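(* Let $0<\alpha<1/2$ and let $\ell:(0,1)\to\mathbb{R}$ be a continuous function supported on $[\alpha,1-\alpha]$. Let $p$ be a probability measure on $\mathbb{R}$ with cdf $P$, and let $x_1,x_2,\ldots$ be independent and identically distributed with law $p$. Let $L(q)=\int_0^1 Q^{-1}(s)\ell(s)\,ds$ (where $Q^{-1}$ is the quantile function of the probability measure $q$), let $v_{jack}=v_{jack}(x_1,\ldots,x_n)$ be the jackknife variance estimator for the functional $L$, let $\mathbb{E}_{\epsilon_n}\phi_{\epsilon_n}^2$ be the infinitesimal jackknife variance estimator, and let $$\sigma^2=\int\int \ell(P(y))\,\Gamma(y,z)\,\ell(P(z))\,dy\,dz,\qquad \Gamma(y,z)=P(y)\wedge P(z)-P(y)P(z).$$ Suppose $p$ has no point masses and $\ell$ is differentiable with $\ell'$ H\''older continuous of order $h>1/2$. Then $$n^{1/2}\left(v_{jack}-\sigma^2\right)=n^{1/2}\left(\mathbb{E}_{\epsilon_n}\phi_{\epsilon_n}^2-\sigma^2\right)+O_s\left(n^{1/2-h}\right),$$ and $n^{1/2}\left(v_{jack}-\sigma^2\right)$ converges in law as $n\to\infty$ to the Gaussian random variable $Y+Z$, where $$Y=\int\int \ell(P(y))\left\{\mathbf{B}(y\wedge z)-P(y)\mathbf{B}(z)-\mathbf{B}(y)P(z)\right\}\ell(P(z))\,dy\,dz,$$ $$Z=2\int\int \ell'(P(y))\,\mathbf{B}(y)\,\Gamma(y,z)\,\ell(P(z))\,dy\,dz,$$ and $\mathbf{B}$ is the $P$-Brownian bridge.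
   Context: The quantile function of a probability measure $q$ on $\mathbb{R}$ with cdf $Q$ is $Q^{-1}(s)=\min\{x:Q(x)\ge s\}$, $0<s<1$. All integrals without limits are over $\mathbb{R}$, with $\ell(u)$ and $\ell'(u)$ taken to be $0$ for $u\in\{0,1\}$ (consistent with $\ell$ vanishing off $[\alpha,1-\alpha]$). $a\wedge b=\min\{a,b\}$. The influence function of $L$ at a probability measure $q$ with cdf $Q$ is $$\phi_q(x)=-\int \ell(Q(y))\,(H_x(y)-Q(y))\,dy,$$ where $H_x$ is the cdf of the point mass $\delta(x)$ at $x$. Given data $x_1,\ldots,x_n$ ($n\ge2$), set $\epsilon_n=\frac1n\sum_{i=1}^n\delta(x_i)$ and $\epsilon_{ni}=\frac1{n-1}\sum_{j\ne i}\delta(x_j)$; let $P_n$ be the cdf of $\epsilon_n$. The jackknife pseudovalues are $Q_{ni}=nL(\epsilon_n)-(n-1)L(\epsilon_{ni})$, $i=1,\ldots,n$, and the jackknife variance estimator is $$v_{jack}(x_1,\ldots,x_n)=\frac1{n-1}\sum_{i=1}^n\left(Q_{ni}-\overline{Q_n}\right)^2,\qquad \overline{Q_n}=\frac1n\sum_{j=1}^nQ_{nj}.$$ The infinitesimal jackknife variance estimator is $$\mathbb{E}_{\epsilon_n}\phi_{\epsilon_n}^2=\frac1n\sum_{i=1}^n\phi_{\epsilon_n}(x_i)^2=\int\int\ell(P_n(y))\left[P_n(y)\wedge P_n(z)-P_n(y)P_n(z)\right]\ell(P_n(z))\,dy\,dz .$$ $\{\mathbf{B}(t)\}_{t\in\mathbb{R}}$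 denotes the mean-zero Gaussian process with covariance $\mathbb{E}[\mathbf{B}(s)\mathbf{B}(t)]=P(s)\wedge P(t)-P(s)P(t)$ that is the limit in law of $n^{1/2}(P_n(t)-P(t))$ given by Donsker's theorem (i.e. a standard Brownian bridge with continuous paths, evaluated at $P(t)$). Notation: for random variables $R_n$ and real numbers $r_n>0$, $R_n=O_s(r_n)$ means that almost surely there is a finite (random) constant $C$ with $|R_n|\le C r_n$ for all sufficiently large $n$. *)

(* Defs.v *)
From HB Require Import structures.
From mathcomp Require Export all_boot all_order all_algebra finmap.
From mathcomp Require Export all_classical all_reals all_analysis.

Set Implicit Arguments.
Unset Strict Implicit.
Unset Printing Implicit Defensive.

Export Order.TTheory GRing.Theory Num.Theory numFieldNormedType.Exports.

Global Open Scope classical_set_scope.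
Global Open Scope ring_scope.

Section empirical_measure.
Context {R : realType} (n : nat) (x : 'I_n -> R) (D : {set 'I_n}).
Local Open Scope ereal_scope.

(* Normalized counting measure of the subsample indexed by D. It is a
   probability as soon as D is nonempty, see empirical_setT. *)
Definition empirical (A : set (measurableTypeR R)) : \bar R :=
  (#|D|%:R^-1)%:E * \sum_(j in D) \d_(x j : measurableTypeR R) A.

Let empirical0 : empirical set0 = 0.
Proof. by rewrite /empirical big1 ?mule0// => j _; rewrite measure0. Qed.

Let empirical_ge0 A : 0 <= empirical A.
Proof. by rewrite /empirical mule_ge0 ?lee_fin// sume_ge0. Qed.

Let empirical_sigma_additive : semi_sigma_additive empirical.
Proof.
have r0 : (0 <= #|D|%:R^-1 :> R)%R by [].
pose r := NngNum r0.
pose m k : {measure set (measurableTypeR R) -> \bar R} :=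
  \d_(nth 0%R [seq x j | j <- enum D] k : measurableTypeR R).
suff -> : empirical = mscale r (msum m #|D|) by exact: measure_semi_sigma_additive.
apply/funext => A; rewrite /empirical /mscale /msum /=; congr (_ * _).
rewrite -[RHS](big_mkord xpredT (fun k => m k A)) /m.
rewrite -[LHS]big_enum -[LHS](big_map x xpredT (fun y => \d_(y : measurableTypeR R) A)).
by rewrite (big_nth 0%R) size_map -cardE.
Qed.

HB.instance Definition _ := isMeasure.Build _ _ _ empirical
  empirical0 empirical_ge0 empirical_sigma_additive.

Lemma empirical_setT : (0 < #|D|)%N -> empirical setT = 1.
Proof.
move=> D0; rewrite /empirical; under eq_bigr do rewrite diracT.
by rewrite sumEFin sumr_const -EFinM mulVf// pnatr_eq0 -lt0n.
Qed.

End empirical_measure.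

Section functional.
Context {R : realType}.
Local Notation mu := (@lebesgue_measure R).
Implicit Types (q : {measure set (measurableTypeR R) -> \bar R}) (l : R -> R).

Definition mcdf q (x : R) : R := fine (q `]-oo, x]%classic).

(* For 0 < s < 1 this infimum is a minimum, see quantile_min. *)
Definition quantile q (s : R) : R := inf [set x | s <= mcdf q x].

(* A function on (0,1) is encoded by l : R -> R, whose values outside (0,1)
   are disregarded: they are replaced by 0. *)
Definition ext01 l (u : R) : R := if 0 < u < 1 then l u else 0.

Definition Lfunctional l q : R :=
  \int[mu]_(s in `]0, 1[) (quantile q s * l s).

Definition influence l q (x : R) : R :=
  - \int[mu]_y (ext01 l (mcdf q y) * (mcdf \d_(x : measurableTypeR R) y - mcdf q y)).

Definition pseudovalue l n (x : 'I_n -> R) (i : 'I_n) : R :=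
  n%:R * Lfunctional l (empirical x [set: 'I_n])
  - n.-1%:R * Lfunctional l (empirical x [set~ i]).

(* This is 0 for n = 1, by the convention 0^-1 = 0. *)
Definition vjack l n (x : 'I_n -> R) : R :=
  let mean := n%:R^-1 * \sum_(j < n) pseudovalue l x j in
  n.-1%:R^-1 * \sum_(i < n) (pseudovalue l x i - mean) ^+ 2.

Definition inf_jack l n (x : 'I_n -> R) : R :=
  n%:R^-1 * \sum_(i < n) influence l (empirical x [set: 'I_n]) (x i) ^+ 2.

Definition Gamma q (y z : R) : R :=
  Num.min (mcdf q y) (mcdf q z) - mcdf q y * mcdf q z.

Definition sigma2 l q : R :=
  \int[mu]_z \int[mu]_y
    (ext01 l (mcdf q y) * Gamma q y z * ext01 l (mcdf q z)).

Definition limit_Y l q (b : R -> R) : R :=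
  \int[mu]_z \int[mu]_y
    (ext01 l (mcdf q y)
     * (b (Num.min y z) - mcdf q y * b z - b y * mcdf q z)
     * ext01 l (mcdf q z)).

Definition limit_Z l q (b : R -> R) : R :=
  2 * \int[mu]_z \int[mu]_y
    (ext01 (derive1 l) (mcdf q y) * b y * Gamma q y z * ext01 l (mcdf q z)).

Definition supported_in l (a b : R) :=
  forall u : R, 0 < u < 1 -> l u != 0 -> a <= u <= b.

Definition hoelder_on01 (h : R) l :=
  exists C : R, forall u v : R, 0 < u < 1 -> 0 < v < 1 ->
    `|l u - l v| <= C * `|u - v| `^ h.

End functional.

Section quantile_is_min.
Context {R : realType} (p : probability (measurableTypeR R) R).

Let idR : measurableTypeR R -> R := idfun.

#[local] HB.instance Definition _ :=
  @isMeasurableFun.Build _ _ _ _ idR (@measurable_id _ _ setT).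

Let F := cdf (idR : {RV p >-> R}).

Let fineFE x : F x = p `]-oo, x]%classic.
Proof. by []. Qed.

Let FE x : F x = (mcdf p x)%:E.
Proof. by rewrite /mcdf fineK ?fin_num_measure// fineFE. Qed.

Let F_le x y : x <= y -> mcdf p x <= mcdf p y.
Proof. by move=> xy; rewrite -lee_fin -!FE; exact: cdf_nondecreasing. Qed.

Lemma quantile_min (s : R) : 0 < s < 1 ->
  s <= mcdf p (quantile p s) /\ forall x, s <= mcdf p x -> quantile p s <= x.
Proof.
move=> /andP[s0 s1].
have [a Fa] : exists a, mcdf p a < s.
  have Fny : mcdf p x @[x --> -oo] --> (0 : R).
    exact: (fine_cvg (@cvg_cdfNy0 _ _ _ _ (idR : {RV p >-> R}))).
  have /filter_ex[a Fa] : \forall x \near -oo, mcdf p x < s.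
    by apply: (cvgr_lt _ Fny).
  by exists a.
have [b Fb] : exists b, s <= mcdf p b.
  have Fy : mcdf p x @[x --> +oo] --> (1 : R).
    exact: (fine_cvg (@cvg_cdfy1 _ _ _ _ (idR : {RV p >-> R}))).
  have /filter_ex[b Fb] : \forall x \near +oo, s < mcdf p x.
    by apply: (cvgr_gt _ Fy).
  by exists b; exact: ltW.
have lbS : has_lbound [set x | s <= mcdf p x].
  exists a => x /= sx; rewrite leNgt; apply/negP => /ltW/F_le xa.
  by have := le_lt_trans (le_trans sx xa) Fa; rewrite ltxx.
split; last by move=> x sx; exact: ge_inf.
rewrite leNgt; apply/negP => Fq.
have Frc : mcdf p x @[x --> at_right (quantile p s)] --> mcdf p (quantile p s).
  have := @cdf_right_continuous _ _ _ _ (idR : {RV p >-> R}) (quantile p s).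
  by rewrite -/F FE => /fine_cvg.
have near_q : \forall x \near at_right (quantile p s),
    mcdf p x < s /\ quantile p s < x.
  by near do split; [exact: (cvgr_lt _ Frc) | exact: nbhs_right_gt].
have [x [Fx qx]] := @filter_ex _ _ (at_right_proper_filter _) _ near_q.
have xq : 0 < x - quantile p s by rewrite subr_gt0.
have inS : has_inf [set x | s <= mcdf p x] by split=> //; exists b.
have [e /= se ex] := @inf_adherent _ [set x | s <= mcdf p x] _ xq inS.
have /F_le ex' : e <= x by rewrite ltW// (lt_le_trans ex)// /quantile addrC subrK.
by have := le_lt_trans (le_trans se ex') Fx; rewrite ltxx.
Unshelve. all: by end_near. Qed.

End quantile_is_min.

Section probability_notions.
Context {R : realType} {d : measure_display} {T : measurableType d}
  (Pr : probability T R).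

Definition mutually_independent (X : nat -> {RV Pr >-> R}) :=
  forall (J : {fset nat}) (A : nat -> set R),
    (forall i, measurable (A i)) ->
    Pr (\bigcap_(i in [set` J]) (X i @^-1` A i)) =
    (\prod_(i <- J) Pr (X i @^-1` A i))%E.

Definition has_law (X : T -> R) (q : set R -> \bar R) :=
  measurable_fun setT X /\
  forall A : set R, measurable A -> Pr (X @^-1` A) = q A.

Definition iid (p : probability (measurableTypeR R) R)
    (X : nat -> {RV Pr >-> R}) :=
  mutually_independent X /\ forall i, has_law (X i) p.

(* The degenerate case is separate because normal_prob m 0 is not \d_m. *)
Definition gaussian (X : T -> R) :=
  (exists m : R, has_law X \d_m) \/
  (exists m s : R, 0 < s /\ has_law X (normal_prob m s)).

Definition big_Os (Rn : nat -> T -> R) (r : nat -> R) :=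
  {ae Pr, forall w, exists C : R, \forall n \near \oo, `|Rn n w| <= C * r n}.

(* Standard Brownian bridge on [0, 1]; W t is unconstrained for t outside
   [0, 1]. *)
Definition brownian_bridge (W : R -> {RV Pr >-> R}) :=
  [/\ forall (n : nat) (t c : 'I_n -> R), (forall i, 0 <= t i <= 1) ->
        gaussian (fun w => \sum_(i < n) c i * W (t i) w),
      forall t : R, 0 <= t <= 1 -> 'E_Pr[W t]%E = 0%E,
      forall s t : R, 0 <= s <= 1 -> 0 <= t <= 1 ->
        'E_Pr[W s \* W t]%E = (Num.min s t - s * t)%:E
    & forall w, {within `[0, 1], continuous (fun t : R => W t w)}].

End probability_notions.

Definition cvg_in_law {R : realType} {d d' : measure_display}
    {T : measurableType d} {T' : measurableType d'}
    (Pr : probability T R) (Pr' : probability T' R)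
    (X : nat -> T -> R) (Y : T' -> R) :=
  [/\ forall n, measurable_fun setT (X n),
      measurable_fun setT Y
    & forall f : R -> R, continuous f -> (exists M : R, forall x, `|f x| <= M) ->
        \int[Pr]_w f (X n w) @[n --> \oo] --> \int[Pr']_w f (Y w)].

(* Main.v *)
(* Write F for the cdf of p, F_n for the empirical cdf, D_n = F_n - F, and lam
   for l extended by 0. If a measure has cdf Q with Q(a) < alpha and
   Q(b) >= 1 - alpha, then L = b M(1) - \int_a^b M(Q(y)) dy, where M is a
   primitive of lam. Off an event of exponentially small probability this
   applies, with a and b fixed, to the empirical measure and to all its
   leave-one-out versions, and a Taylor expansion of M shows that v_jack and the
   infinitesimal jackknife differ by O(1/n); Borel-Cantelli gives the O_s
   statement for h <= 1, and l = 0 when h > 1.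
   The infinitesimal jackknife is the functional sigma^2 at the empirical
   measure. Expanding it around p gives sqrt(n) \int_a^b D_n(y) K(y) dy + o_P(1)
   for an explicit bounded weight K. This is a normalized sum of bounded centered
   iid variables, and Lindeberg's replacement argument yields its limit.
   Finally Y + Z = \int_a^b B(y) K(y) dy is a pointwise limit of Riemann sums of
   the bridge, hence a centered Gaussian. Its variance is the one of the summands,
   because the same Riemann sums of 1[x <= y] - F(y) have the same covariance. *)
Require Import Defs.
From HB Require Import structures.
From mathcomp Require Import measurable_realfun.
From mathcomp Require Import ring lra.

Set Implicit Arguments.
Unset Strict Implicit.
Unset Printing Implicit Defensive.

(** * Integrals of bounded functions *)

Section bounded_integrals.
Context {R : realType} d (T : measurableType d) (mu : {measure set T -> \bar R}).
Variables (D : set T).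
Hypotheses (mD : measurable D) (Dfin : (mu D < +oo)%E).

Lemma integrable_bounded (f : T -> R) (M : R) : measurable_fun D f ->
  (forall x, D x -> `|f x| <= M) -> mu.-integrable D (EFin \o f).
Proof.
move=> mf fM; apply: measurable_bounded_integrable => //.
exists M; split; first exact: num_real.
by move=> r Mr x Dx /=; rewrite (le_trans (fM _ Dx))// ltW.
Qed.

Lemma Rintegral_bounded (f : T -> R) (M : R) : measurable_fun D f ->
  (forall x, D x -> `|f x| <= M) ->
  `|\int[mu]_(x in D) f x| <= M * fine (mu D).
Proof.
move=> mf fM; have fi := integrable_bounded mf fM.
apply: le_trans (le_normr_Rintegral mD fi) _.
rewrite -Rintegral_cst//; apply: le_Rintegral => //.
  exact: (integrable_norm fi).
by apply: (@integrable_bounded _ `|M|) => //.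
Qed.

Lemma Rintegral_bounded_cvg (f : nat -> T -> R) (g : T -> R) (M : R) :
  (forall n, measurable_fun D (f n)) ->
  (forall n x, D x -> `|f n x| <= M) ->
  (forall x, D x -> f n x @[n --> \oo] --> g x) ->
  \int[mu]_(x in D) f n x @[n --> \oo] --> \int[mu]_(x in D) g x.
Proof.
move=> mf fM fg.
have mg : measurable_fun D g by exact: (@measurable_fun_cvg _ _ _ _ f).
have gM x : D x -> `|g x| <= M.
  move=> Dx; have ng : `|f n x| @[n --> \oo] --> `|g x| by apply: cvg_norm; exact: fg.
  rewrite -(cvg_lim (@Rhausdorff R) ng); apply: limr_le; first by apply/cvg_ex; exists `|g x|.
  by apply: nearW => n; exact: fM.
have cvgE : (\int[mu]_(x in D) (f n x)%:E @[n --> \oo] -->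
    \int[mu]_(x in D) (g x)%:E)%E.
  apply: (@dominated_cvg _ _ _ mu D mD (fun n x => (f n x)%:E) _ (cst M%:E)) => //.
  - by move=> n; apply/measurable_EFinP.
  - by move=> x Dx; apply: cvg_EFin; [exact: nearW|exact: fg].
  - by apply: (@integrable_bounded (cst M) `|M|).
rewrite -(@fineK _ (\int[mu]_(x in D) (g x)%:E)%E) in cvgE; last first.
  by apply: integrable_fin_num => //; exact: (integrable_bounded mg gM).
exact: (fine_cvg cvgE).
Qed.

End bounded_integrals.

Section bounded_fubini.
Context {R : realType} d1 d2 (T1 : measurableType d1) (T2 : measurableType d2).
Variables (m1 : {sigma_finite_measure set T1 -> \bar R}).
Variables (m2 : {sigma_finite_measure set T2 -> \bar R}).
Variables (A : set T1) (B : set T2) (f : T1 * T2 -> R) (M : R).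
Hypotheses (mA : measurable A) (mB : measurable B).
Hypotheses (Afin : (m1 A < +oo)%E) (Bfin : (m2 B < +oo)%E).
Hypotheses (mf : measurable_fun setT f) (fM : forall z, `|f z| <= M).
Hypothesis (f0 : forall x y, ~ (A x /\ B y) -> f (x, y) = 0).

Lemma integrable_box : (m1 \x m2)%E.-integrable setT (EFin \o f).
Proof.
have mAB : measurable (A `*` B) by exact: measurableX.
have -> : EFin \o f = (EFin \o f) \_ (A `*` B).
  apply/funext => -[x y]; rewrite patchE; case: ifPn => // /negP xyAB /=.
  by rewrite f0//; move/mem_set: (xyAB); rewrite inE in xyAB *.
apply/(integrable_mkcond (EFin \o f) mAB).
apply: (@integrable_bounded _ _ _ _ _ mAB _ _ M).
- rewrite /= product_measure1E//.
  by rewrite lte_mul_pinfty// ge0_fin_numE.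
- exact: measurable_funTS.
- by move=> z _; exact: fM.
Qed.

Let if_ := integrable_box.

Let fin1 x : (\int[m2]_y (f (x, y))%:E)%E \is a fin_num.
Proof.
apply: integrable_fin_num => //.
have -> : (fun y => (f (x, y))%:E) = (fun y => (f (x, y))%:E) \_ B.
  apply/funext => y; rewrite patchE; case: ifPn => // /negP yB.
  by rewrite f0// => -[_ By]; apply: yB; exact/mem_set.
apply/(integrable_mkcond (fun y => (f (x, y))%:E) mB).
apply: (@integrable_bounded _ _ _ _ _ mB _ (fun y => f (x, y)) M) => //.
apply: measurable_funTS; apply: measurableT_comp => //.
Qed.

Let fin2 y : (\int[m1]_x (f (x, y))%:E)%E \is a fin_num.
Proof.
apply: integrable_fin_num => //.
have -> : (fun x => (f (x, y))%:E) = (fun x => (f (x, y))%:E) \_ A.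
  apply/funext => x; rewrite patchE; case: ifPn => // /negP yB.
  by rewrite f0// => -[Ay _]; apply: yB; exact/mem_set.
apply/(integrable_mkcond (fun x => (f (x, y))%:E) mA).
apply: (@integrable_bounded _ _ _ _ _ mA _ (fun x => f (x, y)) M) => //.
apply: measurable_funTS; apply: measurableT_comp => //.
Qed.

Lemma Rfubini : \int[m1]_x \int[m2]_y f (x, y) = \int[m2]_y \int[m1]_x f (x, y).
Proof.
rewrite /Rintegral; congr fine.
under eq_integral do rewrite fineK//.
under [RHS]eq_integral do rewrite fineK//.
exact: (Fubini if_).
Qed.

Lemma measurable_Rintegral2 : measurable_fun setT (fun x => \int[m2]_y f (x, y)).
Proof. by apply: measurableT_comp => //; exact: (measurable_fubini_F if_). Qed.

Lemma measurable_Rintegral1 : measurable_fun setT (fun y => \int[m1]_x f (x, y)).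
Proof. by apply: measurableT_comp => //; exact: (measurable_fubini_G if_). Qed.

Lemma integrable_Rintegral2 :
  m1.-integrable setT (fun x => (\int[m2]_y f (x, y))%:E).
Proof.
have := integrable_fubini_F if_; apply: eq_integrable => // x _.
by rewrite /Rintegral fineK.
Qed.

End bounded_fubini.

Section integrable_EFin.
Context {R : realType} d (T : measurableType d) (mu : {measure set T -> \bar R}).
Variables (D : set T).
Hypothesis mD : measurable D.
Implicit Types f g : T -> R.

Lemma integrable_EFinD f g : mu.-integrable D (EFin \o f) ->
  mu.-integrable D (EFin \o g) -> mu.-integrable D (fun x => (f x + g x)%:E).
Proof.
move=> fi gi; have := integrableD mD fi gi.
by apply: eq_integrable => // x _.
Qed.

Lemma integrable_EFinB f g : mu.-integrable D (EFin \o f) ->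
  mu.-integrable D (EFin \o g) -> mu.-integrable D (fun x => (f x - g x)%:E).
Proof.
move=> fi gi; have := integrableB mD fi gi.
by apply: eq_integrable => // x _.
Qed.

Lemma integrable_EFinZ (k : R) f : mu.-integrable D (EFin \o f) ->
  mu.-integrable D (fun x => (k * f x)%:E).
Proof.
move=> fi; have := integrableZl mD k fi.
by apply: eq_integrable => // x _.
Qed.

Lemma integrable_EFin_sum I (s : seq I) (f : I -> T -> R) :
  (forall i, mu.-integrable D (EFin \o f i)) ->
  mu.-integrable D (fun x => (\sum_(i <- s) f i x)%:E).
Proof.
move=> fi; elim: s => [|i s ih].
  have := @integrable0 _ _ _ mu D; apply: eq_integrable => // x _.
  by rewrite big_nil.
have := integrable_EFinD (fi i) ih; apply: eq_integrable => // x _.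
by rewrite big_cons.
Qed.

Lemma Rintegral_sum I (s : seq I) (f : I -> T -> R) :
  (forall i, mu.-integrable D (EFin \o f i)) ->
  \int[mu]_(x in D) (\sum_(i <- s) f i x) = \sum_(i <- s) \int[mu]_(x in D) f i x.
Proof.
move=> fi; elim: s => [|i s ih].
  under eq_Rintegral do rewrite big_nil.
  by rewrite big_nil Rintegral_cst// mul0r.
under eq_Rintegral do rewrite big_cons.
by rewrite RintegralD// ?big_cons ?ih//; exact: integrable_EFin_sum.
Qed.

End integrable_EFin.

Section probability_integrals.
Context {R : realType} d (T : measurableType d) (P : probability T R).
Implicit Types f g : T -> R.

Lemma integrable_prob_bounded f (M : R) : measurable_fun setT f ->
  (forall x, `|f x| <= M) -> P.-integrable setT (EFin \o f).
Proof.
move=> mf fM; have Pfin : (P setT < +oo)%E by rewrite probability_setT ltry.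
exact: (@integrable_bounded _ _ _ P _ measurableT Pfin f M mf (fun x _ => fM x)).
Qed.

Lemma integrable_prob_cst (r : R) : P.-integrable setT (EFin \o cst r).
Proof. exact: (@integrable_prob_bounded (cst r) `|r|). Qed.

Lemma Rintegral_prob_cst (r : R) : \int[P]_x r = r.
Proof.
rewrite Rintegral_cst// -[RHS]mulr1; congr (_ * _).
by rewrite -[RHS]/(fine 1%E) -(probability_setT P).
Qed.

Lemma Rintegral_prob_bounded f (M : R) : measurable_fun setT f ->
  (forall x, `|f x| <= M) -> `|\int[P]_x f x| <= M.
Proof.
move=> mf fM; have Pfin : (P setT < +oo)%E by rewrite probability_setT ltry.
have := @Rintegral_bounded _ _ _ P _ measurableT Pfin f M mf (fun x _ => fM x).
by rewrite -[X in fine X]/(P setT) probability_setT mulr1.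
Qed.

Lemma Rintegral_prob_cvg (f : nat -> T -> R) (g : T -> R) (M : R) :
  (forall n, measurable_fun setT (f n)) -> (forall n x, `|f n x| <= M) ->
  (forall x, f n x @[n --> \oo] --> g x) ->
  \int[P]_x f n x @[n --> \oo] --> \int[P]_x g x.
Proof.
move=> mf fM fg; have Pfin : (P setT < +oo)%E by rewrite probability_setT ltry.
exact: (@Rintegral_bounded_cvg _ _ _ P _ measurableT Pfin f g M mf (fun n x _ => fM n x)).
Qed.

Lemma integrable_prob_affine f (r k : R) : P.-integrable setT (EFin \o f) ->
  P.-integrable setT (fun x => (r + k * f x)%:E).
Proof.
move=> fi; apply: (@integrable_EFinD _ _ _ P _ measurableT (cst r)).
  exact: integrable_prob_cst.
exact: integrable_EFinZ.
Qed.

Lemma Rintegral_prob_affine f (r k : R) : P.-integrable setT (EFin \o f) ->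
  \int[P]_x (r + k * f x) = r + k * \int[P]_x f x.
Proof.
move=> fi; rewrite (@RintegralD _ _ _ P setT (cst r)).
- by rewrite RintegralZl// Rintegral_prob_cst.
- by [].
- exact: integrable_prob_cst.
- exact: integrable_EFinZ.
Qed.

Lemma integrable_prob_affine2 f g (r k k' : R) :
  P.-integrable setT (EFin \o f) -> P.-integrable setT (EFin \o g) ->
  P.-integrable setT (fun x => (r + k * f x + k' * g x)%:E).
Proof.
move=> fi gi; apply: (@integrable_EFinD _ _ _ P _ measurableT (fun x => r + k * f x)).
  exact: integrable_prob_affine.
exact: integrable_EFinZ.
Qed.

Lemma Rintegral_prob_affine2 f g (r k k' : R) :
  P.-integrable setT (EFin \o f) -> P.-integrable setT (EFin \o g) ->
  \int[P]_x (r + k * f x + k' * g x) = r + k * \int[P]_x f x + k' * \int[P]_x g x.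
Proof.
move=> fi gi; rewrite (@RintegralD _ _ _ P setT (fun x => r + k * f x)).
- by rewrite Rintegral_prob_affine// RintegralZl.
- by [].
- exact: integrable_prob_affine.
- exact: integrable_EFinZ.
Qed.

Lemma EFin_Rintegral f : P.-integrable setT (EFin \o f) ->
  (\int[P]_x f x)%:E = (\int[P]_x (f x)%:E)%E.
Proof. by move=> fi; rewrite fineK//; exact: integrable_fin_num. Qed.

Lemma le_Rintegral_prob f g : P.-integrable setT (EFin \o f) ->
  P.-integrable setT (EFin \o g) -> (forall x, f x <= g x) ->
  \int[P]_x f x <= \int[P]_x g x.
Proof. by move=> fi gi fg; apply: le_Rintegral. Qed.

End probability_integrals.

Section shift.
Context {R : realType}.

Lemma EFin_Rintegral_shift d (T : measurableType d) (P : probability T R)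
    (f : T -> R) (M : R) : P.-integrable setT (EFin \o f) ->
  (M + \int[P]_x f x)%:E = (\int[P]_x (M + f x)%:E)%E.
Proof.
move=> fi; have := Rintegral_prob_affine M 1 fi.
rewrite mul1r => <-; rewrite /Rintegral fineK.
  by apply: eq_integral => x _; rewrite mul1r.
by apply: integrable_fin_num => //; exact: integrable_prob_affine.
Qed.

Lemma Rintegral_eq_shift d (T : measurableType d) (P : probability T R)
    d' (T' : measurableType d') (P' : probability T' R)
    (f : T -> R) (g : T' -> R) (M : R) :
  P.-integrable setT (EFin \o f) -> P'.-integrable setT (EFin \o g) ->
  (\int[P]_x (M + f x)%:E = \int[P']_x (M + g x)%:E)%E ->
  \int[P]_x f x = \int[P']_x g x.
Proof.
move=> fi gi fg; apply: (addrI M); apply: EFin_inj.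
by rewrite [LHS](EFin_Rintegral_shift M fi) [RHS](EFin_Rintegral_shift M gi).
Qed.

End shift.

Section lebesgue_segment.
Context {R : realType}.
Local Notation mu := (@lebesgue_measure R).

Lemma lebesgue_segment (a b : R) : a <= b -> mu `[a, b]%classic = (b - a)%:E.
Proof.
move=> ab; rewrite lebesgue_measure_itv/= lte_fin.
case: ifPn => [_|]; first by rewrite -EFinB.
by rewrite -leNgt => ba; rewrite (_ : a = b) ?subrr//; apply/le_anti; rewrite ab.
Qed.

Lemma lebesgue_segment_lty (a b : R) : (mu `[a, b]%classic < +oo)%E.
Proof.
have [ab|ba] := leP a b; first by rewrite lebesgue_segment// ltry.
by rewrite set_itv_ge ?measure0// bnd_simp -ltNge.
Qed.

Lemma Rintegral_indic_segment (a b : R) : a <= b ->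
  \int[mu]_x \1_`[a, b] x = b - a.
Proof.
move=> ab; rewrite /Rintegral integral_indic// setIT.
exact: (congr1 fine (lebesgue_segment ab)).
Qed.

Lemma integrable_segment (a b : R) (f : R -> R) (M : R) : measurable_fun setT f ->
  (forall y, y \in `[a, b] -> `|f y| <= M) -> mu.-integrable `[a, b] (EFin \o f).
Proof.
move=> mf fM; have mab : @measurable _ (measurableTypeR R) `[a, b]%classic by exact: measurable_itv.
exact: (@integrable_bounded _ _ _ mu _ mab (lebesgue_segment_lty a b) f M (measurable_funTS mf)).
Qed.

Lemma Rintegral_segment_bounded (a b : R) (f : R -> R) (M : R) : a <= b ->
  measurable_fun setT f -> (forall y, y \in `[a, b] -> `|f y| <= M) ->
  `|\int[mu]_(y in `[a, b]) f y| <= M * (b - a).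
Proof.
move=> ab mf fM; have mab : @measurable _ (measurableTypeR R) `[a, b]%classic by exact: measurable_itv.
rewrite -[X in _ * X]/(fine (b - a)%:E) -(lebesgue_segment ab).
exact: (@Rintegral_bounded _ _ _ mu _ mab (lebesgue_segment_lty a b) f M (measurable_funTS mf)).
Qed.

End lebesgue_segment.

Section measurability_2d.
Context {R : realType}.

Lemma measurable_le2 : measurable_fun setT (fun z : R * R => (z.1 <= z.2)%R%:R : R).
Proof.
have -> : (fun z : R * R => (z.1 <= z.2)%R%:R) =
    (\1_[set z : R * R | z.1 <= z.2] : R * R -> R).
  by apply/funext => z; rewrite indicE mem_setE.
apply: measurable_indic.
rewrite (_ : [set _ | _] = (fun z => z.1 <= z.2) @^-1` [set true])//.
have := @measurable_fun_ler _ _ _ setT (fun z : R * R => z.1) (fun z => z.2).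
move=> /(_ measurable_fst measurable_snd) mb.
by rewrite -[X in measurable X]setTI; exact: mb.
Qed.

Lemma measurable_lt2 : measurable_fun setT (fun z : R * R => (z.1 < z.2)%R%:R : R).
Proof.
have -> : (fun z : R * R => (z.1 < z.2)%R%:R) = (fun z : R * R => 1 - (z.2 <= z.1)%R%:R) :> (_ -> R).
  by apply/funext => z; rewrite ltNge; case: (_ <= _); rewrite ?subr0 ?subrr.
apply: measurable_funB => //.
exact: (measurableT_comp measurable_le2 (measurable_fun_pair measurable_snd measurable_fst)).
Qed.

End measurability_2d.

(** * The standard normal law *)

Section normal_density.
Context {R : realType}.
Local Notation mu := (@lebesgue_measure R).
Implicit Types (m s : R) (f : R -> R).

Lemma ge0_integral_normal_prob m s (f : R -> \bar R) :
  (forall x, 0 <= f x)%E -> measurable_fun setT f ->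
  (\int[normal_prob m s]_x f x = \int[mu]_x (f x * (normal_pdf m s x)%:E))%E.
Proof.
move=> f0 mf; have dom := normal_prob_dominates m s.
rewrite -(Radon_Nikodym_SigmaFinite.change_of_variables dom f0 measurableT mf).
apply: ae_eq_integral => //.
- apply: emeasurable_funM => //; apply: (measurable_int mu).
  exact: Radon_Nikodym_SigmaFinite.f_integrable.
- apply: emeasurable_funM => //=; apply/measurable_EFinP.
  exact: measurable_normal_pdf.
- apply: ae_eqe_mul2l => /=; apply: integral_ae_eq => //=.
  + exact: Radon_Nikodym_SigmaFinite.f_integrable.
  + by apply/measurable_EFinP; exact: measurable_normal_pdf.
  + by move=> E _ mE; rewrite -Radon_Nikodym_SigmaFinite.f_integral.
Qed.

Lemma normal_peak_scale s : 0 < s -> normal_peak s = s^-1 * normal_peak 1.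
Proof.
move=> s0; rewrite /normal_peak -[RHS]invfM; congr (_^-1).
by rewrite expr1n mul1r -mulrnAr sqrtrM ?sqr_ge0// sqrtr_sqr gtr0_norm// mulrC.
Qed.

Lemma normal_pdf_posE m s x : 0 < s -> normal_pdf m s x =
  s^-1 * normal_peak 1 * expR (- (x - m) ^+ 2 / (s ^+ 2 *+ 2)).
Proof. by move=> s0; rewrite normal_pdfE ?gt_eqF// normal_peak_scale. Qed.

Lemma ge0_integral_normal_scale f m s : 0 < s -> continuous f ->
  (forall x, 0 <= f x) ->
  (\int[normal_prob m s]_x (f x)%:E =
   \int[normal_prob 0%R 1%R]_z (f (m + s * z))%:E)%E.
Proof.
move=> s0 cf f0.
have mf : measurable_fun setT f by exact: continuous_measurable_fun.
have cg : continuous (fun z => m + s * z).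
  move=> z; apply: (@cvgD _ R^o); first exact: cvg_cst.
  by apply: cvgM; [exact: cvg_cst|exact: cvg_id].
have mfg : measurable_fun setT (fun z => f (m + s * z)).
  by apply: measurableT_comp => //; exact: continuous_measurable_fun.
have key x : normal_pdf m s (m + s * x) * s = normal_pdf 0 1 x.
  rewrite !normal_pdf_posE//.
  have -> : - (m + s * x - m) ^+ 2 / (s ^+ 2 *+ 2) = - (x - 0) ^+ 2 / (1 ^+ 2 *+ 2).
    by field; rewrite gt_eqF.
  by field; rewrite gt_eqF.
transitivity (\int[mu]_x (f x * normal_pdf m s x)%:E)%E.
  apply: (ge0_integral_normal_prob m s) => [x|]; first by rewrite lee_fin.
  exact/measurable_EFinP.
transitivity (\int[mu]_x (f (m + s * x) * normal_pdf 0 1 x)%:E)%E; last first.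
  symmetry; apply: (ge0_integral_normal_prob 0 1) => [x|]; first by rewrite lee_fin.
  exact/measurable_EFinP.
have dF (x : R) : is_derive x (1:R) (fun z => m + s * z) s.
  by apply: is_derive_eq; rewrite add0r mul1r /GRing.scale/= mulr1.
have F'E : (fun z => m + s * z)^`()%classic = cst s.
  by apply/funext => x; rewrite derive1E; exact: derive_val.
rewrite (@increasing_ge0_integration_by_substitutionT R (fun z => m + s * z)
  (fun x => f x * normal_pdf m s x)); last 1 first.
- by move=> x; rewrite mulr_ge0// normal_pdf_ge0.
- apply: eq_integral => x _; rewrite F'E; congr EFin.
  rewrite -[RHS]/((f (m + s * x)) * normal_pdf 0 1 x) -key mulrA.
  by [].
- by move=> x y xy; rewrite ltrD2l ltr_pM2l.
- by rewrite F'E => x; exact: cvg_cst.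
- by rewrite F'E; exact: is_cvg_cst.
- by rewrite F'E; exact: is_cvg_cst.
- by move=> x.
- apply: (cvg_comp (fun z => s * z) (fun y => m + y)); last exact: cvg_addrl_Ny.
  by apply: gt0_cvgMrNy => //; exact: cvg_id.
- apply: (cvg_comp (fun z => s * z) (fun y => m + y)); last exact: cvg_addrl.
  by apply: gt0_cvgMry => //; exact: cvg_id.
- move=> x; apply: cvgM; first exact: cf.
  by apply: continuous_normal_pdf; rewrite gt_eqF.
Qed.

End normal_density.

Section standard_normal.
Context {R : realType}.
Local Notation mu := (@lebesgue_measure R).
Local Notation gam := (@normal_prob R 0 1).
Implicit Types (a b c s : R) (f : R -> R).

Lemma normal_exp_square s : 0 < s ->
  (\int[gam]_z (expR ((1 - s ^- 2) / 2 * z ^+ 2))%:E = s%:E)%E.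
Proof.
move=> s0.
have mf : measurable_fun setT (fun z : R => expR ((1 - s ^- 2) / 2 * z ^+ 2)).
  by apply: measurableT_comp => //; apply: measurable_funM => //; exact: measurable_funX.
transitivity (\int[mu]_z (s%:E * (normal_pdf 0 s z)%:E))%E; last first.
  rewrite integralZl//; last exact: integrable_normal_pdf.
  by rewrite integral_normal_pdf mule1.
rewrite (@ge0_integral_normal_prob R 0 1 (fun z => (expR ((1 - s ^- 2) / 2 * z ^+ 2))%:E)).
- apply: eq_integral => z _; rewrite -!EFinM; congr EFin.
  rewrite !normal_pdf_posE// invr1 mul1r mulrCA -expRD [in RHS]mulrA [in RHS](mulrA s) mulfV ?gt_eqF// mul1r.
  congr (_ * expR _); field; rewrite gt_eqF//.
- by move=> z; rewrite lee_fin expR_ge0.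
- exact/measurable_EFinP.
Qed.

Lemma normal_exp_linear a :
  (\int[gam]_z (expR (a * z - a ^+ 2 / 2))%:E = 1)%E.
Proof.
have mf : measurable_fun setT (fun z : R => expR (a * z - a ^+ 2 / 2)).
  by apply: measurableT_comp => //; apply: measurable_funB => //; exact: measurable_funM.
rewrite -(integral_normal_pdf a (1:R)).
rewrite (@ge0_integral_normal_prob R 0 1 (fun z => (expR (a * z - a ^+ 2 / 2))%:E)).
- apply: eq_integral => z _; rewrite -!EFinM; congr EFin.
  rewrite !normal_pdf_posE// mulrCA -expRD; congr (_ * expR _); by field.
- by move=> z; rewrite lee_fin expR_ge0.
- exact/measurable_EFinP.
Qed.

Lemma normal_exp_quarter_integrable :
  gam.-integrable setT (fun z => (expR (4^-1 * z ^+ 2))%:E).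
Proof.
have mf : measurable_fun setT (fun z : R => expR (4^-1 * z ^+ 2)).
  by apply: measurableT_comp => //; apply: measurable_funM => //; exact: measurable_funX.
apply/integrableP; split; first exact/measurable_EFinP.
have s0 : 0 < Num.sqrt 2 :> R by rewrite sqrtr_gt0.
have := normal_exp_square s0; rewrite sqr_sqrtr//.
rewrite (_ : (1 - 2^-1) / 2 = 4^-1); last by field.
under [in X in _ -> X]eq_integral do rewrite gee0_abs ?lee_fin ?expR_ge0//.
by move=> ->; rewrite ltry.
Qed.

Lemma cube_le_expR_quarter z : `|z| ^+ 3 <= 1 + 64 * expR (4^-1 * z ^+ 2) :> R.
Proof.
have h1 : 1 + z ^+ 2 / 8 <= expR (z ^+ 2 / 8) by exact: expR_ge1Dx.
have h2 : expR (4^-1 * z ^+ 2) = expR (z ^+ 2 / 8) ^+ 2.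
  by rewrite [RHS]expr2 -expRD; congr expR; by field.
have h3 : (z ^+ 2 / 8) ^+ 2 <= expR (4^-1 * z ^+ 2).
  rewrite h2 ler_sqr ?nnegrE ?expR_ge0//; first by lra.
  by rewrite mulr_ge0// sqr_ge0.
have e4 : (`|z| ^+ 2) ^+ 2 = 64 * (z ^+ 2 / 8) ^+ 2.
  by rewrite real_normK ?num_real//; field.
have a0 := normr_ge0 z; set y := `|z| in a0 e4 *.
have [y1|y1] := leP y 1.
  have : y ^+ 3 <= 1 by rewrite exprn_ile1.
  have := expR_ge0 (4^-1 * z ^+ 2); lra.
have : y ^+ 3 <= (y ^+ 2) ^+ 2 by rewrite -exprM; apply: ler_weXn2l => //; exact: ltW.
lra.
Qed.

Lemma normal_cube_integrable :
  gam.-integrable setT (fun z => (`|z| ^+ 3)%:E).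
Proof.
have i2 : gam.-integrable setT (fun z => (1 + 64 * expR (4^-1 * z ^+ 2))%:E).
  apply: (@integrable_EFinD _ _ _ gam _ measurableT (cst 1)); first exact: integrable_prob_cst.
  exact: (integrable_EFinZ measurableT 64 normal_exp_quarter_integrable).
apply: (le_integrable measurableT _ _ i2).
  by apply/measurable_EFinP; apply: measurable_funX; exact: normr_measurable.
move=> z _; rewrite lee_fin (ger0_norm (exprn_ge0 _ (normr_ge0 _))).
exact: le_trans (cube_le_expR_quarter z) (ler_norm _).
Qed.

Lemma normal_bounded_by_cube_integrable f (C : R) : measurable_fun setT f ->
  (forall z, `|f z| <= C * (1 + `|z| ^+ 3)) -> gam.-integrable setT (EFin \o f).
Proof.
move=> mf fC.
have i2 : gam.-integrable setT (fun z => (C * (1 + `|z| ^+ 3))%:E).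
  apply: (@integrable_EFinZ _ _ _ gam _ measurableT C (fun z => 1 + `|z| ^+ 3)).
  apply: (@integrable_EFinD _ _ _ gam _ measurableT (cst 1)); first exact: integrable_prob_cst.
  exact: normal_cube_integrable.
apply: (le_integrable measurableT _ _ i2); first exact/measurable_EFinP.
by move=> z _; rewrite lee_fin; exact: le_trans (fC z) (ler_norm _).
Qed.

Lemma normal_id_integrable : gam.-integrable setT (fun z => z%:E).
Proof.
apply: (@normal_bounded_by_cube_integrable id 1) => // z; rewrite mul1r.
have a0 := normr_ge0 z; set y := `|z| in a0 *.
have [y1|y1] := leP y 1; first by have := exprn_ge0 3 a0; rewrite /=; lra.
have : y ^+ 1 <= y ^+ 3 by apply: ler_weXn2l => //; exact: ltW.
by rewrite expr1 /=; lra.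
Qed.

Lemma normal_square_integrable : gam.-integrable setT (fun z => (z ^+ 2)%:E).
Proof.
apply: (@normal_bounded_by_cube_integrable (fun z => z ^+ 2) 1) => [|z].
  exact: measurable_funX.
rewrite mul1r normrX; have a0 := normr_ge0 z; set y := `|z| in a0 *.
have [y1|y1] := leP y 1.
  have : y ^+ 2 <= 1 by rewrite exprn_ile1.
  have := exprn_ge0 3 a0; lra.
have : y ^+ 2 <= y ^+ 3 by apply: ler_weXn2l => //; exact: ltW.
lra.
Qed.

(* The bound 1 + k z^2 <= exp (k z^2) integrates to 1 + (1 - s^-2) / 2 * q <= s for
   all s > 0, with equality at s = 1; comparing slopes there gives q = 1. *)
Lemma normal_variance : \int[gam]_z (z ^+ 2) = 1.
Proof.
set q := \int[gam]_z (z ^+ 2).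
have q0 : 0 <= q by apply: Rintegral_ge0 => z _; exact: sqr_ge0.
have key s : 0 < s -> 1 + (1 - s ^- 2) / 2 * q <= s.
  move=> s0; set k := (1 - s ^- 2) / 2.
  have ei : gam.-integrable setT (fun z => (expR (k * z ^+ 2))%:E).
    apply/integrableP; split.
      apply/measurable_EFinP; apply: measurableT_comp => //.
      by apply: measurable_funM => //; exact: measurable_funX.
    under eq_integral do rewrite gee0_abs ?lee_fin ?expR_ge0//.
    by rewrite normal_exp_square// ltry.
  have es : \int[gam]_z expR (k * z ^+ 2) = s.
    by rewrite /Rintegral normal_exp_square.
  rewrite -[leRHS]es -[leLHS](Rintegral_prob_affine 1 k normal_square_integrable).
  apply: le_Rintegral_prob => //; last by move=> z; exact: expR_ge1Dx.
  exact: (integrable_prob_affine 1 k normal_square_integrable).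
have key2 s : 0 < s -> (s ^+ 2 - 1) * q <= 2 * s ^+ 2 * (s - 1).
  move=> s0; have := key s s0.
  have -> : (1 - s ^- 2) / 2 * q = (s ^+ 2 - 1) * q / (2 * s ^+ 2).
    by field; rewrite gt_eqF.
  rewrite -lerBrDl ler_pdivrMr; last by rewrite mulr_gt0// exprn_gt0.
  by rewrite [X in _ <= X -> _]mulrC.
apply/eqP; rewrite eq_le; apply/andP; split; rewrite leNgt; apply/negP => q1.
- pose t := Num.min 1 ((q - 1) / 3).
  have t0 : 0 < t by rewrite lt_min ltr01/=; lra.
  have t1 : t <= 1 by rewrite ge_min lexx.
  have t2 : t <= (q - 1) / 3 by rewrite ge_min lexx orbT.
  have s0 : 0 < 1 + t by lra.
  have := key2 _ s0.
  have -> : ((1 + t) ^+ 2 - 1) * q = t * ((2 + t) * q) by ring.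
  have -> : 2 * (1 + t) ^+ 2 * (1 + t - 1) = t * (2 * (1 + t) ^+ 2) by ring.
  rewrite ler_pM2l//.
  have : t * t <= t by rewrite ger_pMl.
  have : 0 < t * q by rewrite mulr_gt0//; lra.
  lra.
- pose t := Num.min (1/2) ((1 - q) / 4).
  have t0 : 0 < t by rewrite lt_min; apply/andP; split; lra.
  have t1 : t <= 1 / 2 by rewrite ge_min lexx.
  have t2 : t <= (1 - q) / 4 by rewrite ge_min lexx orbT.
  have s0 : 0 < 1 - t by lra.
  have := key2 _ s0.
  have -> : ((1 - t) ^+ 2 - 1) * q = t * - ((2 - t) * q) by ring.
  have -> : 2 * (1 - t) ^+ 2 * (1 - t - 1) = t * - (2 * (1 - t) ^+ 2) by ring.
  rewrite ler_pM2l// lerN2.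
  have : 0 <= t * q by rewrite mulr_ge0//; lra.
  have : 0 <= t * t by rewrite mulr_ge0//; lra.
  lra.
Qed.

(* 1 + (a z - a^2 / 2) <= exp (a z - a^2 / 2) integrates to a m <= a^2 / 2 for all a. *)
Lemma normal_mean : \int[gam]_z z = 0.
Proof.
set m := \int[gam]_z z.
have key a : a * m <= a ^+ 2 / 2.
  have ei : gam.-integrable setT (fun z => (expR (a * z - a ^+ 2 / 2))%:E).
    apply/integrableP; split.
      apply/measurable_EFinP; apply: measurableT_comp => //.
      by apply: measurable_funB => //; exact: measurable_funM.
    under eq_integral do rewrite gee0_abs ?lee_fin ?expR_ge0//.
    by rewrite normal_exp_linear ltry.
  have es : \int[gam]_z expR (a * z - a ^+ 2 / 2) = 1.
    by rewrite /Rintegral normal_exp_linear.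
  have : (1 - a ^+ 2 / 2) + a * m <= 1.
    rewrite -[leRHS]es -[leLHS](Rintegral_prob_affine _ a normal_id_integrable).
    apply: le_Rintegral_prob => //.
      exact: (integrable_prob_affine _ a normal_id_integrable).
    by move=> z; rewrite addrAC -addrA; exact: expR_ge1Dx.
  by lra.
have := key m; have : 0 <= m ^+ 2 by rewrite sqr_ge0.
rewrite -expr2 => h1 h2; have /eqP : m ^+ 2 = 0 by lra.
by rewrite sqrf_eq0 => /eqP.
Qed.

End standard_normal.

Section normal_stability.
Context {R : realType}.
Local Notation mu := (@lebesgue_measure R).
Local Notation gam := (@normal_prob R 0 1).
Implicit Types (a b c s : R) (f : R -> R).

Lemma normal_pdf_mixture a b c x w : 0 < b -> 0 < c -> c ^+ 2 = a ^+ 2 + b ^+ 2 ->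
  normal_pdf (a * x) b w * normal_pdf 0 1 x =
  normal_pdf 0 c w * normal_pdf (a * w / c ^+ 2) (b / c) x.
Proof.
move=> b0 c0 cab.
rewrite !normal_pdf_posE ?divr_gt0//; set k := normal_peak 1.
rewrite [LHS]mulrACA -expRD [RHS]mulrACA -expRD; congr (_ * expR _).
  by field; rewrite !gt_eqF.
have -> : (b / c) ^+ 2 = b ^+ 2 / c ^+ 2 by rewrite expr_div_n.
have b2 : 0 < b ^+ 2 by rewrite exprn_gt0.
have ab0 : 0 < a ^+ 2 + b ^+ 2 by rewrite -cab exprn_gt0.
rewrite cab; field.
by rewrite (gt_eqF b0) (gt_eqF ab0).
Qed.

Lemma ge0_normal_stable f a b c : 0 < b -> 0 < c -> c ^+ 2 = a ^+ 2 + b ^+ 2 ->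
  continuous f -> (forall x, 0 <= f x) ->
  (\int[gam]_x \int[gam]_y (f (a * x + b * y))%:E =
   \int[gam]_z (f (c * z))%:E)%E.
Proof.
move=> b0 c0 cab cf f0.
have mf : measurable_fun setT f by exact: continuous_measurable_fun.
transitivity (\int[normal_prob 0%R c]_x (f x)%:E)%E; last first.
  rewrite (ge0_integral_normal_scale 0 c0 cf f0).
  by apply: eq_integral => z _; rewrite add0r.
transitivity (\int[mu]_w (f w * normal_pdf 0 c w)%:E)%E; last first.
  symmetry; apply: (@ge0_integral_normal_prob R 0 c (EFin \o f)); last exact/measurable_EFinP.
  by move=> x; rewrite lee_fin.
transitivity (\int[gam]_x \int[mu]_w (f w * normal_pdf (a * x) b w)%:E)%E.
  apply: eq_integral => x _.
  transitivity (\int[normal_prob (a * x)%R b]_w (f w)%:E)%E.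
    by rewrite (ge0_integral_normal_scale (a * x) b0 cf f0).
  apply: (@ge0_integral_normal_prob R (a * x) b (EFin \o f)); last exact/measurable_EFinP.
  by move=> w; rewrite lee_fin.
pose h (z : R * R) := f z.2 * normal_pdf (a * z.1) b z.2.
have mh : measurable_fun setT h.
  have -> : h = (fun z => f z.2 * (b^-1 * normal_peak 1 *
      expR (- (z.2 - a * z.1) ^+ 2 * (b ^+ 2 *+ 2)^-1))).
    by apply/funext => z; rewrite /h normal_pdf_posE.
  have m1 : measurable_fun [set: R * R] (fun z => f z.2) by exact: measurableT_comp.
  apply: measurable_funM => //; apply: measurable_funM => //.
  apply: measurableT_comp => //; apply: measurable_funM => //.
  apply: measurableT_comp => //; apply: measurable_funX.
  apply: measurable_funB => //; exact: measurable_funM.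
have h0 z : (0 <= (h z)%:E)%E by rewrite lee_fin mulr_ge0// normal_pdf_ge0.
rewrite (@fubini_tonelli _ _ _ _ R gam mu (EFin \o h))//; last exact/measurable_EFinP.
apply: eq_integral => w _; rewrite /fubini_G/= /h/=.
have c2 : 0 < c ^+ 2 by rewrite exprn_gt0.
transitivity (\int[mu]_x ((f w * normal_pdf 0 c w)%:E * (normal_pdf (a * w / c ^+ 2) (b / c) x)%:E))%E.
  have mx : measurable_fun setT (fun x => f w * normal_pdf (a * x) b w).
    exact: (measurableT_comp mh (pair2_measurable _)).
  rewrite (@ge0_integral_normal_prob R 0 1 (fun x => (f w * normal_pdf (a * x) b w)%:E)).
  - apply: eq_integral => x _; rewrite -!EFinM; congr EFin.
    by rewrite -[LHS]mulrA (normal_pdf_mixture x w b0 c0 cab) mulrA.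
  - by move=> x; rewrite lee_fin mulr_ge0// normal_pdf_ge0.
  - exact/measurable_EFinP.
rewrite integralZl//; last exact: integrable_normal_pdf.
by rewrite integral_normal_pdf mule1.
Qed.

Let add_cst_ge0 f (M : R) : (forall x, `|f x| <= M) -> forall x, 0 <= M + f x.
Proof. by move=> fM x; have := fM x; rewrite ler_norml => /andP[]; lra. Qed.

Let add_cst_continuous f (M : R) : continuous f -> continuous (fun x => M + f x).
Proof. by move=> cf x; apply: (@cvgD _ R^o); [exact: cvg_cst|exact: cf]. Qed.

Lemma Rintegral_normal_scale f (M : R) m s : 0 < s -> continuous f ->
  (forall x, `|f x| <= M) ->
  \int[normal_prob m s]_x f x = \int[gam]_z f (m + s * z).
Proof.
move=> s0 cf fM; have mf : measurable_fun setT f by exact: continuous_measurable_fun.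
have i1 : (normal_prob m s).-integrable setT (EFin \o f).
  exact: (integrable_prob_bounded (normal_prob m s) mf fM).
have mg : measurable_fun setT (fun z => f (m + s * z)).
  by apply: measurableT_comp => //; apply: measurable_funD => //; exact: measurable_funM.
have i2 : gam.-integrable setT (fun z => (f (m + s * z))%:E).
  exact: (integrable_prob_bounded gam mg (fun z => fM _)).
apply: (@Rintegral_eq_shift _ _ _ (normal_prob m s) _ _ gam _ _ M i1 i2).
exact: (ge0_integral_normal_scale m s0 (add_cst_continuous cf) (add_cst_ge0 fM)).
Qed.

Lemma normal_stable f (M : R) a b c : 0 <= a -> 0 < b -> 0 < c ->
  c ^+ 2 = a ^+ 2 + b ^+ 2 -> continuous f -> (forall x, `|f x| <= M) ->
  \int[gam]_x \int[gam]_y f (a * x + b * y) = \int[gam]_z f (c * z).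
Proof.
move=> a0 b0 c0 cab cf fM.
have mf : measurable_fun setT f by exact: continuous_measurable_fun.
pose h (z : R * R) := f (a * z.1 + b * z.2).
have mh : measurable_fun setT h.
  apply: measurableT_comp => //; apply: measurable_funD => //; exact: measurable_funM.
have mh1 x : measurable_fun setT (fun y => f (a * x + b * y)).
  by apply: measurableT_comp => //; apply: measurable_funD => //; exact: measurable_funM.
have i1 x : gam.-integrable setT (fun y => (f (a * x + b * y))%:E).
  exact: (integrable_prob_bounded gam (mh1 x) (fun z => fM _)).
have Tfin : (gam setT < +oo)%E by rewrite probability_setT ltry.
have i2 : gam.-integrable setT (fun x => (\int[gam]_y f (a * x + b * y))%:E).
  apply: (@integrable_Rintegral2 _ _ _ _ _ gam gam setT setT h M) => //.
    by move=> z; exact: fM.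
  by move=> x y []; split.
have mfc : measurable_fun setT (fun z => f (c * z)).
  by apply: measurableT_comp => //; exact: measurable_funM.
have i3 : gam.-integrable setT (fun z => (f (c * z))%:E).
  exact: (integrable_prob_bounded gam mfc (fun z => fM _)).
apply: (@Rintegral_eq_shift _ _ _ gam _ _ gam _ _ M i2 i3).
rewrite -(ge0_normal_stable b0 c0 cab (add_cst_continuous cf) (add_cst_ge0 fM)).
by apply: eq_integral => x _; rewrite (EFin_Rintegral_shift M (i1 x)).
Qed.

End normal_stability.

Section laws.
Context {R : realType} d (T : measurableType d) (Pr : probability T R).
Local Notation gam := (@normal_prob R 0 1).

Lemma has_law_ge0_integral (X : T -> R) (q : {measure set (measurableTypeR R) -> \bar R})
    (f : R -> \bar R) :
  has_law Pr X q -> measurable_fun setT f -> (forall x, 0 <= f x)%E ->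
  (\int[Pr]_w f (X w) = \int[q]_x f x)%E.
Proof.
move=> [mX Xq] mf f0.
have mX' : @measurable_fun _ _ T (measurableTypeR R) setT X by exact: mX.
pose Y : {mfun T >-> measurableTypeR R} :=
  HB.pack X (@isMeasurableFun.Build _ _ T (measurableTypeR R) X mX').
have -> : (\int[q]_x f x = \int[distribution Pr Y]_x f x)%E.
  by apply: (@eq_measure_integral _ _ R setT (distribution Pr Y) q _) => A mA _; exact: esym (Xq A mA).
by rewrite ge0_integral_distribution.
Qed.

Lemma has_law_Rintegral (X : T -> R) (q : probability (measurableTypeR R) R)
    (f : R -> R) (M : R) :
  has_law Pr X q -> measurable_fun setT f -> (forall x, `|f x| <= M) ->
  \int[Pr]_w f (X w) = \int[q]_x f x.
Proof.
move=> [mX Xq] mf fM; rewrite /Rintegral; congr fine.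
have mX' : @measurable_fun _ _ T (measurableTypeR R) setT X by exact: mX.
pose Y : {mfun T >-> measurableTypeR R} :=
  HB.pack X (@isMeasurableFun.Build _ _ T (measurableTypeR R) X mX').
have -> : (\int[q]_x (f x)%:E = \int[distribution Pr Y]_x (f x)%:E)%E.
  by apply: (@eq_measure_integral _ _ R setT (distribution Pr Y) q _) => A mA _; exact: esym (Xq A mA).
have mfX : measurable_fun setT (f \o X) by exact: measurableT_comp.
rewrite integral_distribution//; first exact/measurable_EFinP.
exact: (integrable_prob_bounded Pr mfX (fun z => fM _)).
Qed.

End laws.

Section continuous_tests.
Context {R : realType}.
Implicit Types (P Q : probability (measurableTypeR R) R).

Definition ramp (a : R) (n : nat) (x : R) : R := Num.max 0 (Num.min 1 (n%:R * (a - x))).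

Lemma ramp_continuous a n : continuous (ramp a n).
Proof.
move=> x; apply: (@continuous_max R R (cst 0) (fun x => Num.min 1 (n%:R * (a - x)))).
  exact: cvg_cst.
apply: (@continuous_min R R (cst 1) (fun x => n%:R * (a - x))); first exact: cvg_cst.
apply: cvgM; first exact: cvg_cst.
by apply: (@cvgB _ R^o); [exact: cvg_cst|exact: cvg_id].
Qed.

Lemma ramp_itv a n x : 0 <= ramp a n x <= 1.
Proof. by rewrite /ramp le_max lexx/= ge_max ler01/= ge_min lexx. Qed.

Lemma ramp_cvg a x : ramp a n x @[n --> \oo] --> (\1_`]-oo, a[ x : R).
Proof.
rewrite indicE; have [xa|ax] := ltP x a.
  rewrite mem_set/= ?in_itv//; apply: cvg_near_cst.
  have ax0 : 0 < a - x by rewrite subr_gt0.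
  near=> n; rewrite /ramp; have : (a - x)^-1 <= n%:R by near: n; exact: nbhs_infty_ger.
  move=> h; have h1 : 1 <= n%:R * (a - x) by rewrite -ler_pdivrMr// div1r.
  by rewrite (min_idPl h1) (max_idPr ler01).
rewrite memNset/= ?in_itv/=; last by apply/negP; rewrite -leNgt.
apply: cvg_near_cst; apply: nearW => n; rewrite /ramp.
have h : n%:R * (a - x) <= 0 by rewrite mulr_ge0_le0// subr_le0.
by rewrite (min_idPr (le_trans h ler01)) (max_idPl h).
Unshelve. all: by end_near. Qed.

Lemma prob_eq_continuous P Q :
  (forall f : R -> R, continuous f -> (forall x, 0 <= f x <= 1) ->
    \int[P]_x f x = \int[Q]_x f x) ->
  forall A, measurable A -> P A = Q A.
Proof.
move=> PQ A mA.
have key a : P `]-oo, a[%classic = Q `]-oo, a[%classic.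
  have rampP (S : probability (measurableTypeR R) R) :
      \int[S]_x ramp a n x @[n --> \oo] --> fine (S `]-oo, a[%classic).
    have -> : fine (S `]-oo, a[%classic) = \int[S]_x \1_`]-oo, a[ x.
      by rewrite /Rintegral integral_indic// setIT.
    apply: (@Rintegral_prob_cvg _ _ _ S _ _ 1).
    - by move=> n; apply: continuous_measurable_fun; exact: ramp_continuous.
    - by move=> n x; have /andP[r0 r1] := ramp_itv a n x; rewrite ger0_norm.
    - exact: ramp_cvg.
  have cQ := rampP Q; have := rampP P.
  rewrite (_ : (fun n => \int[P]_x ramp a n x) = (fun n => \int[Q]_x ramp a n x)); last first.
    by apply/funext => n; apply: PQ; [exact: ramp_continuous|exact: ramp_itv].
  move=> cP; have := cvg_unique _ cP cQ => /(_ (@Rhausdorff _)) h.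
  rewrite -[LHS](@fineK _ (P _)) ?fin_num_measure// -[RHS](@fineK _ (Q _)) ?fin_num_measure//.
  by rewrite h.
apply: (@measure_unique _ R (measurableTypeR R) (@RGenInftyO.G R) (fun n => `]-oo, n%:R[%classic)).
- exact: RGenInftyO.measurableE.
- move=> _ _ [x ->] [y ->]; exists (Num.min x y).
  by apply/seteqP; split=> z /=; rewrite !in_itv/= lt_min => /andP.
- by move=> n; exists n%:R.
- apply/seteqP; split=> // x _; exists (Num.truncn `|x|).+1 => //=.
  by rewrite in_itv/= (le_lt_trans (ler_norm x))// truncnS_gt.
- by move=> _ [x ->]; exact: key.
- by move=> n; rewrite -ge0_fin_numE// fin_num_measure.
- by [].
Qed.

End continuous_tests.

Section gaussian_limits.
Context {R : realType} d (T : measurableType d) (Pr : probability T R).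
Local Notation gam := (@normal_prob R 0 1).
Implicit Types (X Y G : T -> R).

Lemma has_law_continuous Y (q : probability (measurableTypeR R) R) :
  measurable_fun setT Y ->
  (forall f : R -> R, continuous f -> (forall x, 0 <= f x <= 1) ->
    \int[Pr]_w f (Y w) = \int[q]_x f x) -> has_law Pr Y q.
Proof.
move=> mY Yq; split=> // A mA.
have mY' : @measurable_fun _ _ T (measurableTypeR R) setT Y by exact: mY.
pose Z : {mfun T >-> measurableTypeR R} :=
  HB.pack Y (@isMeasurableFun.Build _ _ T (measurableTypeR R) Y mY').
apply: (@prob_eq_continuous R (distribution Pr Z) q) => // f cf f01.
rewrite -Yq//; rewrite /Rintegral; congr fine.
have mf : measurable_fun setT f by exact: continuous_measurable_fun.
rewrite ge0_integral_distribution//; first exact/measurable_EFinP.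
by move=> y; rewrite lee_fin; have /andP[] := f01 y.
Qed.

Lemma normal_second_moment (m s c : R) : 0 < s ->
  (\int[normal_prob m s]_x ((x + c) ^+ 2)%:E = ((m + c) ^+ 2 + s ^+ 2)%:E)%E.
Proof.
move=> s0; have cf : continuous (fun x : R => (x + c) ^+ 2).
  move=> x; apply: (@continuous_comp _ _ _ (fun y => y + c) (fun y => y ^+ 2)).
    by apply: (@cvgD _ R^o); [exact: cvg_id|exact: cvg_cst].
  exact: exprn_continuous.
rewrite (ge0_integral_normal_scale m s0 cf); last by move=> x; exact: sqr_ge0.
have i1 := @normal_id_integrable R; have i2 := @normal_square_integrable R.
have E z : (m + s * z + c) ^+ 2 = (m + c) ^+ 2 + 2 * (m + c) * s * z + s ^+ 2 * z ^+ 2 by ring.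
under eq_integral do rewrite E.
have := @integrable_prob_affine2 _ _ _ gam _ _ ((m + c) ^+ 2) (2 * (m + c) * s) (s ^+ 2) i1 i2.
move=> /(@EFin_Rintegral _ _ _ gam) <-.
rewrite (@Rintegral_prob_affine2 _ _ _ gam _ _ ((m + c) ^+ 2) (2 * (m + c) * s) (s ^+ 2) i1 i2).
by rewrite normal_mean normal_variance; congr EFin; ring.
Qed.

Lemma gaussian_centered_test Y (v : R) (f : R -> R) (M : R) :
  gaussian Pr Y -> Pr.-integrable setT (EFin \o Y) ->
  Pr.-integrable setT (fun w => (Y w ^+ 2)%:E) ->
  \int[Pr]_w Y w = 0 -> \int[Pr]_w (Y w ^+ 2) = v ->
  continuous f -> (forall x, `|f x| <= M) ->
  \int[Pr]_w f (Y w) = \int[gam]_z f (Num.sqrt v * z).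
Proof.
move=> gY i1 i2 e1 e2 cf fM.
have mf : measurable_fun setT f by exact: continuous_measurable_fun.
have mom c : (\int[Pr]_w ((Y w + c) ^+ 2)%:E = (c ^+ 2 + v)%:E)%E.
  have E z : (z + c) ^+ 2 = c ^+ 2 + 2 * c * z + 1 * z ^+ 2 by ring.
  under eq_integral do rewrite E.
  have := integrable_prob_affine2 (c ^+ 2) (2 * c) 1 i1 i2 => /EFin_Rintegral <-.
  by rewrite Rintegral_prob_affine2// e1 e2 mulr0 addr0 mul1r.
have mq c : measurable_fun setT (fun x : R => ((x + c) ^+ 2)%:E).
  by apply/measurable_EFinP; apply: measurable_funX; exact: measurable_funD.
have q0 c (x : R) : (0 <= ((x + c) ^+ 2)%:E)%E by rewrite lee_fin sqr_ge0.
have solve m s : (forall c, (m + c) ^+ 2 + s ^+ 2 = c ^+ 2 + v) -> m = 0 /\ v = s ^+ 2.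
  move=> h; have h0 := h 0; have h1 := h 1.
  have m0 : m = 0 by move: h0 h1; rewrite !expr2; lra.
  by split=> //; move: h0; rewrite m0 !expr2; lra.
case: gY => [[m lY]|[m [s [s0 lY]]]].
- pose q : probability (measurableTypeR R) R := \d_(m : measurableTypeR R).
  have {}lY : has_law Pr Y q := lY.
  have [m0 v0] : m = 0 /\ v = 0 ^+ 2.
    apply: solve => c; apply: EFin_inj; rewrite -mom.
    rewrite (@has_law_ge0_integral _ _ _ _ Y q (fun x => ((x + c) ^+ 2)%:E) lY)//.
    rewrite integral_dirac//; last exact: mq.
    by rewrite diracE in_setT mul1e expr0n/= addr0.
  rewrite v0 expr0n/= sqrtr0.
  apply: (etrans (@has_law_Rintegral _ _ _ _ Y q f M lY mf fM)).
  transitivity (f 0); last first.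
    symmetry; under eq_Rintegral do rewrite mul0r.
    exact: (@Rintegral_prob_cst _ _ _ gam).
  rewrite /Rintegral integral_dirac//; last exact/measurable_EFinP.
  by rewrite diracE in_setT mul1e/= m0.
- have [m0 v0] : m = 0 /\ v = s ^+ 2.
    apply: solve => c; apply: EFin_inj; rewrite -mom.
    rewrite (@has_law_ge0_integral _ _ _ _ Y _ (fun x => ((x + c) ^+ 2)%:E) lY)//.
    by rewrite normal_second_moment.
  apply: (etrans (@has_law_Rintegral _ _ _ _ Y (normal_prob m s) f M lY mf fM)).
  apply: (etrans (Rintegral_normal_scale m s0 cf fM)).
  by apply: eq_Rintegral => z _; rewrite m0 v0 sqrtr_sqr gtr0_norm// add0r.
Qed.

Lemma gaussian_limit (Y : nat -> T -> R) (v : nat -> R) G (u : R) :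
  (forall n, gaussian Pr (Y n)) ->
  (forall n, Pr.-integrable setT (EFin \o Y n)) ->
  (forall n, Pr.-integrable setT (fun w => (Y n w ^+ 2)%:E)) ->
  (forall n, \int[Pr]_w Y n w = 0) ->
  (forall n, \int[Pr]_w (Y n w ^+ 2) = v n) ->
  v n @[n --> \oo] --> u ->
  (forall w, Y n w @[n --> \oo] --> G w) ->
  [/\ measurable_fun setT G, gaussian Pr G &
    forall (f : R -> R) M, continuous f -> (forall x, `|f x| <= M) ->
      \int[Pr]_w f (G w) = \int[gam]_z f (Num.sqrt u * z)].
Proof.
move=> gY i1 i2 e1 e2 vu YG.
have mY n : measurable_fun setT (Y n).
  by have /integrableP[/measurable_EFinP] := i1 n.
have mG : measurable_fun setT G by apply: (@measurable_fun_cvg _ _ _ _ Y).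
have key (f : R -> R) M : continuous f -> (forall x, `|f x| <= M) ->
    \int[Pr]_w f (G w) = \int[gam]_z f (Num.sqrt u * z).
  move=> cf fM; have mf : measurable_fun setT f by exact: continuous_measurable_fun.
  have c1 : \int[Pr]_w f (Y n w) @[n --> \oo] --> \int[Pr]_w f (G w).
    apply: (@Rintegral_prob_cvg _ _ _ Pr _ _ M) => //.
    - by move=> n; exact: measurableT_comp.
    - by move=> w; apply: continuous_cvg; [exact: cf|exact: YG].
  have c2 : \int[gam]_z f (Num.sqrt (v n) * z) @[n --> \oo] -->
      \int[gam]_z f (Num.sqrt u * z).
    apply: (@Rintegral_prob_cvg _ _ _ gam _ _ M) => //.
    - move=> n; apply: measurableT_comp => //; exact: measurable_funM.
    - move=> z; apply: continuous_cvg; first exact: cf.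
      apply: cvgM; last exact: cvg_cst.
      by apply: continuous_cvg => //; exact: sqrt_continuous.
  have E : (fun n => \int[Pr]_w f (Y n w)) = (fun n => \int[gam]_z f (Num.sqrt (v n) * z)).
    apply/funext => n.
    exact: (gaussian_centered_test (gY n) (i1 n) (i2 n) (e1 n) (e2 n) cf fM).
  rewrite E in c1; exact: (cvg_unique _ c1 c2).
split=> //.
have u0 : 0 <= u.
  rewrite -(cvg_lim (@Rhausdorff R) vu); apply: limr_ge; first by apply/cvg_ex; exists u.
  by apply: nearW => n; rewrite -e2; apply: Rintegral_ge0 => w _; exact: sqr_ge0.
have bnd (f : R -> R) : (forall x, 0 <= f x <= 1) -> forall x, `|f x| <= 1.
  by move=> f01 x; have /andP[f0 f1] := f01 x; rewrite ger0_norm.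
move: u0; rewrite le_eqVlt => /predU1P[u0|u0].
  left; exists 0; apply: (has_law_continuous (q := \d_(0 : measurableTypeR R))) => // f cf f01.
  have mf : measurable_fun setT f by exact: continuous_measurable_fun.
  apply: (etrans (key f 1 cf (bnd f f01))); rewrite -u0 sqrtr0.
  under eq_Rintegral do rewrite mul0r.
  apply: (etrans (@Rintegral_prob_cst _ _ _ gam _)); rewrite /Rintegral integral_dirac//; last exact/measurable_EFinP.
  by rewrite diracE in_setT mul1e.
right; exists 0, (Num.sqrt u); have s0 : 0 < Num.sqrt u by rewrite sqrtr_gt0.
split=> //; apply: (has_law_continuous (q := normal_prob 0 (Num.sqrt u))) => // f cf f01.
apply: (etrans (key f 1 cf (bnd f f01))).
apply: (etrans _ (esym (Rintegral_normal_scale 0 s0 cf (bnd f f01)))).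
by apply: eq_Rintegral => z _; rewrite add0r.
Qed.

End gaussian_limits.

(** * Lindeberg's central limit theorem *)

Section independence.
Context {R : realType} d (T : measurableType d) (Pr : probability T R).
Variables (p : probability (measurableTypeR R) R) (X : nat -> {RV Pr >-> R}).

Lemma mutually_independent_prefix (A : nat -> set R) (n : nat) :
  mutually_independent X -> (forall i, measurable (A i)) ->
  Pr (\bigcap_(i in `I_n) (X i @^-1` A i)) =
  (\prod_(i < n) Pr (X i @^-1` A i))%E.
Proof.
move=> indX mA; have := indX [fset i in iota 0 n]%fset A mA.
have -> : [set` [fset i in iota 0 n]%fset] = `I_n.
  by apply/seteqP; split=> i /=; rewrite !inE mem_iota.
move=> ->; rewrite -(big_mkord xpredT (fun i => Pr (X i @^-1` A i))) /index_iota subn0.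
apply: perm_big; apply: uniq_perm; [exact: fset_uniq|exact: iota_uniq|].
by move=> i; rewrite !inE.
Qed.

Variables (xi : R -> R).
Hypothesis mxi : measurable_fun setT xi.

Definition psum (k : nat) (w : T) : R := \sum_(i < k) xi (X i w).

Lemma measurable_psum k : measurable_fun setT (psum k).
Proof.
by apply: measurable_sum => i; exact: measurableT_comp.
Qed.

Hypothesis iidX : iid p X.

Lemma psum_independent k (A B : set R) : measurable A -> measurable B ->
  Pr (psum k @^-1` A `&` X k @^-1` B) = (Pr (psum k @^-1` A) * p B)%E.
Proof.
move=> mA mB; have [indX lawX] := iidX.
pose C := X k @^-1` B.
have mC : measurable C by exact: measurable_funPTI.
have PC : Pr C = p B by have [_ ->] := lawX k.
have C0 : 0 <= fine (Pr C) by rewrite fine_ge0.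
pose G : set (set T) := [set E | exists2 D : nat -> set R, (forall i, measurable (D i)) &
  E = \bigcap_(i in `I_k) (X i @^-1` D i)].
have XG i : (i < k)%N -> forall D, measurable D -> G (X i @^-1` D).
  move=> ik D mD; exists (fun j => if j == i then D else setT).
    by move=> j; case: ifP.
  apply/seteqP; split=> w /=; first by move=> Dw j /= _; case: eqP => // ->.
  by move=> /(_ i ik) /=; rewrite eqxx.
have mG : G `<=` measurable.
  move=> _ [D mD ->]; apply: bigcap_measurableType => i _.
  exact: measurable_funPTI.
have key E : <<s G >> E -> mrestr Pr mC E = mscale (NngNum C0) Pr E.
  apply: (@g_sigma_algebra_measure_unique _ R T G mG (fun=> setT)).
  - move=> _; exists (fun=> setT) => //.
    by apply/seteqP; split.
  - by apply/seteqP; split=> // w _; exists 0%N.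
  - move=> _ _ [D mD ->] [D' mD' ->]; exists (fun i => D i `&` D' i).
      by move=> i; exact: measurableI.
    apply/seteqP; split=> w /=; first by move=> [h1 h2] i ik; split; [exact: h1|exact: h2].
    by move=> h; split=> i ik; have [] := h i ik.
  - move=> _ [D mD ->].
    rewrite -[LHS]/(Pr (\bigcap_(i in `I_k) (X i @^-1` D i) `&` C)).
    rewrite -[RHS]/((fine (Pr C))%:E * Pr (\bigcap_(i in `I_k) (X i @^-1` D i)))%E.
    pose D' i := if i == k then B else D i.
    have mD' i : measurable (D' i) by rewrite /D'; case: ifP.
    have -> : \bigcap_(i in `I_k) (X i @^-1` D i) `&` C = \bigcap_(i in `I_k.+1) (X i @^-1` D' i).
      apply/seteqP; split=> w /=.
        move=> [h1 h2] i /=; rewrite ltnS leq_eqVlt /D' => /predU1P[->|ik].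
          by rewrite eqxx.
        by rewrite ltn_eqF//; exact: h1.
      move=> h; split; last by have := h k (ltnSn k); rewrite /D' /= eqxx.
      by move=> i ik; have := h i (ltnW ik); rewrite /D' /= ltn_eqF.
    rewrite mutually_independent_prefix// big_ord_recr/= {2}/D' eqxx muleC fineK ?fin_num_measure//.
    congr (_ * _)%E; rewrite mutually_independent_prefix//; apply: eq_bigr => i _.
    by rewrite /D' ltn_eqF.
  - move=> _; rewrite -[X in (X < _)%E]/(Pr (setT `&` C)).
    by rewrite setTI (le_lt_trans (probability_le1 _ _))// ltry.
have psG : @measurable_fun _ _ (g_sigma_algebraType G) _ setT (psum k).
  apply: measurable_sum => i; apply: measurableT_comp => //.
  move=> _ D mD; rewrite setTI; apply: sub_sigma_algebra; exact: XG.
have := psG measurableT A mA; rewrite setTI => /key.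
rewrite -[X in X = _]/(Pr (psum k @^-1` A `&` C)) => ->.
rewrite -[LHS]/((fine (Pr C))%:E * Pr (psum k @^-1` A))%E.
by rewrite fineK ?fin_num_measure// PC muleC.
Qed.

Lemma Rintegral_psum_next k (f : R * R -> R) (M : R) :
  measurable_fun setT f -> (forall z, `|f z| <= M) ->
  \int[Pr]_w f (psum k w, X k w) = \int[Pr]_w \int[p]_x f (psum k w, x).
Proof.
move=> mf fM.
pose S : {RV Pr >-> R} := mfun_Sub (mem_set (measurable_psum k)).
pose SX (w : T) : R * measurableTypeR R := (psum k w, X k w).
have mSX : measurable_fun setT SX.
  apply: measurable_fun_pair; first exact: measurable_psum.
  exact: (@measurable_funPT _ _ _ _ (X k)).
pose Z : {mfun T >-> (R * measurableTypeR R)%type} :=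
  HB.pack SX (@isMeasurableFun.Build _ _ T (R * measurableTypeR R)%type SX mSX).
have E (D : set (R * measurableTypeR R)%type) : measurable D ->
    (distribution Pr S \x p)%E D = distribution Pr Z D.
  apply: product_measure_unique => A B mA mB.
  by rewrite /= -(psum_independent k mA mB).
have fS : (distribution Pr S setT < +oo)%E by rewrite probability_setT ltry.
have fp : (p setT < +oo)%E by rewrite probability_setT ltry.
have off (x : R) (y : measurableTypeR R) : ~ (setT x /\ setT y) -> f (x, y) = 0.
  by move=> []; split.
have mF : measurable_fun setT (fun s => \int[p]_x f (s, x)).
  exact: (@measurable_Rintegral2 _ _ _ _ _ (distribution Pr S) p setT setT f M
    measurableT measurableT fS fp mf fM off).
have mfs s : measurable_fun [set: measurableTypeR R] (fun x => f (s, x)).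
  exact: (measurableT_comp mf (pair1_measurable s)).
have Fi s : `|\int[p]_x f (s, x)| <= M.
  exact: (Rintegral_prob_bounded p (mfs s) (fun x => fM _)).
transitivity (\int[distribution Pr S]_s \int[p]_x f (s, x)); last first.
  rewrite /Rintegral; congr fine.
  rewrite integral_distribution//; first exact/measurable_EFinP.
  have mFS : measurable_fun setT ((fun s => \int[p]_x f (s, x)) \o S) by exact: measurableT_comp.
  exact: (integrable_prob_bounded Pr mFS (fun w => Fi _)).
have if_ : (distribution Pr S \x p)%E.-integrable setT (EFin \o f).
  exact: (@integrable_box _ _ _ _ _ (distribution Pr S) p setT setT f M
    measurableT measurableT fS fp mf fM off).
have -> : \int[distribution Pr S]_s \int[p]_x f (s, x) =
    fine (\int[(distribution Pr S \x p)%E]_z (f z)%:E)%E.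
  rewrite -(integral12_prod_meas1 if_) /Rintegral; congr fine.
  apply: eq_integral => s _; rewrite fineK//.
  apply: integrable_fin_num => //.
  exact: (integrable_prob_bounded p (mfs s) (fun w => fM _)).
rewrite /Rintegral; congr fine.
transitivity (\int[distribution Pr Z]_z (f z)%:E)%E; last first.
  by apply: eq_measure_integral => D mD _; exact: esym (E D mD).
rewrite integral_distribution//; first exact/measurable_EFinP.
have mfZ : measurable_fun setT (f \o Z) by exact: measurableT_comp.
exact: (integrable_prob_bounded Pr mfZ (fun w => fM _)).
Qed.

End independence.

Section taylor.
Context {R : realType}.
Implicit Types (f : R -> R) (q : probability (measurableTypeR R) R).

(* f1 and f2 stand for the first two derivatives of f; this formulation is stable
   under Gaussian smoothing without differentiating under the integral. *)
Definition taylor (C : R) f := exists f1 f2 : R -> R, exists K : R,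
  [/\ measurable_fun setT f1, measurable_fun setT f2,
      forall x, [/\ `|f x| <= K, `|f1 x| <= K & `|f2 x| <= K] &
      forall x h, `|f (x + h) - (f x + f1 x * h + f2 x / 2 * h ^+ 2)| <= C * `|h| ^+ 3].

Lemma locally_lipschitz_continuous (L : R) f :
  (forall x h, `|h| <= 1 -> `|f (x + h) - f x| <= L * `|h|) -> continuous f.
Proof.
move=> fL x; apply/cvgrPdist_lt => e e0.
have L0 : 0 <= L by have := fL 0 1; rewrite normr1 mulr1 => /(_ (lexx _)); apply: le_trans.
have d0 : 0 < Num.min 1 (e / (L + 1)).
  by rewrite lt_min ltr01 divr_gt0// ltr_wpDl.
apply/nbhs_ballP; exists (Num.min 1 (e / (L + 1))) => //= y.
rewrite /ball/= lt_min distrC => /andP[h1 h2].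
rewrite distrC; have := fL x (y - x) (ltW h1); rewrite (addrC x) subrK => /le_lt_trans; apply.
have : (L + 1) * `|y - x| < e by rewrite mulrC -ltr_pdivlMr// ltr_wpDl.
by rewrite mulrDl mul1r; apply: le_lt_trans; rewrite lerDl.
Qed.

Lemma taylor_continuous C f : taylor C f -> continuous f.
Proof.
move=> [f1 [f2 [K [_ _ fK fC]]]]; apply: (@locally_lipschitz_continuous (K + K + `|C|)) => x h h1.
have [fx f1x f2x] := fK x.
have K0 : 0 <= K by exact: le_trans fx.
have h2 : `|h| ^+ 2 <= `|h| by rewrite expr2 ler_piMr.
have h3 : `|h| ^+ 3 <= `|h| by rewrite exprS (le_trans (ler_piMr _ _))// exprn_ile1.
have -> : f (x + h) - f x = (f (x + h) - (f x + f1 x * h + f2 x / 2 * h ^+ 2)) + (f1 x * h + f2 x / 2 * h ^+ 2).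
  by ring.
rewrite (le_trans (ler_normD _ _))// addrC !mulrDl.
apply: lerD.
  rewrite (le_trans (ler_normD _ _))//; apply: lerD.
    by rewrite normrM ler_wpM2r.
  rewrite (normrM (f2 x / 2)) (normrM (f2 x)) normrX (ger0_norm (_ : 0 <= 2^-1)) ?invr_ge0//.
  apply: ler_pM => //.
  by rewrite ler_pdivrMr// (le_trans f2x)// ler_peMr// ler1n.
rewrite (le_trans (fC x h))// (le_trans (ler_wpM2r _ (ler_norm C)))//.
by rewrite ler_wpM2l.
Qed.

Lemma taylor_ge0 C f : taylor C f -> 0 <= C.
Proof.
move=> [f1 [f2 [K [_ _ _ fC]]]]; have := fC 0 1.
by rewrite normr1 !expr1n !mulr1; apply: le_trans.
Qed.

Lemma taylor_step q (Y : R -> R) (v m3 C s x : R) f (f1 f2 : R -> R) (K : R) :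
  measurable_fun setT f -> (forall x, `|f x| <= K) ->
  (forall x h, `|f (x + h) - (f x + f1 x * h + f2 x / 2 * h ^+ 2)| <= C * `|h| ^+ 3) ->
  0 <= C -> 0 <= s -> measurable_fun setT Y ->
  q.-integrable setT (EFin \o Y) -> q.-integrable setT (fun y => (Y y ^+ 2)%:E) ->
  q.-integrable setT (fun y => (`|Y y| ^+ 3)%:E) ->
  \int[q]_y Y y = 0 -> \int[q]_y (Y y ^+ 2) = v -> \int[q]_y (`|Y y| ^+ 3) <= m3 ->
  `|\int[q]_y f (x + s * Y y) - (f x + s ^+ 2 * v / 2 * f2 x)| <= C * s ^+ 3 * m3.
Proof.
move=> mf fK fC C0 s0 mY i1 i2 i3 e1 e2 e3.
have mfY : measurable_fun setT (fun y => f (x + s * Y y)).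
  apply: measurableT_comp => //; apply: measurable_funD => //; exact: measurable_funM.
have if_ : q.-integrable setT (fun y => (f (x + s * Y y))%:E).
  exact: (integrable_prob_bounded q mfY (fun y => fK _)).
pose k1 := s * f1 x; pose k2 := s ^+ 2 * f2 x / 2.
have iA := integrable_prob_affine2 (f x) k1 k2 i1 i2.
have eA := Rintegral_prob_affine2 (f x) k1 k2 i1 i2.
have -> : f x + s ^+ 2 * v / 2 * f2 x = \int[q]_y (f x + k1 * Y y + k2 * Y y ^+ 2).
  by rewrite eA e1 e2 /k2; ring.
rewrite -RintegralB//.
have iB : q.-integrable setT
    (fun y => (f (x + s * Y y) - (f x + k1 * Y y + k2 * Y y ^+ 2))%:E).
  exact: integrable_EFinB.
apply: (le_trans (le_normr_Rintegral measurableT iB)).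
apply: (@le_trans _ _ (\int[q]_y (C * s ^+ 3 * `|Y y| ^+ 3))).
  apply: le_Rintegral_prob.
  - exact: (integrable_norm iB).
  - exact: (integrable_EFinZ measurableT (C * s ^+ 3) i3).
  - move=> y; have := fC x (s * Y y).
    rewrite normrM exprMn (ger0_norm s0) mulrA.
    by congr (`|_ - _| <= _); rewrite /k1 /k2; ring.
rewrite RintegralZl//; apply: ler_wpM2l => //.
by rewrite mulr_ge0// exprn_ge0.
Qed.

Variable gam : probability (measurableTypeR R) R.

Definition gsmooth (s : R) f (x : R) := \int[gam]_z f (x + s * z).

Lemma measurable_gsmooth (s K : R) f : measurable_fun setT f ->
  (forall x, `|f x| <= K) -> measurable_fun setT (gsmooth s f).
Proof.
move=> mf fK.
have mh : measurable_fun setT (fun z : R * R => f (z.1 + s * z.2)).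
  by apply: measurableT_comp => //; apply: measurable_funD => //; exact: measurable_funM.
have fg : (gam setT < +oo)%E by rewrite probability_setT ltry.
have off (x : measurableTypeR R) (y : measurableTypeR R) :
  ~ (setT x /\ setT y) -> f (x + s * y) = 0 by move=> []; split.
exact: (@measurable_Rintegral2 _ _ _ _ _ gam gam setT setT (fun z => f (z.1 + s * z.2)) K
    measurableT measurableT fg fg mh (fun z => fK _) off).
Qed.

Let mscale_ (s x : R) f : measurable_fun setT f ->
  measurable_fun setT (fun z => f (x + s * z)).
Proof.
by move=> mf; apply: measurableT_comp => //; apply: measurable_funD => //; exact: measurable_funM.
Qed.

Lemma gsmooth_bounded (s K : R) f : measurable_fun setT f ->
  (forall x, `|f x| <= K) -> forall x, `|gsmooth s f x| <= K.
Proof.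
move=> mf fK x; exact: (Rintegral_prob_bounded gam (mscale_ s x mf) (fun z => fK _)).
Qed.

Lemma taylor_gsmooth C f s : taylor C f -> taylor C (gsmooth s f).
Proof.
move=> tf; have cf := taylor_continuous tf; have C0 := taylor_ge0 tf.
have mf : measurable_fun setT f by exact: continuous_measurable_fun.
case: tf => f1 [f2 [K [m1 m2 fK fC]]].
have K0 x : `|f x| <= K by have [] := fK x.
have K1 x : `|f1 x| <= K by have [] := fK x.
have K2 x : `|f2 x| <= K by have [] := fK x.
exists (gsmooth s f1), (gsmooth s f2), K; split.
- exact: measurable_gsmooth K1.
- exact: measurable_gsmooth K2.
- by move=> x; split; exact: gsmooth_bounded.
move=> x h.
have i0 y : gam.-integrable setT (fun z => (f (y + s * z))%:E).
  exact: (integrable_prob_bounded gam (mscale_ s y mf) (fun z => K0 _)).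
have i1 : gam.-integrable setT (fun z => (f1 (x + s * z))%:E).
  exact: (integrable_prob_bounded gam (mscale_ s x m1) (fun z => K1 _)).
have i2 : gam.-integrable setT (fun z => (f2 (x + s * z))%:E).
  exact: (integrable_prob_bounded gam (mscale_ s x m2) (fun z => K2 _)).
have -> : gsmooth s f (x + h) - (gsmooth s f x + gsmooth s f1 x * h + gsmooth s f2 x / 2 * h ^+ 2) =
    \int[gam]_z (f (x + h + s * z) - (f (x + s * z) + (0 + h * f1 (x + s * z) + h ^+ 2 / 2 * f2 (x + s * z)))).
  rewrite RintegralB//; last 2 first.
  - exact: i0.
  - apply: (@integrable_EFinD _ _ _ gam _ measurableT (fun z => f (x + s * z))); first exact: i0.
    exact: (integrable_prob_affine2 0 h (h ^+ 2 / 2) i1 i2).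
  rewrite RintegralD//; [|exact: i0|exact: (integrable_prob_affine2 0 h (h ^+ 2 / 2) i1 i2)].
  rewrite Rintegral_prob_affine2// /gsmooth; ring.
apply: Rintegral_prob_bounded.
  apply: measurable_funB; first exact: mscale_.
  apply: measurable_funD; first exact: mscale_.
  apply: measurable_funD; first apply: measurable_funD => //.
    by apply: measurable_funM => //; exact: mscale_.
  by apply: measurable_funM => //; exact: mscale_.
move=> z; have := fC (x + s * z) h; congr (`|_ - _| <= _); last by ring.
by congr f; ring.
Qed.

Hypothesis gstable : forall f (M a b c : R), 0 <= a -> 0 < b -> 0 < c ->
  c ^+ 2 = a ^+ 2 + b ^+ 2 -> continuous f -> (forall x, `|f x| <= M) ->
  \int[gam]_x \int[gam]_y f (a * x + b * y) = \int[gam]_z f (c * z).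

Lemma iter_gsmooth C f s n : taylor C f -> 0 <= s ->
  iter n (gsmooth s) f = gsmooth (Num.sqrt n%:R * s) f.
Proof.
move=> tf s0; have cf := taylor_continuous tf.
have g0 g : gsmooth 0 g = g.
  apply/funext => x; rewrite /gsmooth; under eq_Rintegral do rewrite mul0r addr0.
  exact: Rintegral_prob_cst.
move: s0; rewrite le_eqVlt => /predU1P[<-|s0].
  by rewrite mulr0 g0; elim: n => //= n ->; rewrite g0.
elim: n => [|[|n] ih]; first by rewrite sqrtr0 mul0r g0.
  by rewrite /= sqrtr1 mul1r.
rewrite iterS ih; apply/funext => x; rewrite /gsmooth.
case: tf => f1 [f2 [K [m1 m2 fK fC]]].
have K0 y : `|f (x + y)| <= K by have [] := fK (x + y).
have cfx : continuous (fun y => f (x + y)).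
  move=> y; apply: (@continuous_comp _ _ _ (fun y => x + y) f); last exact: cf.
  by apply: (@cvgD _ R^o); [exact: cvg_cst|exact: cvg_id].
have b0 : 0 < Num.sqrt n.+1%:R * s :> R by rewrite mulr_gt0// sqrtr_gt0.
have c0 : 0 < Num.sqrt n.+2%:R * s :> R by rewrite mulr_gt0// sqrtr_gt0.
have abc : (Num.sqrt n.+2%:R * s) ^+ 2 = s ^+ 2 + (Num.sqrt n.+1%:R * s) ^+ 2 :> R.
  by rewrite !exprMn !sqr_sqrtr// -[n.+2]addn1 natrD; ring.
rewrite -(gstable (ltW s0) b0 c0 abc cfx K0).
by apply: eq_Rintegral => z _; apply: eq_Rintegral => y _; rewrite addrA.
Qed.

End taylor.

Section lindeberg.
Context {R : realType} d (T : measurableType d) (Pr : probability T R).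
Variables (p : probability (measurableTypeR R) R) (X : nat -> {RV Pr >-> R}).
Variables (gam : probability (measurableTypeR R) R).
Hypothesis gam1 : gam.-integrable setT (fun z => z%:E).
Hypothesis gam2 : gam.-integrable setT (fun z => (z ^+ 2)%:E).
Hypothesis gam3 : gam.-integrable setT (fun z => (`|z| ^+ 3)%:E).
Hypothesis gam_mean : \int[gam]_z z = 0.
Hypothesis gam_var : \int[gam]_z (z ^+ 2) = 1.
Hypothesis gam_stable : forall (f : R -> R) (M a b c : R), 0 <= a -> 0 < b -> 0 < c ->
  c ^+ 2 = a ^+ 2 + b ^+ 2 -> continuous f -> (forall x, `|f x| <= M) ->
  \int[gam]_x \int[gam]_y f (a * x + b * y) = \int[gam]_z f (c * z).

Variables (xi : R -> R) (B v : R).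
Hypothesis iidX : iid p X.
Hypothesis mxi : measurable_fun setT xi.
Hypothesis xiB : forall x, `|xi x| <= B.
Hypothesis xi_mean : \int[p]_x xi x = 0.
Hypothesis xi_var : \int[p]_x (xi x ^+ 2) = v.

Let g3 := \int[gam]_z (`|z| ^+ 3).

Let v0 : 0 <= v.
Proof. by rewrite -xi_var; apply: Rintegral_ge0 => x _; exact: sqr_ge0. Qed.

Lemma lindeberg_step C f (s : R) k : taylor C f -> 0 <= s ->
  `|\int[Pr]_w f (s * psum X xi k.+1 w) -
    \int[Pr]_w gsmooth gam (s * Num.sqrt v) f (s * psum X xi k w)|
  <= C * s ^+ 3 * (B ^+ 3 + Num.sqrt v ^+ 3 * g3).
Proof.
move=> tf s0; have cf := taylor_continuous tf; have C0 := taylor_ge0 tf.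
have mf : measurable_fun setT f by exact: continuous_measurable_fun.
have tV := @taylor_gsmooth R gam C f (s * Num.sqrt v) tf.
have mV : measurable_fun setT (gsmooth gam (s * Num.sqrt v) f).
  by apply: continuous_measurable_fun; exact: taylor_continuous tV.
have [f1 [f2 [K [m1 m2 fK fC]]]] := tf.
have K0 x : `|f x| <= K by have [] := fK x.
have mS : measurable_fun setT (psum X xi k) by exact: measurable_psum.
pose phi (z : R * R) := f (s * z.1 + s * xi z.2).
have mphi : measurable_fun setT phi.
  apply: measurableT_comp => //; apply: measurable_funD; apply: measurable_funM => //.
  exact: measurableT_comp.
have -> : \int[Pr]_w f (s * psum X xi k.+1 w) = \int[Pr]_w \int[p]_x phi (psum X xi k w, x).
  rewrite -(Rintegral_psum_next mxi iidX k mphi (fun z => K0 _)).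
  by apply: eq_Rintegral => w _; rewrite /phi/= /psum big_ord_recr/= mulrDr.
have mI : measurable_fun setT (fun u => \int[p]_x phi (u, x)).
  have fg : (gam setT < +oo)%E by rewrite probability_setT ltry.
  have fp : (p setT < +oo)%E by rewrite probability_setT ltry.
  have off (x : measurableTypeR R) (y : measurableTypeR R) :
    ~ (setT x /\ setT y) -> phi (x, y) = 0 by move=> []; split.
  exact: (@measurable_Rintegral2 _ _ _ _ _ gam p setT setT phi K
      measurableT measurableT fg fp mphi (fun z => K0 _) off).
have mxis u : measurable_fun setT (fun x => f (u + s * xi x)).
  by apply: measurableT_comp => //; apply: measurable_funD => //; exact: measurable_funM.
have IK u : `|\int[p]_x phi (u, x)| <= K.
  exact: (@Rintegral_prob_bounded _ _ _ p (fun x => f (s * u + s * xi x)) K (mxis (s * u)) (fun z => K0 _)).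
have VK u : `|gsmooth gam (s * Num.sqrt v) f u| <= K by exact: gsmooth_bounded.
have mIS : measurable_fun setT (fun w => \int[p]_x phi (psum X xi k w, x)).
  exact: (measurableT_comp mI mS).
have mVS : measurable_fun setT (fun w => gsmooth gam (s * Num.sqrt v) f (s * psum X xi k w)).
  by apply: measurableT_comp => //; exact: measurable_funM.
rewrite -RintegralB//; last 2 first.
- exact: (integrable_prob_bounded Pr mIS (fun w => IK _)).
- exact: (integrable_prob_bounded Pr mVS (fun w => VK _)).
have B0 : 0 <= B by exact: le_trans (xiB 0).
have xi3 : p.-integrable setT (fun x => (`|xi x| ^+ 3)%:E).
  apply: (integrable_prob_bounded p (f := fun x => `|xi x| ^+ 3) (M := B ^+ 3)).
    by apply: measurable_funX; exact: measurableT_comp.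
  by move=> x; rewrite normrX normr_id lerXn2r ?nnegrE.
have xi2 : p.-integrable setT (fun x => (xi x ^+ 2)%:E).
  apply: (integrable_prob_bounded p (f := fun x => xi x ^+ 2) (M := B ^+ 2)).
    exact: measurable_funX.
  by move=> x; rewrite normrX lerXn2r ?nnegrE.
have xi1 : p.-integrable setT (EFin \o xi) by exact: (integrable_prob_bounded p mxi xiB).
have xi3B : \int[p]_x (`|xi x| ^+ 3) <= B ^+ 3.
  rewrite -[leRHS](Rintegral_prob_cst p); apply: le_Rintegral_prob => //.
    exact: integrable_prob_cst.
  by move=> x; rewrite lerXn2r ?nnegrE.
apply: Rintegral_prob_bounded; first exact: measurable_funB.
move=> w; set u := s * psum X xi k w.
have sv0 : 0 <= s * Num.sqrt v by rewrite mulr_ge0// sqrtr_ge0.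
have h1 := taylor_step u mf K0 fC C0 s0 mxi xi1 xi2 xi3 xi_mean xi_var xi3B.
have h2 := @taylor_step _ gam id 1 g3 C (s * Num.sqrt v) u f f1 f2 K mf K0 fC C0 sv0
  (@measurable_id _ _ _) gam1 gam2 gam3 gam_mean gam_var (lexx _).
have e : (s * Num.sqrt v) ^+ 2 * 1 = s ^+ 2 * v by rewrite mulr1 exprMn sqr_sqrtr.
rewrite e in h2; rewrite mulrDr.
have -> : C * s ^+ 3 * (Num.sqrt v ^+ 3 * g3) = C * (s * Num.sqrt v) ^+ 3 * g3.
  by rewrite exprMn; ring.
apply: le_trans (lerD h1 h2); rewrite [X in _ <= _ + X]distrC.
by apply: le_trans (ler_normD _ _); rewrite addrA subrK.
Qed.

Lemma lindeberg_iter C f (s : R) k : taylor C f -> 0 <= s ->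
  `|\int[Pr]_w f (s * psum X xi k w) - iter k (gsmooth gam (s * Num.sqrt v)) f 0|
  <= k%:R * (C * s ^+ 3 * (B ^+ 3 + Num.sqrt v ^+ 3 * g3)).
Proof.
move=> + s0; elim: k f => [|k ih] f tf.
  rewrite mul0r; under eq_Rintegral do rewrite /psum big_ord0 mulr0.
  by rewrite Rintegral_prob_cst/= subrr normr0.
have tV := @taylor_gsmooth R gam C f (s * Num.sqrt v) tf.
rewrite iterSr -addn1 natrD mulrDl mul1r [leRHS]addrC.
apply: le_trans (lerD (lindeberg_step k tf s0) (ih _ tV)).
by rewrite addn1; apply: le_trans (ler_normD _ _); rewrite addrA subrK.
Qed.

Lemma clt_taylor C f : taylor C f ->
  \int[Pr]_w f ((Num.sqrt n%:R)^-1 * psum X xi n w) @[n --> \oo] -->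
  \int[gam]_z f (Num.sqrt v * z).
Proof.
move=> tf; set D := C * (B ^+ 3 + Num.sqrt v ^+ 3 * g3).
apply/cvgrPdist_le => e e0.
have [N Ne] : exists N : nat, forall n, (N <= n)%N -> (0 < n)%N /\ D <= e * Num.sqrt n%:R.
  exists (Num.truncn ((D / e) ^+ 2)).+1 => n Nn; split; first exact: leq_trans Nn.
  rewrite mulrC -ler_pdivrMr// (le_trans (ler_norm _))// -sqrtr_sqr ler_wsqrtr//.
  by rewrite (le_trans (ltW (truncnS_gt _)))// ler_nat.
exists N => //= n Nn; have [n0 De] := Ne n Nn.
have s0 : 0 < Num.sqrt n%:R :> R by rewrite sqrtr_gt0 ltr0n.
have si0 : 0 <= (Num.sqrt n%:R)^-1 :> R by rewrite invr_ge0 ltW.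
have := lindeberg_iter n tf si0.
rewrite (iter_gsmooth gam_stable n tf); last by rewrite mulr_ge0// sqrtr_ge0.
rewrite (mulrA (Num.sqrt n%:R)) mulfV ?gt_eqF// mul1r distrC.
have -> : gsmooth gam (Num.sqrt v) f 0 = \int[gam]_z f (Num.sqrt v * z).
  by apply: eq_Rintegral => z _; rewrite add0r.
move=> /le_trans; apply.
have -> : n%:R * (C * (Num.sqrt n%:R)^-1 ^+ 3 * (B ^+ 3 + Num.sqrt v ^+ 3 * g3)) =
    D / Num.sqrt n%:R.
  rewrite -{1}(@sqr_sqrtr _ n%:R)// /D.
  by field; rewrite gt_eqF.
by rewrite ler_pdivrMr.
Qed.

End lindeberg.

(** * Smooth test functions and convergence in law *)

Section antiderivative.
Context {R : realType}.
Local Notation mu := (@lebesgue_measure R).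
Implicit Types (f g : R -> R).

Lemma is_derive_continuous f f' : (forall x, is_derive x (1:R) f (f' x)) -> continuous f.
Proof.
move=> df x; apply/differentiable_continuous/derivable1_diffP.
exact: (@ex_derive _ _ _ _ _ _ _ (df x)).
Qed.

Lemma is_derive_scale_shift f (f' a c x : R) : is_derive (a * x + c) (1:R) f f' ->
  is_derive x (1:R) (fun y => f (a * y + c)) (a * f').
Proof.
move=> df; have dg : is_derive x (1:R) (fun y => a * y + c) a.
  by apply: is_derive_eq; rewrite addr0 /GRing.scale/= mulr1.
have := @is_derive1_comp R f (fun y => a * y + c) x f' a df dg.
by rewrite mulrC.
Qed.

Lemma is_derive_shift_arg f (f' c x : R) : is_derive (x + c) (1:R) f f' ->
  is_derive x (1:R) (fun y => f (y + c)) f'.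
Proof.
move=> df; have := @is_derive_scale_shift f f' 1 c x; rewrite !mul1r => /(_ df).
by under eq_fun do rewrite mul1r.
Qed.

Lemma antiderivative_itv g (a : R) : continuous g ->
  (forall x, x <= a -> g x = 0) ->
  forall x, is_derive x (1:R) (fun y => \int[mu]_(t in `]-oo, y]) g t) (g x).
Proof.
move=> cg g0 x.
have mg : measurable_fun setT g by exact: continuous_measurable_fun.
pose u := Num.max (x + 1) a.
have gi : mu.-integrable `]-oo, u] (EFin \o g).
  have gau : mu.-integrable `[a, u] (EFin \o g).
    apply: continuous_compact_integrable; first exact: segment_compact.
    exact: continuous_subspaceT.
  apply/integrable_mkcond => //; move/integrable_mkcond : gau => /(_ _)/=.
  have -> : (EFin \o g) \_ `]-oo, u] = (EFin \o g) \_ `[a, u].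
    apply/funext => t; rewrite !patchE !mem_setE !in_itv/=.
    have [tu|] := boolP (t <= u); last by rewrite andbF.
    by rewrite andbT; have [//|ta] := leP a t; rewrite /= g0// ltW.
  by apply.
have xu : x < u by rewrite lt_max ltrDl ltr01.
have [h1 h2] := @continuous_FTC1 R g -oo%O x u xu gi (ltNyr x) (cg x).
by apply: DeriveDef; [exact: h1|rewrite -derive1E h2].
Qed.

Lemma antiderivative g : continuous g ->
  exists G : R -> R, forall x, is_derive x (1:R) G (g x).
Proof.
move=> cg.
pose gr x := g (Num.max 0 x) - g 0; pose gl x := g (Num.min 0 (- x)) - g 0.
have cgr : continuous gr.
  move=> x; apply: (@cvgB _ R^o); last exact: cvg_cst.
  apply: continuous_cvg; first exact: cg.
  by apply: (@continuous_max R R (cst 0) id); [exact: cvg_cst|exact: cvg_id].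
have cgl : continuous gl.
  move=> x; apply: (@cvgB _ R^o); last exact: cvg_cst.
  apply: continuous_cvg; first exact: cg.
  apply: (@continuous_min R R (cst 0) (fun x => - x)); first exact: cvg_cst.
  by apply: (@cvgN _ R^o); exact: cvg_id.
have gr0 x : x <= 0 -> gr x = 0 by move=> x0; rewrite /gr (max_idPl x0) subrr.
have gl0 x : x <= 0 -> gl x = 0.
  by move=> x0; rewrite /gl (min_idPl _) ?subrr// oppr_ge0.
have dr := antiderivative_itv cgr gr0.
have dl := antiderivative_itv cgl gl0.
set Gr := (fun y => _) in dr; set Gl := (fun y => _) in dl.
exists (fun x => Gr x + (- Gl (-1 * x + 0) + g 0 * x)) => x.
have d1 : is_derive x (1:R) (fun x => Gl (-1 * x + 0)) (-1 * gl (-1 * x + 0)).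
  exact: is_derive_scale_shift.
have d2 : is_derive x (1:R) (fun x => g 0 * x) (g 0).
  by apply: is_derive_eq; rewrite /GRing.scale/= mulr1.
have d3 := is_deriveD (dr x) (is_deriveD (is_deriveN d1) d2).
apply: (is_derive_eq d3).
rewrite mulN1r opprK mulN1r addr0 /gr /gl opprK.
by have [x0|x0] := leP 0 x; ring.
Qed.

Lemma mean_value f f' x h : (forall x, is_derive x (1:R) f (f' x)) ->
  exists t, `|t| <= `|h| /\ 0 <= t * h /\ f (x + h) - f x = f' (x + t) * h.
Proof.
move=> df; have cf a b : {within `[a, b], continuous f}.
  by apply: continuous_subspaceT; exact: is_derive_continuous df.
have [h0|h0] := leP 0 h.
- have xh : x <= x + h by rewrite lerDl.
  have [c] := MVT_segment xh (fun x _ => df x) (cf _ _).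
  rewrite in_itv/= => /andP[c1 c2] E; exists (c - x).
  rewrite (ger0_norm h0) ger0_norm ?subr_ge0// lerBlDl; split=> //; split.
    by rewrite mulr_ge0// subr_ge0.
  by rewrite E; congr (f' _ * _); ring.
- have xh : x + h <= x by rewrite gerDl ltW.
  have [c] := MVT_segment xh (fun x _ => df x) (cf _ _).
  rewrite in_itv/= => /andP[c1 c2] E; exists (c - x).
  rewrite (ltr0_norm h0) ler0_norm ?subr_le0//; split; [|split].
  + by rewrite lerN2 lerBrDl.
  + by rewrite mulr_le0 ?subr_le0// ltW.
  + rewrite -[LHS]opprB E (_ : x + (c - x) = c); last by ring.
    ring.
Qed.

Lemma taylor_of_derivatives (f f1 f2 f3 : R -> R) (K : R) :
  (forall x, is_derive x (1:R) f (f1 x)) ->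
  (forall x, is_derive x (1:R) f1 (f2 x)) ->
  (forall x, is_derive x (1:R) f2 (f3 x)) ->
  (forall x, [/\ `|f x| <= K, `|f1 x| <= K, `|f2 x| <= K & `|f3 x| <= K]) ->
  taylor K f.
Proof.
move=> d1 d2 d3 fK; exists f1, f2, K; split.
- by apply: continuous_measurable_fun; exact: is_derive_continuous d2.
- by apply: continuous_measurable_fun; exact: is_derive_continuous d3.
- by move=> x; have [] := fK x.
move=> x h.
have K0 : 0 <= K by have [+ _ _ _] := fK 0; exact: le_trans.
have b2 t : `|f2 (x + t) - f2 x| <= K * `|t|.
  have [s [_ [_ ->]]] := mean_value x t d3.
  by rewrite normrM ler_wpM2r//; have [] := fK (x + s).
have dsh g g' t : (forall x, is_derive x (1:R) g (g' x)) ->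
    is_derive t (1:R) (fun y => g (x + y)) (g' (x + t)).
  move=> dg; have := @is_derive_shift_arg g (g' (x + t)) x t.
  rewrite addrC => /(_ (dg _)).
  by under eq_fun do rewrite addrC.
have b1 t : `|f1 (x + t) - f1 x - f2 x * t| <= K * `|t| ^+ 2.
  pose r y := f1 (x + y) - f1 x - f2 x * y.
  have dr y : is_derive y (1:R) r (f2 (x + y) - f2 x).
    have D1 := dsh f1 f2 y d2.
    rewrite /r; apply: is_derive_eq.
    rewrite /GRing.scale/=. ring.
  have [s [s1 [_]]] := mean_value 0 t dr.
  rewrite !add0r /r addr0 mulr0 subr0 subrr subr0 => ->.
  rewrite normrM expr2 mulrA ler_wpM2r//.
  by rewrite (le_trans (b2 s))// ler_wpM2l.
pose r y := f (x + y) - f x - f1 x * y - f2 x / 2 * y ^+ 2.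
have dr y : is_derive y (1:R) r (f1 (x + y) - f1 x - f2 x * y).
  have D1 := dsh f f1 y d1.
  rewrite /r; apply: is_derive_eq.
  by rewrite /GRing.scale/=; field.
have [s [s1 [_]]] := mean_value 0 h dr.
rewrite !add0r /r addr0 !mulr0 expr0n/= mulr0 !subr0 subrr subr0 => E.
have -> : f (x + h) - (f x + f1 x * h + f2 x / 2 * h ^+ 2) =
    f (x + h) - f x - f1 x * h - f2 x / 2 * h ^+ 2 by ring.
rewrite E normrM exprSr mulrA ler_wpM2r// (le_trans (b1 s))// ler_wpM2l//.
by rewrite lerXn2r ?nnegrE.
Qed.

End antiderivative.

Section smoothing.
Context {R : realType}.
Implicit Types (f g : R -> R) (e : R).

Definition lipschitz_on_line (L : R) f := forall x y : R, `|f x - f y| <= L * `|x - y|.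

Definition diffquot e f (x : R) : R := (f (x + e) - f x) / e.

Lemma is_derive_diffquot e f f' : (forall x, is_derive x (1:R) f (f' x)) ->
  forall x, is_derive x (1:R) (diffquot e f) (diffquot e f' x).
Proof.
move=> df x; have d1 := is_derive_shift_arg (df (x + e)).
have D := is_deriveM (is_deriveB d1 (df x)) (is_derive_cst (e^-1) x 1).
by apply: (is_derive_eq D); rewrite /diffquot scaler0 add0r /GRing.scale/= mulrC.
Qed.

Lemma diffquot_bounded e f K : 0 < e -> (forall x, `|f x| <= K) ->
  forall x, `|diffquot e f x| <= 2 * K / e.
Proof.
move=> e0 fK x; rewrite /diffquot normrM (gtr0_norm (_ : 0 < e^-1)) ?invr_gt0//.
rewrite ler_pM2r ?invr_gt0//; apply: le_trans (ler_normB _ _) _.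
by have := fK (x + e); have := fK x; lra.
Qed.

Lemma diffquot_mean e f f' x : 0 < e -> (forall x, is_derive x (1:R) f (f' x)) ->
  exists t, 0 <= t <= e /\ diffquot e f x = f' (x + t).
Proof.
move=> e0 df; have [t [te [t0 E]]] := mean_value x e df.
exists t; rewrite /diffquot E mulfK ?gt_eqF//; split=> //.
have t00 : 0 <= t by rewrite -(pmulr_lge0 _ e0).
by rewrite t00; move: te; rewrite (ger0_norm t00) gtr0_norm.
Qed.

Lemma diffquot_mean_bounded e f f' K : 0 < e -> (forall x, is_derive x (1:R) f (f' x)) ->
  (forall x, `|f' x| <= K) -> forall x, `|diffquot e f x| <= K.
Proof. by move=> e0 df fK x; have [t [_ ->]] := diffquot_mean x e0 df. Qed.

(* The smooth approximation is the third difference quotient of a third primitive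
   of f, that is, f convolved three times with a uniform law on [-e, 0]. *)
Lemma taylor_smoothing f (L K eta : R) : lipschitz_on_line L f ->
  (forall x, `|f x| <= K) -> 0 < eta ->
  exists g C, taylor C g /\ forall x, `|g x - f x| <= eta.
Proof.
move=> fL fK eta0.
have L0 : 0 <= L.
  by have := fL 1 0; rewrite subr0 normr1 mulr1; exact: le_trans.
have K0 : 0 <= K by exact: le_trans (fK 0).
have cf : continuous f.
  apply: (@locally_lipschitz_continuous _ L) => x h _.
  by have := fL (x + h) x; rewrite addrAC subrr add0r.
have [F1 d1] := antiderivative cf.
have [F2 d2] := antiderivative (is_derive_continuous d1).
have [F3 d3] := antiderivative (is_derive_continuous d2).
pose e := Num.min 1 (eta / (3 * (L + 1))).
have e0 : 0 < e by rewrite lt_min ltr01 divr_gt0//; lra.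
have e1 : e <= 1 by rewrite ge_min lexx.
have eL : 3 * e * (L + 1) <= eta.
  have : e <= eta / (3 * (L + 1)) by rewrite ge_min lexx orbT.
  by rewrite ler_pdivlMr; [move=> h; apply: le_trans h; rewrite mulrCA mulrA|lra].
pose D := diffquot e.
have D1 g g' : (forall x, is_derive x (1:R) g (g' x)) ->
  forall x, is_derive x (1:R) (D g) (D g' x) by exact: is_derive_diffquot.
have D3 g g' (dg : forall x, is_derive x (1:R) g (g' x)) := D1 _ _ (D1 _ _ (D1 _ _ dg)).
have ei : 1 <= e^-1 by rewrite invf_ge1.
have ei0 : 0 <= e^-1 by exact: le_trans ei.
pose K1 := 2 * K / e; pose K2 := 2 * K1 / e; pose K3 := 2 * K2 / e.
have KK1 : K <= K1 by rewrite /K1 -mulrA; have : K * 1 <= K * e^-1 by [rewrite ler_wpM2l]; lra.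
have K10 : 0 <= K1 by exact: le_trans KK1.
have KK2 : K1 <= K2 by rewrite /K2 -mulrA; have : K1 * 1 <= K1 * e^-1 by [rewrite ler_wpM2l]; lra.
have K20 : 0 <= K2 by exact: le_trans KK2.
have KK3 : K2 <= K3 by rewrite /K3 -mulrA; have : K2 * 1 <= K2 * e^-1 by [rewrite ler_wpM2l]; lra.
have M1 g g' k : (forall x, is_derive x (1:R) g (g' x)) -> (forall x, `|g' x| <= k) ->
  forall x, `|D g x| <= k by exact: diffquot_mean_bounded.
have B1 g k : (forall x, `|g x| <= k) -> forall x, `|D g x| <= 2 * k / e.
  exact: diffquot_bounded.
have bF1 := M1 _ _ _ d1 fK.
have bF2 : forall x, `|D (D F2) x| <= K := M1 _ _ _ (D1 _ _ d2) bF1.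
have bF3 : forall x, `|D (D (D F3)) x| <= K := M1 _ _ _ (D1 _ _ (D1 _ _ d3)) bF2.
exists (D (D (D F3))), K3; split.
  apply: (@taylor_of_derivatives R _ (D (D (D F2))) (D (D (D F1))) (D (D (D f)))).
  - move=> x; split.
    + by rewrite (le_trans (bF3 x))//; lra.
    + by rewrite (le_trans (B1 _ _ bF2 x))//; rewrite -/K1; lra.
    + by rewrite (le_trans (B1 _ _ (B1 _ _ bF1) x))//; rewrite -/K1 -/K2; lra.
    + exact: (B1 _ _ (B1 _ _ (B1 _ _ fK)) x).
move=> x.
have [t1 [/andP[t10 t11] E1]] := diffquot_mean x e0 (D1 _ _ (D1 _ _ d3)).
have [t2 [/andP[t20 t21] E2]] := diffquot_mean (x + t1) e0 (D1 _ _ d2).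
have [t3 [/andP[t30 t31] E3]] := diffquot_mean (x + t1 + t2) e0 d1.
have -> : D (D (D F3)) x = f (x + t1 + t2 + t3) by rewrite [LHS]E1 [LHS]E2.
apply: le_trans (fL _ _) _.
have -> : x + t1 + t2 + t3 - x = t1 + t2 + t3 by ring.
rewrite ger0_norm; last by lra.
apply: le_trans eL; apply: (@le_trans _ _ (L * (3 * e))).
  by rewrite ler_wpM2l//; lra.
by rewrite mulrC ler_wpM2l//; lra.
Qed.

Section lipschitz_minorant.
Variables (f : R -> R) (K : R).
Hypothesis fK : forall x, `|f x| <= K.

Definition minorant (k : nat) (x : R) : R :=
  inf [set f y + k%:R * `|x - y| | y in [set: R]].

Let fKl y : - K <= f y. Proof. by have := fK y; rewrite ler_norml => /andP[]. Qed.
Let fKu y : f y <= K. Proof. by have := fK y; rewrite ler_norml => /andP[]. Qed.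

Let lb k x : lbound [set f y + k%:R * `|x - y| | y in [set: R]] (- K).
Proof. by move=> _ [y _ <-]; rewrite (le_trans (fKl y))// lerDl mulr_ge0. Qed.

Lemma minorant_le k x y : minorant k x <= f y + k%:R * `|x - y|.
Proof. by apply: ge_inf; [exists (- K); exact: lb|exists y]. Qed.

Lemma minorant_le_self k x : minorant k x <= f x.
Proof. by rewrite (le_trans (minorant_le k x x))// subrr normr0 mulr0 addr0. Qed.

Lemma minorant_ge k x m : (forall y, m <= f y + k%:R * `|x - y|) -> m <= minorant k x.
Proof.
move=> h; apply: lb_le_inf; first by exists (f x + k%:R * `|x - x|), x.
by move=> _ [y _ <-].
Qed.

Lemma minorant_bounded k x : `|minorant k x| <= K.
Proof.
rewrite ler_norml (le_trans (minorant_le_self k x))// andbT.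
by apply: minorant_ge => y; apply: (lb (k := k) (x := x)); exists y.
Qed.

Lemma minorant_lipschitz k : lipschitz_on_line k%:R (minorant k).
Proof.
have half x x' : minorant k x <= minorant k x' + k%:R * `|x - x'|.
  rewrite -lerBlDr; apply: minorant_ge => y; rewrite lerBlDr -addrA.
  apply: le_trans (minorant_le k x y) _; rewrite lerD2l -mulrDr ler_wpM2l//.
  by rewrite [leRHS]addrC (le_trans _ (ler_normD _ _))// addrA subrK.
move=> x y; rewrite ler_norml; apply/andP; split.
  by rewrite lerBrDl lerBlDr distrC; exact: half.
by rewrite lerBlDl; exact: half.
Qed.

Lemma minorant_cvg x : {for x, continuous f} -> minorant k x @[k --> \oo] --> f x.
Proof.
move=> cf; apply/cvgrPdist_le => e e0.
have /cvgrPdist_lt/(_ _ e0) := cf; case/nbhs_ballP => r /= r0 fr.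
near=> k; have kr : 2 * K / r <= k%:R by near: k; exact: nbhs_infty_ger.
rewrite ger0_norm ?subr_ge0; last exact: minorant_le_self.
rewrite lerBlDr -lerBlDl; apply: minorant_ge => y.
have [yr|yr] := ltP `|x - y| r.
  have := fr y yr; rewrite ltr_norml => /andP[_ h].
  by have : 0 <= k%:R * `|x - y| by [rewrite mulr_ge0]; lra.
have : 2 * K <= k%:R * `|x - y|.
  rewrite (@le_trans _ _ (k%:R * r))//; first by rewrite -ler_pdivrMr.
  by rewrite ler_wpM2l.
by have := fKl y; have := fKu x; lra.
Unshelve. all: by end_near. Qed.

End lipschitz_minorant.
End smoothing.

Section convergence_in_law.
Context {R : realType} d (T : measurableType d) (Pr : probability T R)
  d' (T' : measurableType d') (Pr' : probability T' R).
Variables (J : nat -> T -> R) (G : T' -> R).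
Hypothesis mJ : forall n, measurable_fun setT (J n).
Hypothesis mG : measurable_fun setT G.

Lemma lipschitz_continuous (L : R) (f : R -> R) : lipschitz_on_line L f -> continuous f.
Proof.
move=> fL; apply: (@locally_lipschitz_continuous _ L) => x h _.
by have := fL (x + h) x; rewrite addrAC subrr add0r.
Qed.

Lemma cvg_lipschitz_continuous :
  (forall (f : R -> R) (L K : R), lipschitz_on_line L f -> (forall x, `|f x| <= K) ->
    \int[Pr]_w f (J n w) @[n --> \oo] --> \int[Pr']_w f (G w)) ->
  forall (f : R -> R) (K : R), continuous f -> (forall x, `|f x| <= K) ->
    \int[Pr]_w f (J n w) @[n --> \oo] --> \int[Pr']_w f (G w).
Proof.
move=> lipcvg.
have lower (f : R -> R) (K : R) : continuous f -> (forall x, `|f x| <= K) ->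
    forall e, 0 < e -> \forall n \near \oo,
      \int[Pr']_w f (G w) - e <= \int[Pr]_w f (J n w).
  move=> cf fK e e0; have mf : measurable_fun setT f by exact: continuous_measurable_fun.
  have mm k : measurable_fun setT (minorant f k).
    apply: continuous_measurable_fun; apply: lipschitz_continuous.
    exact: minorant_lipschitz fK k.
  have : \int[Pr']_w minorant f k (G w) @[k --> \oo] --> \int[Pr']_w f (G w).
    apply: (@Rintegral_prob_cvg _ _ _ Pr' _ _ K).
    - by move=> k; exact: measurableT_comp.
    - by move=> k w; exact: minorant_bounded.
    - by move=> w; apply: (minorant_cvg fK); exact: cf.
  have e2 : 0 < e / 2 by rewrite divr_gt0.
  move=> /cvgrPdist_le/(_ _ e2) => /filter_ex[k hk].
  have := lipcvg _ _ _ (minorant_lipschitz fK k) (minorant_bounded fK k).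
  move=> /cvgrPdist_le/(_ _ e2); apply: filterS => n hn.
  have : \int[Pr]_w minorant f k (J n w) <= \int[Pr]_w f (J n w).
    apply: le_Rintegral_prob.
    - have mc : measurable_fun setT (fun w => minorant f k (J n w)) by exact: measurableT_comp.
      exact: (integrable_prob_bounded Pr mc (fun w => minorant_bounded fK k _)).
    - have mc : measurable_fun setT (fun w => f (J n w)) by exact: measurableT_comp.
      exact: (integrable_prob_bounded Pr mc (fun w => fK _)).
    - by move=> w; exact: minorant_le_self fK k _.
  move: hk hn; rewrite !ler_norml => /andP[h1 h2] /andP[h3 h4]; lra.
move=> f K cf fK; have mf : measurable_fun setT f by exact: continuous_measurable_fun.
apply/cvgrPdist_le => e e0.
have cNf : continuous (fun x => - f x) by move=> x; apply: (@cvgN _ R^o); exact: cf.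
have NfK x : `|- f x| <= K by rewrite normrN.
have h1 := lower _ _ cf fK e e0; have h2 := lower _ _ cNf NfK e e0.
have opp d0 (S : measurableType d0) (Q : probability S R) (Y : S -> R) : measurable_fun setT Y ->
    \int[Q]_w (- f (Y w)) = - \int[Q]_w f (Y w).
  move=> mY; have mc : measurable_fun setT (fun w => f (Y w)) by exact: measurableT_comp.
  have i1 := integrable_prob_bounded Q mc (fun w => fK _).
  rewrite -mulN1r -(RintegralZl (-1) measurableT i1).
  by apply: eq_Rintegral => w _; rewrite mulN1r.
near=> n; have a1 : \int[Pr']_w f (G w) - e <= \int[Pr]_w f (J n w) by near: n.
have : \int[Pr']_w (- f (G w)) - e <= \int[Pr]_w (- f (J n w)) by near: n.
by rewrite !opp// ler_norml => a2; apply/andP; split; lra.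
Unshelve. all: by end_near. Qed.

Variables (S : nat -> T -> R).
Hypothesis mS : forall n, measurable_fun setT (S n).
Hypothesis JS : forall e, 0 < e -> \forall n \near \oo,
  \int[Pr]_w Num.min 1 `|J n w - S n w| <= e.
Hypothesis Scvg : forall (f : R -> R) C, taylor C f ->
  \int[Pr]_w f (S n w) @[n --> \oo] --> \int[Pr']_w f (G w).

Lemma cvg_in_law_taylor : cvg_in_law Pr Pr' J G.
Proof.
split=> // f cf [K fK]; apply: (cvg_lipschitz_continuous _ cf fK) => {cf fK K f}.
move=> f L K fL fK; have cf := lipschitz_continuous fL.
have mf : measurable_fun setT f by exact: continuous_measurable_fun.
have intf d0 (U : measurableType d0) (Q : probability U R) (Y : U -> R) :
    measurable_fun setT Y -> Q.-integrable setT (fun w => (f (Y w))%:E).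
  move=> mY; have mc : measurable_fun setT (fun w => f (Y w)) by exact: measurableT_comp.
  exact: (integrable_prob_bounded Q mc (fun w => fK _)).
have near_int d0 (U : measurableType d0) (Q : probability U R) (Y : U -> R) (g : R -> R) C a :
    measurable_fun setT Y -> taylor C g -> (forall x, `|g x - f x| <= a) ->
    `|\int[Q]_w g (Y w) - \int[Q]_w f (Y w)| <= a.
  move=> mY tg ga; have cg := taylor_continuous tg.
  have mg : measurable_fun setT g by exact: continuous_measurable_fun.
  have [g1 [g2 [k [_ _ gk _]]]] := tg.
  have gk0 x : `|g x| <= k by have [] := gk x.
  have mc : measurable_fun setT (fun w => g (Y w)) by exact: measurableT_comp.
  have mc' : measurable_fun setT (fun w => f (Y w)) by exact: measurableT_comp.
  rewrite -RintegralB//; last 2 first.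
  - exact: (integrable_prob_bounded Q mc (fun w => gk0 _)).
  - exact: intf.
  by apply: Rintegral_prob_bounded => //; exact: measurable_funB.
have L0 : 0 <= L by have := fL 1 0; rewrite subr0 normr1 mulr1; exact: le_trans.
have K0 : 0 <= K by exact: le_trans (fK 0).
pose c := L + 2 * K + 1.
have c0 : 0 < c by rewrite /c; lra.
have fc x y : `|f x - f y| <= c * Num.min 1 `|x - y|.
  have [h|h] := ltP `|x - y| 1; rewrite ?(min_idPr (ltW h)) ?(min_idPl h).
    apply: le_trans (fL x y) _; rewrite ler_wpM2r// /c; lra.
  rewrite mulr1; apply: le_trans (ler_normB _ _) _.
  by have := fK x; have := fK y; rewrite /c; lra.
have JSf n : `|\int[Pr]_w f (J n w) - \int[Pr]_w f (S n w)| <=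
    c * \int[Pr]_w Num.min 1 `|J n w - S n w|.
  have mm : measurable_fun setT (fun w => Num.min 1 `|J n w - S n w|).
    apply: measurable_minr => //; apply: measurableT_comp => //; exact: measurable_funB.
  have im : Pr.-integrable setT (fun w => (Num.min 1 `|J n w - S n w|)%:E).
    apply: (integrable_prob_bounded Pr mm (M := 1)) => w.
    by rewrite ger0_norm ?ge_min ?lexx// le_min ler01/=.
  rewrite -(RintegralZl c measurableT im) -RintegralB//; [|exact: intf|exact: intf].
  have ib : Pr.-integrable setT (fun w => (f (J n w) - f (S n w))%:E).
    by apply: integrable_EFinB => //; exact: intf.
  apply: le_trans (le_normr_Rintegral measurableT ib) _.
  apply: le_Rintegral_prob.
  - exact: (integrable_norm ib).
  - exact: integrable_EFinZ.
  - by move=> w; exact: fc.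
apply/cvgrPdist_le => e e0.
have e4 : 0 < e / 4 by rewrite divr_gt0.
have [g [C [tg gf]]] := taylor_smoothing fL fK e4.
have /cvgrPdist_le/(_ _ e4) h1 := Scvg tg.
have h2 := JS (divr_gt0 e4 c0).
near=> n.
have a1 : `|\int[Pr']_w g (G w) - \int[Pr]_w g (S n w)| <= e / 4 by near: n.
have a2 : \int[Pr]_w Num.min 1 `|J n w - S n w| <= e / 4 / c by near: n.
have a3 := JSf n.
have a4 : c * \int[Pr]_w Num.min 1 `|J n w - S n w| <= e / 4.
  by rewrite mulrC -ler_pdivlMr.
have a5 := near_int _ _ Pr' G g C _ mG tg gf.
have a6 := near_int _ _ Pr (S n) g C _ (mS n) tg gf.
have := le_trans a3 a4; move: a1 a5 a6; rewrite !ler_norml.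
move=> /andP[? ?] /andP[? ?] /andP[? ?] /andP[? ?]; apply/andP; split; lra.
Unshelve. all: by end_near. Qed.

End convergence_in_law.

(** * The weight function and the functional L *)

Section weight_function.
Context {R : realType}.
Variables (alpha h : R) (l : R -> R).
Hypothesis a01 : 0 < alpha < 1 / 2.
Hypothesis lsupp : supported_in l alpha (1 - alpha).
Hypothesis dl : forall u : R, 0 < u < 1 -> derivable l u 1.
Hypothesis h0 : 0 < h.
Hypothesis lh : hoelder_on01 h (derive1 l).

Local Notation lam := (ext01 l).
Local Notation lam' := (ext01 (derive1 l)).

Let a0 : 0 < alpha. Proof. by have /andP[] := a01. Qed.
Let a2 : alpha < 1 / 2. Proof. by have /andP[] := a01. Qed.

Lemma ext01_eq0 u : ~~ (alpha <= u <= 1 - alpha) -> lam u = 0.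
Proof.
move=> nu; rewrite /ext01; case: ifP => // u01.
by apply/eqP; apply: contraNT nu => lu; exact: lsupp.
Qed.

Let near_lt (u c : R) : u < c -> \forall y \near u, y < c.
Proof. exact: lt_nbhsl. Qed.

Let near_gt (u c : R) : c < u -> \forall y \near u, c < y.
Proof. exact: lt_nbhsr. Qed.

Let is_derive_ext01_out u : u < alpha \/ 1 - alpha < u -> is_derive u (1:R) lam 0.
Proof.
move=> uout; have : \forall y \near u, cst 0 y = lam y.
  case: uout => uout.
    apply: filterS (near_lt uout) => y ya; rewrite ext01_eq0//.
    by apply: contraL ya => /andP[+ _]; rewrite -leNgt.
  apply: filterS (near_gt uout) => y ya; rewrite ext01_eq0//.
  by apply: contraL ya => /andP[_]; rewrite -leNgt.
by move=> e; apply: (near_eq_is_derive e); exact: is_derive_cst.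
Qed.

Let is_derive_ext01_in (u : R) : 0 < u < 1 -> is_derive u (1:R) lam (derive1 l u).
Proof.
move=> /andP[u0 u1].
have e : \forall y \near u, l y = lam y.
  near=> y; rewrite /ext01; case: ifP => // /negP[]; apply/andP; split; near: y.
    exact: near_gt.
  exact: near_lt.
apply: (near_eq_is_derive e).
by apply: DeriveDef; [apply: dl; rewrite u0 u1|rewrite derive1E].
Unshelve. all: by end_near. Qed.

Lemma is_derive_ext01 (u : R) : is_derive u (1:R) lam (lam' u).
Proof.
rewrite {2}/ext01; case: ifPn => [u01|]; first exact: is_derive_ext01_in.
rewrite negb_and -!leNgt => /orP[u0|u1]; apply: is_derive_ext01_out.
  by left; exact: le_lt_trans u0 _.
by right; have := a0; lra.
Qed.

Lemma ext01_derive_eq0 (u : R) : u < alpha \/ 1 - alpha < u -> lam' u = 0.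
Proof.
move=> uo; have d0 := is_derive_ext01_out uo; have d1 := is_derive_ext01 u.
by rewrite -(@derive_val _ _ _ _ _ _ _ d1) (@derive_val _ _ _ _ _ _ _ d0).
Qed.

Lemma ext01_derive_hoelder : exists C : R, 0 <= C /\
  forall u v : R, `|lam' u - lam' v| <= C * `|u - v| `^ h.
Proof.
have [C0 hC0] := lh; exists `|C0|; split=> //.
have hC u v : 0 < u < 1 -> 0 < v < 1 -> `|lam' u - lam' v| <= `|C0| * `|u - v| `^ h.
  move=> u01 v01; rewrite /ext01 u01 v01 (le_trans (hC0 _ _ u01 v01))//.
  by rewrite ler_wpM2r ?ler_norm ?powR_ge0.
have hin u v : 0 < u < 1 -> ~~ (0 < v < 1) -> `|lam' u - lam' v| <= `|C0| * `|u - v| `^ h.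
  move=> u01 v01; have lv : lam' v = 0 by rewrite /ext01 (negbTE v01).
  have [ua|ua] := ltP u alpha.
    by rewrite lv ext01_derive_eq0; [rewrite subrr normr0 mulr_ge0 ?powR_ge0|left].
  have [ub|ub] := ltP (1 - alpha) u.
    by rewrite lv ext01_derive_eq0; [rewrite subrr normr0 mulr_ge0 ?powR_ge0|right].
  have step w : 0 < w < 1 -> (w < alpha \/ 1 - alpha < w) -> `|u - w| <= `|u - v| ->
      `|lam' u - lam' v| <= `|C0| * `|u - v| `^ h.
    move=> w01 wo uw; rewrite lv -(ext01_derive_eq0 wo) (le_trans (hC _ _ u01 w01))//.
    by rewrite ler_wpM2l// ge0_ler_powR ?nnegrE// ltW.
  move: v01; rewrite negb_and -!leNgt => /orP[v0|v1].
    apply: (step (alpha / 2)); [by apply/andP; split; have := a0; have := a2; lra|by left; have := a0; lra|].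
    by rewrite !ger0_norm; have := a0; lra.
  apply: (step (1 - alpha / 2)); [by apply/andP; split; have := a0; have := a2; lra|by right; have := a0; lra|].
  by rewrite !ler0_norm; have := a0; lra.
move=> u v; have [u01|u01] := boolP (0 < u < 1); have [v01|v01] := boolP (0 < v < 1).
- exact: hC.
- exact: hin.
- by rewrite distrC (distrC u); exact: hin.
- by rewrite /ext01 (negbTE u01) (negbTE v01) subrr normr0 mulr_ge0 ?powR_ge0.
Qed.

Let powR_le1 (x : R) : 0 <= x <= 1 -> x `^ h <= 1.
Proof.
move=> /andP[x0 x1]; have -> : 1 = 1 `^ h :> R by rewrite powR1.
by rewrite ge0_ler_powR ?nnegrE ?(ltW h0).
Qed.

Lemma ext01_bounds : exists C : R, [/\ 0 <= C, forall u, `|lam u| <= C,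
  forall u, `|lam' u| <= C & forall u v, `|lam u - lam v| <= C * `|u - v|].
Proof.
have [C [C0 hC]] := ext01_derive_hoelder; exists C.
have b' u : `|lam' u| <= C.
  have [u01|u01] := boolP (0 < u < 1); last by rewrite /ext01 (negbTE u01) normr0.
  have := hC u 0; rewrite (ext01_derive_eq0 (u := 0)); last by left.
  rewrite !subr0 => /le_trans; apply; rewrite ler_piMr// powR_le1//.
  by have /andP[u0 u1] := u01; rewrite ger0_norm ?ltW.
have lip u v : `|lam u - lam v| <= C * `|u - v|.
  have [t [_ [_]]] := mean_value v (u - v) is_derive_ext01.
  by rewrite (_ : v + (u - v) = u); [move=> ->; rewrite normrM ler_wpM2r|ring].
split=> // u; have [u01|u01] := boolP (0 < u < 1); last by rewrite /ext01 (negbTE u01) normr0.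
have := lip u 0; rewrite (_ : lam 0 = 0) ?subr0; last by rewrite /ext01 ltxx.
by move/le_trans; apply; have /andP[u0 u1] := u01; rewrite ler_piMr// ger0_norm ltW.
Qed.

Lemma ext01_taylor (e : R) : 0 < e -> exists K : R, 0 <= K /\
  forall u v : R, 0 <= u <= 1 -> 0 <= v <= 1 ->
  `|lam u - lam v - lam' v * (u - v)| <= e * `|u - v| + K * (u - v) ^+ 2.
Proof.
move=> e0; have [C [C0 hC]] := ext01_derive_hoelder.
pose del := (e / (C + 1)) `^ h^-1.
have C1 : 0 < C + 1 by lra.
have eC : 0 < e / (C + 1) by rewrite divr_gt0.
have d0 : 0 < del by rewrite powR_gt0.
have dh : del `^ h = e / (C + 1) by rewrite -powRrM mulVf ?gt_eqF// powRr1// ltW.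
exists (C / del); split; first by rewrite divr_ge0// ltW.
move=> u v /andP[u0 u1] /andP[v0 v1].
have [t [tuv [_]]] := mean_value v (u - v) is_derive_ext01.
rewrite (_ : v + (u - v) = u); last by ring.
move=> ->; rewrite -mulrBl normrM.
have uv1 : `|u - v| <= 1 by rewrite ler_norml; apply/andP; split; lra.
have tp : `|t| `^ h <= del `^ h + `|u - v| / del.
  have [td|td] := leP `|t| del.
    rewrite -[leLHS]addr0 lerD//; first by apply: ge0_ler_powR; rewrite ?nnegrE ?(ltW h0) ?(ltW d0).
    by rewrite divr_ge0// ltW.
  rewrite -[leLHS]add0r lerD ?powR_ge0//.
  rewrite (@le_trans _ _ 1)//; first by rewrite powR_le1// normr_ge0 (le_trans tuv).
  by rewrite ler_pdivlMr// mul1r (le_trans (ltW td)).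
have tb : `|lam' (v + t) - lam' v| <= e + C / del * `|u - v|.
  apply: le_trans (hC _ _) _; rewrite addrAC subrr add0r.
  apply: le_trans (ler_wpM2l C0 tp) _; rewrite dh mulrDr; apply: lerD.
    rewrite mulrCA; apply: ler_piMr; [exact: ltW|by rewrite ler_pdivrMr// mul1r; lra].
  by rewrite mulrA mulrAC.
apply: le_trans (ler_wpM2r (normr_ge0 _) tb) _.
by rewrite mulrDl -(real_normK (num_real (u - v))) expr2 !mulrA.
Qed.

Lemma ext01_hoelder_gt1 : 1 < h -> forall u, lam u = 0.
Proof.
move=> h1; have [C [C0 hC]] := ext01_derive_hoelder.
have d0 u : is_derive u (1:R) lam' 0.
  have lim0 : t^-1 *: (lam' (t *: 1 + u) - lam' u) @[t --> (0:R)^'] --> (0:R).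
    apply/cvgrPdist_le => e e0.
    have C1 : 0 < C + 1 by lra.
    have eC : 0 < e / (C + 1) by rewrite divr_gt0.
    have hm : 0 < h - 1 by rewrite subr_gt0.
    apply/nbhs_ballP; exists ((e / (C + 1)) `^ (h - 1)^-1) => /=; first by rewrite powR_gt0.
    move=> t; rewrite /ball/= sub0r normrN => te t0.
    rewrite sub0r normrN normrZ /GRing.scale/= mulr1.
    have tn0 : 0 < `|t| by rewrite normr_gt0.
    rewrite normfV mulrC ler_pdivrMr//.
    have := hC (t + u) u; rewrite -addrA subrr addr0 => /le_trans; apply.
    have -> : `|t| `^ h = `|t| `^ (h - 1) * `|t|.
      by rewrite -[X in _ * X](powRr1 (ltW tn0)) -powRD ?subrK// gt_eqF// implybT.
    rewrite mulrA ler_wpM2r//.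
    have tp : `|t| `^ (h - 1) <= e / (C + 1).
      have -> : e / (C + 1) = ((e / (C + 1)) `^ (h - 1)^-1) `^ (h - 1).
        by rewrite -powRrM mulVf ?gt_eqF// powRr1// ltW.
      by apply: ge0_ler_powR; rewrite ?nnegrE ?powR_ge0 ?(ltW hm) ?(ltW te).
    apply: le_trans (ler_wpM2l C0 tp) _.
    rewrite mulrCA; apply: ler_piMr; [exact: ltW|by rewrite ler_pdivrMr// mul1r; lra].
  by apply: DeriveDef; [apply/cvg_ex; exists 0|exact/cvg_lim].
have l'0 u : lam' u = 0.
  have [t [_ [_]]] := mean_value 0 u d0.
  rewrite add0r mul0r (ext01_derive_eq0 (u := 0)); last by left.
  by rewrite subr0.
move=> u; have [t [_ [_]]] := mean_value 0 u is_derive_ext01.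
by rewrite add0r l'0 mul0r (_ : lam 0 = 0) ?subr0// /ext01 ltxx.
Qed.

End weight_function.

Section mcdf.
Context {R : realType} (q : probability (measurableTypeR R) R).

Lemma mcdf_ge0 y : 0 <= mcdf q y. Proof. by rewrite fine_ge0. Qed.

Lemma mcdf_le1 y : mcdf q y <= 1.
Proof. by rewrite -lee_fin fineK ?fin_num_measure// probability_le1. Qed.

Lemma mcdf_nd y z : y <= z -> mcdf q y <= mcdf q z.
Proof.
move=> yz; rewrite fine_le ?fin_num_measure// le_measure ?inE//.
by apply: subset_itvl; rewrite bnd_simp.
Qed.

Lemma mcdf_segment (e a b : R) : e < 1 / 2 -> mcdf q a < e -> 1 - e <= mcdf q b -> a <= b.
Proof.
by move=> e2 qa qb; rewrite leNgt; apply/negP => /ltW/mcdf_nd; lra.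
Qed.

Lemma measurable_mcdf : measurable_fun setT (mcdf q).
Proof. by apply: nondecreasing_measurable => // x y; exact: mcdf_nd. Qed.

Lemma mcdf_min y z : mcdf q (Num.min y z) = Num.min (mcdf q y) (mcdf q z).
Proof.
by have [yz|/ltW yz] := leP y z; have := mcdf_nd yz; [move/min_idPl|move/min_idPr].
Qed.

Lemma quantile_le s y : 0 < s < 1 -> (quantile q s <= y) = (s <= mcdf q y).
Proof.
move=> s01; have [q1 q2] := quantile_min q s01.
apply/idP/idP => [qy|]; last exact: q2.
exact: le_trans q1 (mcdf_nd qy).
Qed.

End mcdf.

Lemma Rintegral0 d (T : measurableType d) (R : realType)
    (m : {measure set T -> \bar R}) (D : set T) : \int[m]_(x in D) (0 : R) = 0.
Proof. by rewrite /Rintegral integral0. Qed.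

Lemma restrictNy (R : realType) (f : R -> R) (u s : R) :
  (f \_ `]-oo, u]) s = if s <= u then f s else 0.
Proof. by rewrite patchE mem_setE in_itv. Qed.

Section L_functional.
Context {R : realType}.
Local Notation mu := (@lebesgue_measure R).
Variables (alpha h : R) (l : R -> R).
Hypothesis a01 : 0 < alpha < 1 / 2.
Hypothesis lsupp : supported_in l alpha (1 - alpha).
Hypothesis dl : forall u : R, 0 < u < 1 -> derivable l u 1.
Hypothesis h0 : 0 < h.
Hypothesis lh : hoelder_on01 h (derive1 l).

Local Notation lam := (ext01 l).

Definition primitive (u : R) : R := \int[mu]_(t in `]-oo, u]) lam t.

Let clam : continuous lam.
Proof. exact: is_derive_continuous (is_derive_ext01 a01 lsupp dl). Qed.

Let mlam : measurable_fun setT lam.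
Proof. exact: continuous_measurable_fun. Qed.

Lemma is_derive_primitive u : is_derive u (1:R) primitive (lam u).
Proof.
apply: (antiderivative_itv clam (a := 0)) => x x0.
by rewrite /ext01 ltNge x0.
Qed.

Lemma primitive_continuous : continuous primitive.
Proof. exact: is_derive_continuous is_derive_primitive. Qed.

Lemma primitive_taylor C : (forall u v, `|lam u - lam v| <= C * `|u - v|) ->
  forall u v, `|primitive u - primitive v - lam v * (u - v)| <= C * (u - v) ^+ 2.
Proof.
move=> hC u v; have [t [tuv [_]]] := mean_value v (u - v) is_derive_primitive.
have C0 : 0 <= C by have := hC 1 0; rewrite subr0 normr1 mulr1; exact: le_trans.
rewrite (_ : v + (u - v) = u); last by ring.
move=> ->; rewrite -mulrBl normrM -(real_normK (num_real (u - v))) expr2 mulrA.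
rewrite ler_wpM2r// (le_trans (hC _ _))// ler_wpM2l//.
by rewrite addrAC subrr add0r.
Qed.

Lemma primitive_bounded : exists M, forall y, 0 <= y <= 1 -> `|primitive y| <= M.
Proof.
have [C [C0 lamC _ lamL]] := ext01_bounds a01 lsupp dl h0 lh.
exists (`|primitive 0| + (`|lam 0| + C)) => y /andP[y0 y1].
have := primitive_taylor lamL y 0; rewrite subr0 => P1.
have -> : primitive y = primitive 0 + (lam 0 * y + (primitive y - primitive 0 - lam 0 * y)).
  by ring.
apply: le_trans (ler_normD _ _) _; rewrite lerD2l.
apply: le_trans (ler_normD _ _) _; apply: lerD.
  by rewrite normrM ler_piMr// ger0_norm.
apply: le_trans P1 _; rewrite ler_piMr//; exact: exprn_ile1.
Qed.

Variable q : probability (measurableTypeR R) R.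
Variables (a b : R).
Hypothesis qa : mcdf q a < alpha.
Hypothesis qb : 1 - alpha <= mcdf q b.

Let ab : a <= b.
Proof.
by have /andP[_ a2] := a01; exact: mcdf_segment a2 qa qb.
Qed.

Let quantile_int (s : R) : alpha <= s <= 1 - alpha ->
  quantile q s = b - \int[mu]_y (\1_`[a, b] y * (s <= mcdf q y)%R%:R).
Proof.
move=> /andP[s1 s2]; have /andP[a0 a2] := a01.
have s01 : 0 < s < 1 by apply/andP; split; lra.
have qsb : quantile q s <= b by rewrite quantile_le//; exact: le_trans qb.
have qsa : a < quantile q s.
  by rewrite ltNge quantile_le// -ltNge; exact: lt_le_trans s1.
have -> : \int[mu]_y (\1_`[a, b] y * (s <= mcdf q y)%R%:R) =
    \int[mu]_y \1_`[quantile q s, b] y.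
  apply: eq_Rintegral => y _; rewrite !indicE -quantile_le//.
  rewrite !mem_setE !in_itv/= -natrM mulnb; congr (nat_of_bool _)%:R.
  have [qy|qy] := leP (quantile q s) y; rewrite ?andbF//= andbT.
  by rewrite (ltW (lt_le_trans qsa qy)).
by rewrite Rintegral_indic_segment// subKr.
Qed.

(* Fubini in quantile q s = b - \int_a^b 1[s <= mcdf q y] dy. *)
Lemma LfunctionalE :
  Lfunctional l q = b * primitive 1 - \int[mu]_(y in `[a, b]) primitive (mcdf q y).
Proof.
have /andP[a0 a2] := a01.
have [C [C0 lamC _ _]] := ext01_bounds a01 lsupp dl h0 lh.
pose f (z : R * R) : R := lam z.1 * (\1_`[a, b] z.2 * (z.1 <= mcdf q z.2)%R%:R).
have mind : measurable_fun setT (fun z : R * R => (z.1 <= mcdf q z.2)%R%:R : R).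
  apply: (measurableT_comp measurable_le2 (measurable_fun_pair measurable_fst _)).
  exact: measurableT_comp (measurable_mcdf q) measurable_snd.
have mf : measurable_fun setT f.
  apply: measurable_funM; first exact: measurableT_comp.
  apply: measurable_funM => //.
  by apply: (measurableT_comp (measurable_indic (measurable_itv _))).
have fC z : `|f z| <= C.
  rewrite /f normrM -[leRHS]mulr1 ler_pM// indicE -natrM mulnb.
  by case: (_ && _); rewrite ?normr1 ?normr0.
have f0 x y : ~ (`[0, 1]%classic x /\ `[a, b]%classic y) -> f (x, y) = 0.
  move=> nxy; rewrite /f/=; have [x01|x01] := boolP (x \in `[0, 1]%classic).
    rewrite (_ : \1_`[a, b] y = 0) ?mul0r ?mulr0// indicE memNset// => yab.
    by apply: nxy; split=> //; rewrite inE in x01.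
  have -> : lam x = 0; last by rewrite mul0r.
  rewrite /ext01; case: ifP => // /andP[x0 x1]; case/negP: x01.
  by rewrite mem_setE in_itv/= !ltW.
have F1 := lebesgue_segment_lty (0:R) 1.
have F2 := lebesgue_segment_lty a b.
have m01 : measurable (`[0:R, 1]%classic : set (measurableTypeR R)) by exact: measurable_itv.
have mab : measurable (`[a, b]%classic : set (measurableTypeR R)) by exact: measurable_itv.
have lam_int : mu.-integrable setT (EFin \o lam).
  have -> : EFin \o lam = (EFin \o lam) \_ `[0, 1].
    apply/funext => x; rewrite patchE; case: ifPn => // x01 /=.
    rewrite /ext01; case: ifP => // /andP[x0 x1]; case/negP: x01.
    by rewrite mem_setE in_itv/= !ltW.
  apply/(@integrable_mkcond _ (measurableTypeR R) R mu _ (EFin \o lam) m01).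
  apply: (@integrable_bounded _ _ _ mu _ m01 F1 lam C) => //.
  exact: measurable_funTS.
have fubini := @Rfubini R _ _ _ _ mu mu `[0, 1]%classic `[a, b]%classic f C
  m01 mab F1 F2 mf fC f0.
have int2 := @integrable_Rintegral2 R _ _ _ _ mu mu `[0, 1]%classic `[a, b]%classic f C
  m01 mab F1 F2 mf fC f0.
have i1 s : mu.-integrable setT (EFin \o (fun y => \1_`[a, b] y * (s <= mcdf q y)%R%:R)).
  have -> : (EFin \o (fun y => \1_`[a, b] y * (s <= mcdf q y)%R%:R)) =
      (fun y => (s <= mcdf q y)%R%:R%:E) \_ `[a, b] :> (R -> \bar R).
    apply/funext => y; rewrite patchE /= indicE.
    by case: (y \in _); rewrite ?mul1r ?mul0r.
  apply/(@integrable_mkcond _ (measurableTypeR R) R mu _ (fun y => (s <= mcdf q y)%R%:R%:E) mab).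
  apply: (@integrable_bounded _ _ _ mu _ mab F2 (fun y => (s <= mcdf q y)%R%:R) 1).
    exact: measurable_funTS (measurableT_comp mind (pair1_measurable s)).
  by move=> y _; rewrite normr_nat lern1 leq_b1.
have -> : Lfunctional l q = \int[mu]_s (b * lam s - \int[mu]_y f (s, y)).
  rewrite /Lfunctional Rintegral_mkcond; apply: eq_Rintegral => s _.
  have -> : \int[mu]_y f (s, y) = lam s * \int[mu]_y (\1_`[a, b] y * (s <= mcdf q y)%R%:R).
    exact: (RintegralZl (lam s) measurableT (i1 s)).
  rewrite patchE mem_setE in_itv/= /ext01; case: ifPn => s01; last by rewrite mulr0 mul0r subr0.
  have [sa|sa] := boolP (alpha <= s <= 1 - alpha).
    by rewrite (quantile_int sa); ring.
  have : lam s = 0 by exact: (ext01_eq0 lsupp).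
  by rewrite /ext01 s01 => ->; rewrite !mulr0 mul0r subr0.
have iB : mu.-integrable setT (EFin \o (fun s => b * lam s)).
  exact: (integrable_EFinZ measurableT b lam_int).
apply: (etrans (RintegralB measurableT iB int2)).
apply: (etrans (congr1 (fun z => z - _) (RintegralZl b measurableT lam_int))).
rewrite fubini.
have primE u : primitive u = \int[mu]_s (lam s * (s <= u)%R%:R).
  rewrite /primitive Rintegral_mkcond; apply: eq_Rintegral => s _.
  by rewrite restrictNy; case: (s <= u); rewrite ?mulr1 ?mulr0.
congr (b * _ - _).
  rewrite primE; apply: eq_Rintegral => s _.
  have [s1|s1] := leP s 1; first by rewrite mulr1.
  by rewrite /ext01 (lt_gtF s1) andbF mul0r.
rewrite [RHS]Rintegral_mkcond; apply: eq_Rintegral => y _.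
rewrite patchE; case: ifPn => yab; last first.
  rewrite /f/=; under eq_Rintegral do rewrite indicE (negbTE yab) mul0r mulr0.
  exact: Rintegral0.
rewrite primE; apply: eq_Rintegral => s _.
by rewrite /f/= indicE yab mul1r.
Qed.

End L_functional.

(** * The jackknife and the infinitesimal jackknife *)

Section empirical_cdf.
Context {R : realType} (n : nat) (x : 'I_n -> R).
Implicit Types (D : {set 'I_n}).

Lemma mcdf_dirac (c y : R) : mcdf \d_(c : measurableTypeR R) y = (c <= y)%R%:R.
Proof.
rewrite /mcdf -[X in fine X]/((\1_`]-oo, y]%classic c)%:E) /= indicE mem_setE.
by rewrite in_itv.
Qed.

Lemma mcdf_empirical D y :
  mcdf (empirical x D) y = #|D|%:R^-1 * \sum_(j in D) (x j <= y)%R%:R.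
Proof.
rewrite /mcdf -[X in fine X]/((#|D|%:R^-1)%:E *
  \sum_(j in D) (\1_`]-oo, y]%classic (x j))%:E)%E.
rewrite sumEFin -EFinM /=; congr (_ * _); apply: eq_bigr => j _.
by rewrite indicE mem_setE in_itv.
Qed.

Lemma empirical_probability D : (0 < #|D|)%N ->
  exists P : probability (measurableTypeR R) R,
    (P : {measure set (measurableTypeR R) -> \bar R}) = empirical x D.
Proof.
move=> D0.
pose P : probability (measurableTypeR R) R := HB.pack (empirical x D)
  (@Measure_isProbability.Build _ (measurableTypeR R) R (empirical x D) (empirical_setT x D0)).
by exists P.
Qed.

End empirical_cdf.

Section jackknife.
Context {R : realType}.
Local Notation mu := (@lebesgue_measure R).
Variables (alpha h : R) (l : R -> R).
Hypothesis a01 : 0 < alpha < 1 / 2.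
Hypothesis lsupp : supported_in l alpha (1 - alpha).
Hypothesis dl : forall u : R, 0 < u < 1 -> derivable l u 1.
Hypothesis h0 : 0 < h.
Hypothesis lh : hoelder_on01 h (derive1 l).

Local Notation lam := (ext01 l).
Local Notation prim := (primitive l).

Let clam : continuous lam.
Proof. exact: is_derive_continuous (is_derive_ext01 a01 lsupp dl). Qed.

Let mlam : measurable_fun setT lam.
Proof. exact: continuous_measurable_fun. Qed.

Let mprim : measurable_fun setT prim.
Proof. apply: continuous_measurable_fun; exact: (primitive_continuous a01 lsupp dl). Qed.

Variable C : R.
Hypothesis lamC : forall u, `|lam u| <= C.
Hypothesis lamL : forall u v, `|lam u - lam v| <= C * `|u - v|.

Let C0 : 0 <= C. Proof. exact: le_trans (lamC 0). Qed.

Variables (n : nat) (x : 'I_n -> R).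
Hypothesis n2 : (1 < n)%N.

Let F := mcdf (empirical x [set: 'I_n]).
Let Fi i := mcdf (empirical x [set~ i]).
Let H i (y : R) : R := (x i <= y)%R%:R.

Let n0 : n%:R != 0 :> R.
Proof. by rewrite pnatr_eq0 -lt0n (ltn_trans _ n2). Qed.

Let n1E : n.-1%:R = n%:R - 1 :> R.
Proof. by rewrite -subn1 natrB// ltnW. Qed.

Let n1 : 0 < n%:R - 1 :> R.
Proof. by rewrite subr_gt0 ltr1n. Qed.

Let n2R : 2 <= n%:R :> R.
Proof. by rewrite ler_nat. Qed.

Lemma empirical_cdfE y : F y = n%:R^-1 * \sum_(j < n) H j y.
Proof.
rewrite /F mcdf_empirical cardsT card_ord; congr (_ * _).
by apply: eq_bigl => j; rewrite inE.
Qed.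

Lemma empirical_cdf_loo i y : Fi i y - F y = (F y - H i y) / (n%:R - 1).
Proof.
have Fn : \sum_(j < n) H j y = n%:R * F y by rewrite empirical_cdfE mulrA mulfV// mul1r.
rewrite /Fi mcdf_empirical cardsC1 card_ord n1E.
have -> : \sum_(j in [set~ i]%SET) (x j <= y)%R%:R = n%:R * F y - H i y.
  rewrite -Fn [X in _ = X - _](bigD1 i)//= [RHS]addrAC subrr add0r; apply: eq_bigl => j.
  by rewrite !inE.
by field; rewrite gt_eqF.
Qed.

Let cardT : (0 < #|[set: 'I_n]%SET|)%N. Proof. by rewrite cardsT card_ord ltnW. Qed.
Let cardC (i : 'I_n) : (0 < #|[set~ i]%SET|)%N.
Proof. by rewrite cardsC1 card_ord -subn1 subn_gt0. Qed.

Lemma empirical_cdf_itv y : 0 <= F y <= 1.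
Proof.
by have [P PE] := empirical_probability x cardT; rewrite /F -PE mcdf_ge0 mcdf_le1.
Qed.

Lemma empirical_cdf_nd y z : y <= z -> F y <= F z.
Proof.
by have [P PE] := empirical_probability x cardT; rewrite /F -PE; exact: mcdf_nd.
Qed.

Lemma measurable_empirical_cdf : measurable_fun setT F.
Proof.
by have [P PE] := empirical_probability x cardT; rewrite /F -PE; exact: measurable_mcdf.
Qed.

Let mFi i : measurable_fun setT (Fi i).
Proof.
by have [P PE] := empirical_probability x (cardC i); rewrite /Fi -PE; exact: measurable_mcdf.
Qed.

Let mH i : measurable_fun setT (H i).
Proof.
rewrite (_ : H i = \1_`[x i, +oo[); first exact: measurable_indic.
by apply/funext => y; rewrite indicE mem_setE in_itv/= andbT.
Qed.

Variables (a b : R).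
Hypothesis Fa : F a < alpha / 2.
Hypothesis Fb : 1 - alpha / 2 < F b.

Let a0 : 0 < alpha. Proof. by have /andP[] := a01. Qed.
Let a2 : alpha < 1 / 2. Proof. by have /andP[] := a01. Qed.

Lemma empirical_segment : a <= b.
Proof.
rewrite leNgt; apply/negP => /ltW /empirical_cdf_nd; have := a0; have := a2.
by have := Fa; have := Fb; lra.
Qed.

Let ab := empirical_segment.

Lemma empirical_weight_out y : y \notin `[a, b]%classic -> lam (F y) = 0.
Proof.
rewrite mem_setE in_itv/= => yab; apply: (ext01_eq0 lsupp); apply: contra yab => /andP[h1 h2].
have := a0; have := a2; have := Fa; have := Fb => ? ? ? ?; apply/andP; split.
  by rewrite leNgt; apply/negP => /ltW/empirical_cdf_nd; lra.
by rewrite leNgt; apply/negP => /ltW/empirical_cdf_nd; lra.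
Qed.

Let Hitv i y : 0 <= H i y <= 1.
Proof. by rewrite /H; case: (x i <= y); rewrite ?lexx ?ler01. Qed.

Let FHi i y : `|F y - H i y| <= 1.
Proof.
have /andP[? ?] := empirical_cdf_itv y; have /andP[? ?] := Hitv i y.
by rewrite ler_norml; apply/andP; split; lra.
Qed.

Let Fia i : Fi i a < alpha.
Proof.
have := empirical_cdf_loo i a; have /andP[f0 f1] := empirical_cdf_itv a.
have /andP[Hi0 Hi1] := Hitv i a => E.
have : (F a - H i a) / (n%:R - 1) <= F a.
  rewrite ler_pdivrMr// -[leLHS]mulr1 (@le_trans _ _ (F a))//; first by lra.
  by rewrite ler_peMr//; have := n2R; lra.
by have := Fa; lra.
Qed.

Let Fib i : 1 - alpha <= Fi i b.
Proof.
have := empirical_cdf_loo i b; have /andP[f0 f1] := empirical_cdf_itv b.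
have /andP[Hi0 Hi1] := Hitv i b => E.
have : - (1 - F b) <= (F b - H i b) / (n%:R - 1).
  rewrite ler_pdivlMr// mulNr (@le_trans _ _ (- (1 - F b)))//; last by lra.
  by rewrite lerN2 ler_peMr//; have := n2R; lra.
by have := Fb; lra.
Qed.

Let Lfull : Lfunctional l (empirical x [set: 'I_n]) =
  b * prim 1 - \int[mu]_(y in `[a, b]) prim (F y).
Proof.
have [P PE] := empirical_probability x cardT; rewrite /F -PE.
apply: (LfunctionalE a01 lsupp dl h0 lh); rewrite PE -/F.
  by apply: lt_trans Fa _; have := a0; lra.
by have := a0; have := Fb; lra.
Qed.

Let Lloo i : Lfunctional l (empirical x [set~ i]) =
  b * prim 1 - \int[mu]_(y in `[a, b]) prim (Fi i y).
Proof.
have [P PE] := empirical_probability x (cardC i); rewrite /Fi -PE.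
apply: (LfunctionalE a01 lsupp dl h0 lh); rewrite PE.
  exact: Fia.
exact: Fib.
Qed.

Let mab : @measurable _ (measurableTypeR R) `[a, b]%classic.
Proof. exact: measurable_itv. Qed.

Let iab (f : R -> R) (M : R) : measurable_fun setT f -> (forall y, `|f y| <= M) ->
  mu.-integrable `[a, b] (EFin \o f).
Proof.
by move=> mf fM; apply: (integrable_segment mf (M := M)).
Qed.

Let bab (f : R -> R) (M : R) : measurable_fun setT f -> (forall y, `|f y| <= M) ->
  `|\int[mu]_(y in `[a, b]) f y| <= M * (b - a).
Proof.
by move=> mf fM; apply: Rintegral_segment_bounded.
Qed.

Let g i y := lam (F y) * (F y - H i y).

Let mg i : measurable_fun setT (g i).
Proof.
apply: measurable_funM; last exact: measurable_funB measurable_empirical_cdf (mH i).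
exact: measurableT_comp mlam measurable_empirical_cdf.
Qed.

Let gC i y : `|g i y| <= C.
Proof. by rewrite normrM -[leRHS]mulr1 ler_pM. Qed.

Lemma influence_empiricalE i :
  influence l (empirical x [set: 'I_n]) (x i) =
  \int[mu]_(y in `[a, b]) (lam (F y) * (F y - H i y)).
Proof.
rewrite /influence.
have -> : \int[mu]_y (lam (mcdf (empirical x [set: 'I_n]) y) *
   (mcdf \d_(x i : measurableTypeR R) y - mcdf (empirical x [set: 'I_n]) y)) =
   \int[mu]_(y in `[a, b]) (-1 * g i y).
  rewrite [RHS]Rintegral_mkcond; apply: eq_Rintegral => y _.
  rewrite patchE mcdf_dirac; case: ifPn => yab.
    by rewrite mulN1r /g -mulrN opprB.
  by rewrite (empirical_weight_out yab) mul0r.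
by rewrite (RintegralZl (-1) mab (iab (mg i) (gC i))) mulN1r opprK.
Qed.

Let phi i := \int[mu]_(y in `[a, b]) g i y.

Let phiB i : `|phi i| <= C * (b - a).
Proof. exact: bab. Qed.

Let sum_phi : \sum_(i < n) phi i = 0.
Proof.
rewrite /phi -(@Rintegral_sum _ _ _ mu _ mab); last by move=> i; exact: iab (mg i) (gC i).
rewrite -[RHS](Rintegral0 mu `[a, b]); apply: eq_Rintegral => y _.
have e : \sum_(i < n) H i y = n%:R * F y by rewrite empirical_cdfE mulrA mulfV// mul1r.
by rewrite -mulr_sumr sumrB sumr_const card_ord e mulr_natl subrr mulr0.
Qed.

Let err i := pseudovalue l x i - Lfunctional l (empirical x [set: 'I_n]) - phi i.

Let errB i : `|err i| <= C * (b - a) / (n%:R - 1).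
Proof.
have mF := measurable_empirical_cdf.
have [M hM] := primitive_bounded a01 lsupp dl h0 lh.
have i1 : mu.-integrable `[a, b] (EFin \o (fun y => prim (F y))).
  apply: (@iab _ M); first exact: measurableT_comp.
  by move=> y; apply: hM; exact: empirical_cdf_itv.
have i2 : mu.-integrable `[a, b] (EFin \o (fun y => prim (Fi i y))).
  apply: (@iab _ M); first by apply: measurableT_comp => //; exact: mFi.
  move=> y; apply: hM; have [P PE] := empirical_probability x (cardC i).
  by rewrite /Fi -PE mcdf_ge0 mcdf_le1.
pose r y := (n%:R - 1) * (prim (Fi i y) - prim (F y)) - g i y.
have i3 : mu.-integrable `[a, b] (EFin \o (fun y => prim (Fi i y) - prim (F y))).
  exact: (integrable_EFinB mab i2 i1).
have alg (N L1 A1 A2 A3 : R) :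
    N * (L1 - A1) - (N - 1) * (L1 - A2) - (L1 - A1) - A3 = (N - 1) * (A2 - A1) - A3.
  by ring.
have -> : err i = \int[mu]_(y in `[a, b]) r y.
  rewrite (RintegralB mab (integrable_EFinZ mab (n%:R - 1) i3) (iab (mg i) (gC i))).
  rewrite (RintegralZl (n%:R - 1) mab i3) (RintegralB mab i2 i1).
  rewrite /err /pseudovalue Lfull Lloo n1E -/(phi i).
  by rewrite [LHS](alg n%:R).
have -> : C * (b - a) / (n%:R - 1) = C / (n%:R - 1) * (b - a) by rewrite mulrAC.
apply: bab.
  apply: measurable_funB => //; apply: measurable_funM => //.
  by apply: measurable_funB; [exact: measurableT_comp mprim (mFi i)|exact: measurableT_comp mprim mF].
move=> y; rewrite /r /g.
have -> : F y - H i y = (n%:R - 1) * (Fi i y - F y).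
  by rewrite empirical_cdf_loo mulrC divfK// gt_eqF.
rewrite mulrCA -mulrBr normrM (gtr0_norm n1).
have P1 := primitive_taylor a01 lsupp dl lamL (Fi i y) (F y).
apply: le_trans (ler_wpM2l (ltW n1) P1) _.
rewrite empirical_cdf_loo expr_div_n mulrCA ler_wpM2l//.
have -> : (n%:R - 1) * ((F y - H i y) ^+ 2 / (n%:R - 1) ^+ 2) =
    (F y - H i y) ^+ 2 / (n%:R - 1) by field; rewrite gt_eqF.
apply: ler_piMl; first by rewrite invr_ge0 ltW.
by rewrite -(real_normK (num_real (_ - _))) exprn_ile1.
Qed.

Let Lf := Lfunctional l (empirical x [set: 'I_n]).

Let psE i : pseudovalue l x i = Lf + phi i + err i.
Proof. by rewrite /err /Lf; ring. Qed.

Lemma vjack_inf_jack_bound :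
  `|vjack l x - inf_jack l x| <= 34 * (C * (b - a)) ^+ 2 / n%:R.
Proof.
set B := C * (b - a); have B0 : 0 <= B by rewrite mulr_ge0// subr_ge0 ab.
pose E := B / (n%:R - 1); have E0 : 0 <= E by rewrite divr_ge0// ltW.
pose m := n%:R^-1 * \sum_(i < n) err i.
have meanE : n%:R^-1 * \sum_(j < n) pseudovalue l x j = Lf + m.
  under eq_bigr do rewrite psE.
  rewrite big_split/= big_split/= sum_phi addr0 sumr_const card_ord mulrDr /m; congr (_ + _).
  by rewrite -[X in _ * X]mulr_natl mulrA mulVf// mul1r.
have mB : `|m| <= E.
  rewrite /m normrM normfV (ger0_norm (_ : 0 <= n%:R))// mulrC ler_pdivrMr ?(lt_le_trans _ n2R)//.
  apply: le_trans (ler_norm_sum _ _ _) _.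
  apply: le_trans (ler_sum _ (fun i _ => errB i)) _.
  by rewrite sumr_const card_ord -[leLHS]mulr_natr.
have EB : E <= B by rewrite ler_pdivrMr// ler_peMr//; have := n2R; lra.
have vE : vjack l x = (n%:R - 1)^-1 * \sum_(i < n) (phi i + (err i - m)) ^+ 2.
  rewrite /vjack n1E meanE; congr (_ * _); apply: eq_bigr => i _.
  by rewrite psE; congr (_ ^+ 2); ring.
have iE : inf_jack l x = n%:R^-1 * \sum_(i < n) phi i ^+ 2.
  by rewrite /inf_jack; congr (_ * _); apply: eq_bigr => i _; rewrite influence_empiricalE.
have -> : vjack l x - inf_jack l x =
    (n%:R - 1)^-1 * \sum_(i < n) ((phi i + (err i - m)) ^+ 2 - phi i ^+ 2) +
    (n%:R * (n%:R - 1))^-1 * \sum_(i < n) phi i ^+ 2.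
  rewrite vE iE sumrB; set S1 := \sum_(i < n) _; set S2 := \sum_(i < n) _.
  by field; rewrite n0 gt_eqF.
have t1 : `|\sum_(i < n) ((phi i + (err i - m)) ^+ 2 - phi i ^+ 2)| <= n%:R * (8 * B * E).
  apply: le_trans (ler_norm_sum _ _ _) _.
  apply: (@le_trans _ _ (\sum_(i < n) (8 * B * E))); last by rewrite sumr_const card_ord [leRHS]mulr_natl.
  apply: ler_sum => i _.
  have -> : (phi i + (err i - m)) ^+ 2 - phi i ^+ 2 = (err i - m) * (2 * phi i + (err i - m)).
    by ring.
  have d2 : `|err i - m| <= 2 * E.
    by apply: le_trans (ler_normB _ _) _; have := errB i; rewrite -/B -/E; lra.
  have d3 : `|2 * phi i + (err i - m)| <= 4 * B.
    apply: le_trans (ler_normD _ _) _; rewrite normrM (ger0_norm (_ : 0 <= 2))//.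
    by have := phiB i; rewrite -/B; lra.
  rewrite normrM (_ : 8 * B * E = 2 * E * (4 * B)); last by ring.
  exact: ler_pM.
have t2 : `|\sum_(i < n) phi i ^+ 2| <= n%:R * B ^+ 2.
  apply: le_trans (ler_norm_sum _ _ _) _.
  apply: (@le_trans _ _ (\sum_(i < n) B ^+ 2)); last by rewrite sumr_const card_ord [leRHS]mulr_natl.
  apply: ler_sum => i _; rewrite normrX lerXn2r ?nnegrE//; exact: phiB.
apply: le_trans (ler_normD _ _) _; rewrite !normrM.
have np : 0 < n%:R :> R by exact: lt_le_trans n2R.
have i1 : 0 <= (n%:R - 1)^-1 :> R by rewrite invr_ge0 ltW.
have i2 : 0 <= (n%:R * (n%:R - 1))^-1 :> R by rewrite invr_ge0 mulr_ge0// ltW.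
rewrite (ger0_norm i1) (ger0_norm i2).
apply: le_trans (lerD (ler_wpM2l i1 t1) (ler_wpM2l i2 t2)) _.
have -> : (n%:R - 1)^-1 * (n%:R * (8 * B * E)) + (n%:R * (n%:R - 1))^-1 * (n%:R * B ^+ 2) =
    B ^+ 2 / n%:R * (8 * (n%:R / (n%:R - 1)) ^+ 2 + n%:R / (n%:R - 1)).
  by rewrite /E; field; rewrite n0 gt_eqF.
have -> : 34 * B ^+ 2 / n%:R = B ^+ 2 / n%:R * 34 by field.
apply: ler_wpM2l; first by apply: divr_ge0; [exact: sqr_ge0|exact: ler0n].
set t := n%:R / (n%:R - 1).
have t0 : 0 <= t by rewrite divr_ge0// ltW.
have tle : t <= 2 by rewrite ler_pdivrMr//; have := n2R; lra.
have : t ^+ 2 <= 2 * t by rewrite expr2 ler_wpM2r.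
by lra.
Qed.

End jackknife.

(** * Expansion of the variance functional *)

Section box_functions.
Context {R : realType} d (T : measurableType d).
Variables (m : {sigma_finite_measure set T -> \bar R}) (D : set T).
Hypotheses (mD : measurable D) (Dfin : (m D < +oo)%E).

Definition boxfn (f : T * T -> R) :=
  [/\ measurable_fun setT f, exists M, forall z, `|f z| <= M
    & forall x y, ~ (D x /\ D y) -> f (x, y) = 0].

Definition box (f : T * T -> R) : R := \int[m]_z \int[m]_y f (y, z).

Lemma boxfnD f g : boxfn f -> boxfn g -> boxfn (fun z => f z + g z).
Proof.
move=> [mf [M fM] f0] [mg [N gN] g0]; split; first exact: measurable_funD.
  by exists (M + N) => z; rewrite (le_trans (ler_normD _ _))// lerD.
by move=> x y xy; rewrite f0// g0// addr0.
Qed.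

Lemma boxfnZ (k : R) f : boxfn f -> boxfn (fun z => k * f z).
Proof.
move=> [mf [M fM] f0]; split; first exact: measurable_funM.
  by exists (`|k| * M) => z; rewrite normrM ler_wpM2l.
by move=> x y xy; rewrite f0// mulr0.
Qed.

Lemma boxfn_sum I (s : seq I) (f : I -> T * T -> R) : (forall i, boxfn (f i)) ->
  boxfn (fun z => \sum_(i <- s) f i z).
Proof.
move=> bf; elim: s => [|i s ih].
  under [X in boxfn X]eq_fun do rewrite big_nil.
  by split=> //; exists 0 => z; rewrite normr0.
under [X in boxfn X]eq_fun do rewrite big_cons.
exact: boxfnD.
Qed.

Lemma boxfn_swap f : boxfn f -> boxfn (fun z => f (z.2, z.1)).
Proof.
move=> [mf [M fM] f0]; split; last by move=> x y xy; apply: f0 => -[? ?]; apply: xy.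
- apply: (measurableT_comp mf); exact: (measurable_fun_pair measurable_snd measurable_fst).
- by exists M => z; exact: fM.
Qed.

Lemma boxE f : boxfn f -> box f = \int[m]_y \int[m]_z f (y, z).
Proof.
by move=> [mf [M fM] f0]; rewrite /box (@Rfubini R _ _ _ _ m m D D f M mD mD Dfin Dfin mf fM f0).
Qed.

Lemma box_swap f : boxfn f -> box (fun z => f (z.2, z.1)) = box f.
Proof. by move=> bf; rewrite (boxE bf). Qed.

Lemma boxfn_integrable f : boxfn f -> (m \x m)%E.-integrable setT (EFin \o f).
Proof.
by move=> [mf [M fM] f0]; exact: (@integrable_box R _ _ _ _ m m D D f M mD mD Dfin Dfin mf fM f0).
Qed.

Lemma boxfn_slice f x : boxfn f -> m.-integrable setT (fun y => (f (x, y))%:E).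
Proof.
move=> [mf [M fM] f0].
have -> : (fun y => (f (x, y))%:E) = (fun y => (f (x, y))%:E) \_ D.
  apply/funext => y; rewrite patchE; case: ifPn => // /negP yB.
  by rewrite f0// => -[_ By]; apply: yB; exact/mem_set.
apply/(integrable_mkcond (fun y => (f (x, y))%:E) mD).
apply: (@integrable_bounded _ _ _ m _ mD Dfin (fun y => f (x, y)) M) => //.
by apply: measurable_funTS; apply: measurableT_comp.
Qed.

Lemma box_prod f : boxfn f -> box f = \int[(m \x m)%E]_z f z.
Proof.
move=> bf; rewrite boxE//.
have fi := boxfn_integrable bf.
rewrite /Rintegral; congr fine; rewrite -(integral12_prod_meas1 fi).
apply: eq_integral => x _; rewrite fineK//; apply: integrable_fin_num => //.
exact: boxfn_slice.
Qed.

Lemma boxD f g : boxfn f -> boxfn g -> box (fun z => f z + g z) = box f + box g.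
Proof.
move=> bf bg; rewrite !box_prod//; last exact: boxfnD.
by rewrite (RintegralD _ (boxfn_integrable bf) (boxfn_integrable bg)).
Qed.

Lemma boxZ (k : R) f : boxfn f -> box (fun z => k * f z) = k * box f.
Proof.
move=> bf; rewrite !box_prod//; last exact: boxfnZ.
by rewrite (RintegralZl _ _ (boxfn_integrable bf)).
Qed.

Lemma box_sum I (s : seq I) (f : I -> T * T -> R) : (forall i, boxfn (f i)) ->
  box (fun z => \sum_(i <- s) f i z) = \sum_(i <- s) box (f i).
Proof.
move=> bf; elim: s => [|i s ih].
  rewrite big_nil /box -[RHS](Rintegral0 m setT); apply: eq_Rintegral => z _.
  by under eq_Rintegral do rewrite big_nil; rewrite Rintegral0.
rewrite big_cons -ih; apply: etrans (boxD (bf i) (boxfn_sum s bf)).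
by congr box; apply/funext => z; rewrite big_cons.
Qed.

Lemma boxfn_tensor (u v : T -> R) (k : T * T -> R) (M : R) :
  measurable_fun setT u -> measurable_fun setT v -> measurable_fun setT k ->
  (forall x, `|u x| <= M) -> (forall x, `|v x| <= M) -> (forall z, `|k z| <= M) ->
  (forall x, ~ D x -> u x = 0) -> (forall x, ~ D x -> v x = 0) ->
  boxfn (fun z => u z.1 * k z * v z.2).
Proof.
move=> mu mv mk uM vM kM u0 v0; split.
- apply: measurable_funM; last exact: (measurableT_comp mv measurable_snd).
  by apply: measurable_funM => //; exact: (measurableT_comp mu measurable_fst).
- by exists (M * M * M) => z; rewrite !normrM ler_pM// ler_pM.
- move=> x y /=; have [Dx|Dx] := pselect (D x); last by rewrite u0// !mul0r.
  by have [Dy|Dy] := pselect (D y); [case|rewrite v0// mulr0].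
Qed.

Lemma Rintegral_indic_mkcond (r : T -> R) :
  \int[m]_(y in D) r y = \int[m]_y (\1_D y * r y).
Proof.
rewrite Rintegral_mkcond; apply: eq_Rintegral => y _.
by rewrite patchE indicE; case: (y \in D); rewrite ?mul1r ?mul0r.
Qed.

Lemma box_mul (u v : T -> R) (M : R) : measurable_fun setT u -> measurable_fun setT v ->
  (forall x, `|u x| <= M) -> (forall x, `|v x| <= M) ->
  (forall x, ~ D x -> u x = 0) -> (forall x, ~ D x -> v x = 0) ->
  box (fun z => u z.1 * v z.2) = (\int[m]_y u y) * \int[m]_z v z.
Proof.
move=> mu mv uM vM u0 v0.
have int (w : T -> R) : measurable_fun setT w -> (forall x, `|w x| <= M) ->
    (forall x, ~ D x -> w x = 0) -> m.-integrable setT (EFin \o w).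
  move=> mw wM w0; have -> : EFin \o w = (EFin \o w) \_ D.
    apply/funext => y; rewrite patchE; case: ifPn => // /negP yB /=.
    by rewrite w0// => By; apply: yB; exact/mem_set.
  apply/(integrable_mkcond (EFin \o w) mD).
  by apply: (@integrable_bounded _ _ _ m _ mD Dfin w M) => //; exact: measurable_funTS.
have iu := int u mu uM u0; have iv := int v mv vM v0.
rewrite -(RintegralZl (\int[m]_y u y) measurableT iv); apply: eq_Rintegral => z _.
exact: (RintegralZr (v z) measurableT iu).
Qed.

Lemma box_le f (r : T -> R) (M : R) : boxfn f -> measurable_fun setT r ->
  (forall x, 0 <= r x <= M) ->
  (forall x y, D x -> D y -> `|f (x, y)| <= r x + r y) ->
  `|box f| <= 2 * fine (m D) * \int[m]_(y in D) r y.
Proof.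
move=> bf mr rM fr.
have M0 : 0 <= M by have /andP[r0 r1] := rM point; exact: le_trans r1.
pose i (x : T) : R := \1_D x.
have mi : measurable_fun setT i by exact: measurable_indic.
have iD x : ~ D x -> i x = 0 by move=> Dx; rewrite /i indicE memNset.
have i1 x : D x -> i x = 1 by move=> Dx; rewrite /i indicE mem_set.
have ile x : `|i x| <= M + 1.
  by rewrite /i indicE normr_nat (@le_trans _ _ 1) ?lern1 ?leq_b1// lerDr.
have irle x : `|i x * r x| <= M + 1.
  have /andP[r0 r1] := rM x; rewrite normrM (ger0_norm r0) (@le_trans _ _ (r x))//.
    by rewrite ler_piMl// /i indicE normr_nat lern1 leq_b1.
  by rewrite (le_trans r1)// lerDl.
have mir : measurable_fun setT (fun x => i x * r x) by exact: measurable_funM.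
have irD x : ~ D x -> i x * r x = 0 by move=> Dx; rewrite iD// mul0r.
have mk : measurable_fun setT (fun _ : T * T => (1:R)) by [].
have kM (z : T * T) : `|(1:R)| <= M + 1 by rewrite normr1 lerDr.
have b1 := boxfn_tensor mir mi mk irle ile kM irD iD.
have b2 := boxfn_tensor mi mir mk ile irle kM iD irD.
have iE : \int[m]_z i z = fine (m D).
  rewrite /i /Rintegral integral_indic// setIT //.
have e1 : box (fun z => i z.1 * r z.1 * 1 * i z.2) = fine (m D) * \int[m]_(y in D) r y.
  rewrite mulrC -iE Rintegral_indic_mkcond -(box_mul mir mi irle ile irD iD).
  by congr box; apply/funext => z; rewrite mulr1.
have e2 : box (fun z => i z.1 * 1 * (i z.2 * r z.2)) = fine (m D) * \int[m]_(y in D) r y.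
  rewrite -iE Rintegral_indic_mkcond -(box_mul mi mir ile irle iD irD).
  by congr box; apply/funext => z; rewrite mulr1.
have -> : 2 * fine (m D) * \int[m]_(y in D) r y =
    box (fun z => i z.1 * r z.1 * 1 * i z.2 + i z.1 * 1 * (i z.2 * r z.2)).
  by rewrite (boxD b1 b2) e1 e2; ring.
have fi := boxfn_integrable bf; have gi := boxfn_integrable (boxfnD b1 b2).
rewrite (box_prod bf) (box_prod (boxfnD b1 b2)).
apply: le_trans (le_normr_Rintegral measurableT fi) _.
apply: (le_Rintegral measurableT (integrable_norm fi) gi) => -[x y] _ /=.
have [Dx|Dx] := pselect (D x); last first.
  have [_ _ ->] := bf; last by case.
  by rewrite normr0 iD// !mul0r addr0.
have [Dy|Dy] := pselect (D y); last first.
  have [_ _ ->] := bf; last by case.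
  by rewrite normr0 (iD y)// !mul0r !mulr0 addr0.
by rewrite !i1// !mulr1 !mul1r; exact: fr.
Qed.

End box_functions.

Lemma expansion_bound (R : realFieldType) (C e k Ny Nz gy gz g'y g'z Dy Dz Fy Fz Fm Dm : R) :
  0 <= C -> `|Ny| <= C -> `|Nz| <= C -> `|gy| <= C -> `|gz| <= C ->
  `|Ny - gy| <= C * `|Dy| -> `|Nz - gz| <= C * `|Dz| ->
  `|Ny - gy - g'y * Dy| <= e * `|Dy| + k * Dy ^+ 2 ->
  `|Nz - gz - g'z * Dz| <= e * `|Dz| + k * Dz ^+ 2 ->
  0 <= Fy <= 1 -> 0 <= Fz <= 1 -> `|Fm - Fy * Fz| <= 1 -> `|Dm| <= `|Dy| + `|Dz| ->
  `|Ny * (Fm + Dm - (Fy + Dy) * (Fz + Dz)) * Nz -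
    (gy * (Fm - Fy * Fz) * gz + gy * (Dm - Fy * Dz - Dy * Fz) * gz +
     (g'y * Dy * (Fm - Fy * Fz) * gz + g'z * Dz * (Fm - Fy * Fz) * gy))| <=
  (C * e * `|Dy| + (C * k + 5 * C ^+ 2) * Dy ^+ 2) +
  (C * e * `|Dz| + (C * k + 5 * C ^+ 2) * Dz ^+ 2).
Proof.
move=> C0 hNy hNz hgy hgz dNy dNz tNy tNz /andP[Fy0 Fy1] /andP[Fz0 Fz1] hGam hDm.
rewrite -(real_normK (num_real Dy)) -(real_normK (num_real Dz)) in tNy tNz *.
set p := `|Dy| in dNy tNy hDm *; set q := `|Dz| in dNz tNz hDm *.
have p0 : 0 <= p by rewrite normr_ge0.
have q0 : 0 <= q by rewrite normr_ge0.
set G := Fm - Fy * Fz in hGam *.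
pose L1 := Dm - Fy * Dz - Dy * Fz.
have L1B : `|L1| <= 2 * (p + q).
  apply: le_trans (ler_normB _ _) _; rewrite normrM (ger0_norm Fz0).
  have a1 : p * Fz <= p by rewrite ler_piMr.
  have a2 : `|Dm - Fy * Dz| <= (p + q) + q.
    apply: le_trans (ler_normB _ _) _; rewrite lerD// normrM (ger0_norm Fy0).
    by rewrite ler_piMl.
  by rewrite -/p; lra.
pose N2 := Ny * Nz - gy * gz.
have N2B : `|N2| <= C * C * (p + q).
  have -> : N2 = (Ny - gy) * Nz + gy * (Nz - gz) by rewrite /N2; ring.
  apply: le_trans (ler_normD _ _) _; rewrite !normrM.
  have -> : C * C * (p + q) = C * p * C + C * (C * q) by ring.
  by apply: lerD; apply: ler_pM.
pose T3 := N2 - g'y * Dy * gz - g'z * Dz * gy.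
have T3B : `|T3| <= (e * p + k * p ^+ 2) * C + (e * q + k * q ^+ 2) * C + C * p * (C * q).
  have -> : T3 = (Ny - gy - g'y * Dy) * gz + (Nz - gz - g'z * Dz) * gy + (Ny - gy) * (Nz - gz).
    by rewrite /T3 /N2; ring.
  apply: le_trans (ler_normD _ _) _; rewrite normrM.
  apply: lerD; last by apply: ler_pM.
  by apply: le_trans (ler_normD _ _) _; rewrite !normrM; apply: lerD; apply: ler_pM.
have -> : Ny * (Fm + Dm - (Fy + Dy) * (Fz + Dz)) * Nz -
    (gy * G * gz + gy * (Dm - Fy * Dz - Dy * Fz) * gz +
     (g'y * Dy * G * gz + g'z * Dz * G * gy)) =
    - (Ny * Nz * (Dy * Dz)) + N2 * L1 + G * T3.
  by rewrite /T3 /N2 /L1 /G; ring.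
apply: le_trans (ler_normD _ _) _.
have b3 : `|G * T3| <= (e * p + k * p ^+ 2) * C + (e * q + k * q ^+ 2) * C + C * p * (C * q).
  by rewrite normrM; apply: le_trans T3B; rewrite ler_piMl.
have b2 : `|N2 * L1| <= C * C * (p + q) * (2 * (p + q)) by rewrite normrM; apply: ler_pM.
have b1 : `|- (Ny * Nz * (Dy * Dz))| <= C * C * (p * q).
  by rewrite normrN !normrM -/p -/q; apply: ler_wpM2r; rewrite ?mulr_ge0//; apply: ler_pM.
apply: le_trans (lerD (le_trans (ler_normD _ _) (lerD b1 b2)) b3) _.
have sq : 0 <= C ^+ 2 * (p - q) ^+ 2 by rewrite mulr_ge0 ?sqr_ge0.
rewrite -subr_ge0; apply: le_trans (mulr_ge0 (ler0n R 3) sq) _.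
by rewrite le_eqVlt; apply/orP; left; apply/eqP; ring.
Qed.

Section sigma2_expansion.
Context {R : realType}.
Local Notation mu := (@lebesgue_measure R).
Variables (alpha h : R) (l : R -> R).
Hypothesis a01 : 0 < alpha < 1 / 2.
Hypothesis lsupp : supported_in l alpha (1 - alpha).
Hypothesis dl : forall u : R, 0 < u < 1 -> derivable l u 1.
Hypothesis h0 : 0 < h.
Hypothesis lh : hoelder_on01 h (derive1 l).

Local Notation lam := (ext01 l).
Local Notation lam' := (ext01 (derive1 l)).

Let mlam : measurable_fun setT lam.
Proof.
apply: continuous_measurable_fun.
exact: is_derive_continuous (is_derive_ext01 a01 lsupp dl).
Qed.

Lemma measurable_ext01_derive : measurable_fun setT lam'.
Proof.
apply: continuous_measurable_fun => u.
have [C [C0 hC]] := ext01_derive_hoelder a01 lsupp dl h0 lh.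
apply/cvgrPdist_le => e e0.
have C1 : 0 < C + 1 by lra.
have eC : 0 < e / (C + 1) by rewrite divr_gt0.
pose del := (e / (C + 1)) `^ h^-1.
have d0 : 0 < del by rewrite powR_gt0.
have dh : del `^ h = e / (C + 1) by rewrite -powRrM mulVf ?gt_eqF// powRr1// ltW.
apply/nbhs_ballP; exists del => //= v; rewrite /ball/= => uv.
apply: le_trans (hC _ _) _.
have p : `|u - v| `^ h <= e / (C + 1).
  by rewrite -dh; apply: ge0_ler_powR; rewrite ?nnegrE ?(ltW h0) ?(ltW d0)// ltW.
apply: le_trans (ler_wpM2l C0 p) _.
rewrite mulrCA; apply: ler_piMr; [exact: ltW|by rewrite ler_pdivrMr// mul1r; lra].
Qed.

Let mlam' := measurable_ext01_derive.

Variables (a b : R).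
Let mab : @measurable _ (measurableTypeR R) `[a, b]%classic.
Proof. exact: measurable_itv. Qed.
Let fab := lebesgue_segment_lty a b.

Section weight_out.
Variable q : probability (measurableTypeR R) R.
Hypotheses (qa : mcdf q a < alpha) (qb : 1 - alpha < mcdf q b).

Let out y : ~ `[a, b]%classic y -> mcdf q y < alpha \/ 1 - alpha < mcdf q y.
Proof.
rewrite /= in_itv/= => /negP; rewrite negb_and -!ltNge => /orP[ya|yb].
  by left; apply: le_lt_trans qa; apply: mcdf_nd; exact: ltW.
by right; apply: lt_le_trans qb _; apply: mcdf_nd; exact: ltW.
Qed.

Lemma weight_out y : ~ `[a, b]%classic y -> lam (mcdf q y) = 0.
Proof.
move=> /out yo; apply: (ext01_eq0 lsupp); rewrite negb_and -!ltNge.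
by case: yo => ->; rewrite ?orbT.
Qed.

Lemma weight_derive_out y : ~ `[a, b]%classic y -> lam' (mcdf q y) = 0.
Proof. by move=> /out yo; exact: (ext01_derive_eq0 a01 lsupp dl). Qed.

Let ms (f : R -> R) : measurable_fun setT f -> measurable_fun setT (f \o mcdf q).
Proof. by move=> mf; exact: measurableT_comp mf (measurable_mcdf q). Qed.

Lemma measurable_Gamma : measurable_fun setT (fun z : R * R => Gamma q z.1 z.2).
Proof.
have m1 := measurableT_comp (measurable_mcdf q) (@measurable_fst _ _ R R).
have m2 := measurableT_comp (measurable_mcdf q) (@measurable_snd _ _ R R).
by apply: measurable_funB; [exact: measurable_minr m1 m2|exact: measurable_funM].
Qed.

Lemma Gamma_le1 y z : `|Gamma q y z| <= 1.
Proof.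
have := mcdf_ge0 q y; have := mcdf_ge0 q z; have := mcdf_le1 q y; have := mcdf_le1 q z.
rewrite /Gamma; set u := mcdf q y; set v := mcdf q z => v1 u1 v0 u0.
have [uv|/ltW uv] := leP u v.
  have s1 : 0 <= u * (1 - v) by rewrite mulr_ge0// subr_ge0.
  have s2 : 0 <= u * v by rewrite mulr_ge0.
  by rewrite ler_norml; apply/andP; split; lra.
have s1 : 0 <= v * (1 - u) by rewrite mulr_ge0// subr_ge0.
have s2 : 0 <= u * v by rewrite mulr_ge0.
by rewrite ler_norml; apply/andP; split; lra.
Qed.

Lemma boxfn_sigma2 :
  boxfn `[a, b] (fun z : R * R => lam (mcdf q z.1) * Gamma q z.1 z.2 * lam (mcdf q z.2)).
Proof.
have [C [C0 lamC _ _]] := ext01_bounds a01 lsupp dl h0 lh.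
apply: (@boxfn_tensor R _ _ _ (lam \o mcdf q) (lam \o mcdf q) _ (C + 1)).
- exact: ms.
- exact: ms.
- exact: measurable_Gamma.
- by move=> x; rewrite (le_trans (lamC _))// lerDl.
- by move=> x; rewrite (le_trans (lamC _))// lerDl.
- by move=> x; rewrite (le_trans (Gamma_le1 _ _))// lerDr.
- exact: weight_out.
- exact: weight_out.
Qed.

End weight_out.

Variable p : probability (measurableTypeR R) R.
Hypotheses (pa : mcdf p a < alpha) (pb : 1 - alpha < mcdf p b).
Local Notation F := (mcdf p).

(* The kernel of the linear functional Y + Z: b (min y z) is split according to
   y <= z or z < y and the variables are exchanged in the terms containing b z. *)
Definition limit_kernel (z : R * R) : R :=
  lam (F z.1) * ((z.1 <= z.2)%R%:R + (z.1 < z.2)%R%:R - 2 * F z.2) * lam (F z.2) +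
  2 * (lam' (F z.1) * Gamma p z.1 z.2 * lam (F z.2)).

Definition limit_weight (y : R) : R := \int[mu]_z limit_kernel (y, z).

Let mF := measurable_mcdf p.

Let boxfn_lam (k : R * R -> R) : measurable_fun setT k -> (forall z, `|k z| <= 4) ->
  boxfn `[a, b] (fun z => lam (F z.1) * k z * lam (F z.2)).
Proof.
move=> mk k4; have [C [C0 lamC _ _]] := ext01_bounds a01 lsupp dl h0 lh.
have lamC4 x : `|lam (F x)| <= C + 4 by rewrite (le_trans (lamC _))// lerDl.
apply: (@boxfn_tensor R _ _ _ (lam \o F) (lam \o F) _ (C + 4)) => //.
- exact: measurableT_comp.
- exact: measurableT_comp.
- by move=> z; rewrite (le_trans (k4 z))// lerDr.
- exact: weight_out.
- exact: weight_out.
Qed.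

Let boxfn_lam' : boxfn `[a, b] (fun z => lam' (F z.1) * Gamma p z.1 z.2 * lam (F z.2)).
Proof.
have [C [C0 lamC lamC' _]] := ext01_bounds a01 lsupp dl h0 lh.
apply: (@boxfn_tensor R _ _ _ (lam' \o F) (lam \o F) _ (C + 4)) => //.
- exact: measurableT_comp.
- exact: measurableT_comp.
- exact: measurable_Gamma.
- by move=> x; rewrite (le_trans (lamC' _))// lerDl.
- by move=> x; rewrite (le_trans (lamC _))// lerDl.
- by move=> x; rewrite (le_trans (Gamma_le1 _ _ _))//; lra.
- exact: weight_derive_out.
- exact: weight_out.
Qed.

Let F2 : measurable_fun setT (fun z : R * R => F z.2).
Proof. exact: measurableT_comp mF measurable_snd. Qed.

Let boxfn_le : boxfn `[a, b] (fun z => lam (F z.1) * ((z.1 <= z.2)%R%:R - F z.2) * lam (F z.2)).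
Proof.
apply: (boxfn_lam (k := fun z => (z.1 <= z.2)%R%:R - F z.2)).
  by apply: measurable_funB => //; exact: measurable_le2.
move=> z; apply: le_trans (ler_normB _ _) _; rewrite normr_nat (ger0_norm (mcdf_ge0 _ _)).
by have := mcdf_le1 p z.2; case: (leP z.1 z.2) => _ /=; lra.
Qed.

Let boxfn_lt : boxfn `[a, b] (fun z => lam (F z.1) * ((z.1 < z.2)%R%:R - F z.2) * lam (F z.2)).
Proof.
apply: (boxfn_lam (k := fun z => (z.1 < z.2)%R%:R - F z.2)).
  by apply: measurable_funB => //; exact: measurable_lt2.
move=> z; apply: le_trans (ler_normB _ _) _; rewrite normr_nat (ger0_norm (mcdf_ge0 _ _)).
by have := mcdf_le1 p z.2; case: (ltP z.1 z.2) => _ /=; lra.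
Qed.

Let kernelE z : limit_kernel z =
  lam (F z.1) * ((z.1 <= z.2)%R%:R - F z.2) * lam (F z.2) +
  lam (F z.1) * ((z.1 < z.2)%R%:R - F z.2) * lam (F z.2) +
  2 * (lam' (F z.1) * Gamma p z.1 z.2 * lam (F z.2)).
Proof. by rewrite /limit_kernel; ring. Qed.

Lemma boxfn_limit_kernel : boxfn `[a, b] limit_kernel.
Proof.
have := boxfnD (boxfnD boxfn_le boxfn_lt) (boxfnZ 2 boxfn_lam').
by congr boxfn; apply/funext => z; rewrite kernelE.
Qed.

Lemma measurable_limit_weight : measurable_fun setT limit_weight.
Proof.
have [mk [M kM] k0] := boxfn_limit_kernel.
exact: (@measurable_Rintegral2 R _ _ _ _ mu mu _ _ _ M mab mab fab fab mk kM k0).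
Qed.

Lemma limit_weight_out y : ~ `[a, b]%classic y -> limit_weight y = 0.
Proof.
move=> yab; have [mk [M kM] k0] := boxfn_limit_kernel.
rewrite /limit_weight -[RHS](Rintegral0 mu setT); apply: eq_Rintegral => z _.
by rewrite k0// => -[].
Qed.

Lemma limit_weight_bounded : exists M, forall y, `|limit_weight y| <= M.
Proof.
have [mk [M kM] k0] := boxfn_limit_kernel; exists (M * fine (mu `[a, b]%classic)) => y.
have -> : limit_weight y = \int[mu]_(z in `[a, b]) limit_kernel (y, z).
  rewrite [RHS]Rintegral_mkcond; apply: eq_Rintegral => z _; rewrite patchE.
  case: ifPn => // /negP zab; rewrite k0// => -[_ z'].
  by apply: zab; exact/mem_set.
have mky : measurable_fun `[a, b] (fun z => limit_kernel (y, z)).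
  by apply: measurable_funTS; exact: measurableT_comp mk (pair1_measurable y).
exact: (@Rintegral_bounded _ _ _ mu _ mab fab _ M mky (fun z _ => kM _)).
Qed.

Let boxfn_mull (f : R * R -> R) (u : R -> R) (M : R) : boxfn `[a, b] f ->
  measurable_fun setT u -> (forall y, `|u y| <= M) ->
  boxfn `[a, b] (fun z => u z.1 * f z).
Proof.
move=> [mf [N fN] f0] mu_ uM; split.
- by apply: measurable_funM => //; exact: measurableT_comp mu_ measurable_fst.
- by exists (M * N) => z; rewrite normrM ler_pM.
- by move=> x y xy; rewrite f0// mulr0.
Qed.

Lemma limit_YZ (u : R -> R) (M : R) : measurable_fun setT u -> (forall y, `|u y| <= M) ->
  limit_Y l p u + limit_Z l p u = \int[mu]_(y in `[a, b]) (u y * limit_weight y).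
Proof.
move=> mu_ uM.
have bA := boxfn_mull boxfn_le mu_ uM.
have bA' := boxfn_mull boxfn_lt mu_ uM.
have bA'' := boxfn_mull boxfn_lam' mu_ uM.
have bk := boxfn_mull boxfn_limit_kernel mu_ uM.
set A := (fun z : R * R => _) in bA; set A' := (fun z : R * R => _) in bA'.
set A'' := (fun z : R * R => _) in bA''.
have YE : limit_Y l p u = box mu A + box mu A'.
  rewrite -(box_swap mab fab bA') -(boxD mab fab bA (boxfn_swap bA')).
  apply: eq_Rintegral => z _; apply: eq_Rintegral => y _; rewrite /A /A' /=.
  by have [yz|yz] := leP y z; rewrite ?mulr1n ?mulr0n; ring.
have ZE : limit_Z l p u = 2 * box mu A''.
  apply: (congr1 (fun t : R => 2 * t)).
  apply: eq_Rintegral => z _; apply: eq_Rintegral => y _; rewrite /A'' /=.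
  by ring.
rewrite YE ZE -(boxD mab fab bA bA') -(boxZ mab fab 2 bA'').
rewrite -(boxD mab fab (boxfnD bA bA') (boxfnZ 2 bA'')).
have -> : (fun z => A z + A' z + 2 * A'' z) = (fun z => u z.1 * limit_kernel z).
  by apply/funext => z; rewrite kernelE /A /A' /A''; ring.
rewrite (boxE mab fab bk) [RHS]Rintegral_mkcond; apply: eq_Rintegral => y _.
rewrite patchE /=.
have ik := boxfn_slice mab fab y boxfn_limit_kernel.
apply: (etrans (RintegralZl (u y) measurableT ik)).
case: ifPn => [//|/negP yab].
have -> : \int[mu]_z limit_kernel (y, z) = 0.
  by apply: limit_weight_out => y'; apply: yab; exact/mem_set.
by rewrite mulr0.
Qed.

End sigma2_expansion.

Section expansion.
Context {R : realType}.
Local Notation mu := (@lebesgue_measure R).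
Variables (alpha h : R) (l : R -> R).
Hypothesis a01 : 0 < alpha < 1 / 2.
Hypothesis lsupp : supported_in l alpha (1 - alpha).
Hypothesis dl : forall u : R, 0 < u < 1 -> derivable l u 1.
Hypothesis h0 : 0 < h.
Hypothesis lh : hoelder_on01 h (derive1 l).

Local Notation lam := (ext01 l).
Local Notation lam' := (ext01 (derive1 l)).

Let clam : continuous lam.
Proof. exact: is_derive_continuous (is_derive_ext01 a01 lsupp dl). Qed.

Let mlam : measurable_fun setT lam.
Proof. exact: continuous_measurable_fun. Qed.

Let mlam' := measurable_ext01_derive a01 lsupp dl h0 lh.

Variables (a b : R).
Let mab : @measurable _ (measurableTypeR R) `[a, b]%classic.
Proof. exact: measurable_itv. Qed.
Let fab := lebesgue_segment_lty a b.

Variable p : probability (measurableTypeR R) R.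
Hypotheses (pa : mcdf p a < alpha) (pb : 1 - alpha < mcdf p b).
Local Notation F := (mcdf p).
Let mF := measurable_mcdf p.

Let ab : a <= b.
Proof.
by have /andP[_ a2] := a01; exact: mcdf_segment a2 pa (ltW pb).
Qed.

Lemma sigma2_expansion (e : R) : 0 < e -> exists k : R, 0 <= k /\
  forall (q : probability (measurableTypeR R) R) (D : R -> R),
  mcdf q a < alpha -> 1 - alpha < mcdf q b -> (forall y, D y = mcdf q y - F y) ->
  `|sigma2 l q - sigma2 l p - \int[mu]_(y in `[a, b]) (D y * limit_weight l p y)| <=
  \int[mu]_(y in `[a, b]) (e * `|D y| + k * D y ^+ 2).
Proof.
move=> e0; have [C [C0 lamC lamC' lamL]] := ext01_bounds a01 lsupp dl h0 lh.
pose c := 2 * (b - a); have c0 : 0 <= c by rewrite mulr_ge0// subr_ge0.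
have cC0 : 0 <= c * C by rewrite mulr_ge0.
pose e' := e / (c * C + 1).
have e'0 : 0 < e' by rewrite divr_gt0//; lra.
have [k' [k'0 tay]] := ext01_taylor a01 lsupp dl h0 lh e'0.
have key (t : R) : 0 <= t -> t * e / (t + 1) <= e.
  by move=> t0; rewrite ler_pdivrMr ?mulrDr ?mulr1 1?mulrC ?lerDl; lra.
pose r D := C * e' * `|D| + (C * k' + 5 * C ^+ 2) * D ^+ 2.
have ck0 : 0 <= C * k' + 5 * C ^+ 2.
  by rewrite addr_ge0// mulr_ge0// exprn_ge0.
exists (c * (C * k' + 5 * C ^+ 2)); split; first exact: mulr_ge0.
move=> q D qa qb DE.
have mq := measurable_mcdf q.
have mD : measurable_fun setT D by rewrite (funext DE); exact: measurable_funB.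
have D1 y : `|D y| <= 1.
  have := mcdf_ge0 q y; have := mcdf_le1 q y; have := mcdf_ge0 p y; have := mcdf_le1 p y.
  by rewrite DE ler_norml => *; apply/andP; split; lra.
have D21 y : D y ^+ 2 <= 1 by rewrite -(real_normK (num_real _)) exprn_ile1.
pose fq z := lam (mcdf q z.1) * Gamma q z.1 z.2 * lam (mcdf q z.2).
pose fp z := lam (F z.1) * Gamma p z.1 z.2 * lam (F z.2).
pose f1 z := lam (F z.1) * (D (Num.min z.1 z.2) - F z.1 * D z.2 - D z.1 * F z.2) * lam (F z.2).
pose f2 z := lam' (F z.1) * D z.1 * Gamma p z.1 z.2 * lam (F z.2).
have bq : boxfn `[a, b] fq := boxfn_sigma2 a01 lsupp dl h0 lh qa qb.
have bp : boxfn `[a, b] fp := boxfn_sigma2 a01 lsupp dl h0 lh pa pb.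
have lamC4 x : `|lam (F x)| <= C + 4 by rewrite (le_trans (lamC _))// lerDl.
have m1 (f : R -> R) : measurable_fun setT f -> measurable_fun setT (fun z : R * R => f z.1).
  by move=> mf; exact: measurableT_comp mf measurable_fst.
have m2 (f : R -> R) : measurable_fun setT f -> measurable_fun setT (fun z : R * R => f z.2).
  by move=> mf; exact: measurableT_comp mf measurable_snd.
have b1 : boxfn `[a, b] f1.
  apply: (@boxfn_tensor R _ _ _ (lam \o F) (lam \o F) _ (C + 4)) => //.
  - exact: measurableT_comp.
  - exact: measurableT_comp.
  - apply: measurable_funB; last by apply: measurable_funM; [exact: m1|exact: m2].
    apply: measurable_funB; last by apply: measurable_funM; [exact: m1|exact: m2].
    exact: measurableT_comp mD (measurable_minr measurable_fst measurable_snd).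
  - move=> z; apply: (@le_trans _ _ 3); last by lra.
    apply: le_trans (ler_normB _ _) _; rewrite (_ : 3 = 2 + 1); last by ring.
    apply: lerD; last by rewrite normrM (ger0_norm (mcdf_ge0 _ _)) mulr_ile1 ?mcdf_ge0 ?mcdf_le1.
    apply: le_trans (ler_normB _ _) _; apply: lerD => //.
    by rewrite normrM (ger0_norm (mcdf_ge0 _ _)) mulr_ile1 ?mcdf_ge0 ?mcdf_le1.
  - exact: (weight_out lsupp pa pb).
  - exact: (weight_out lsupp pa pb).
have b2 : boxfn `[a, b] f2.
  apply: (@boxfn_tensor R _ _ _ (fun y => lam' (F y) * D y) (lam \o F) _ (C + 4)) => //.
  - by apply: measurable_funM => //; exact: measurableT_comp.
  - exact: measurableT_comp.
  - exact: measurable_Gamma.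
  - move=> x; rewrite normrM (@le_trans _ _ C)//; last by rewrite lerDl.
    by rewrite -[leRHS]mulr1 ler_pM.
  - by move=> x; rewrite (le_trans (Gamma_le1 _ _ _))//; lra.
  - by move=> x xab; rewrite (weight_derive_out a01 lsupp dl pa pb xab) mul0r.
  - exact: (weight_out lsupp pa pb).
have YZ := limit_YZ a01 lsupp dl h0 lh pa pb mD D1.
have b22 := boxfnD b2 (boxfn_swap b2).
have bT := boxfnD bp (boxfnD b1 b22).
have e1 : sigma2 l q - sigma2 l p - \int[mu]_(y in `[a, b]) (D y * limit_weight l p y) =
    box mu (fun z => fq z + (-1) * (fp z + (f1 z + (f2 z + f2 (z.2, z.1))))).
  rewrite (boxD mab fab bq (boxfnZ (-1) bT)) (boxZ mab fab (-1) bT).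
  rewrite (boxD mab fab bp (boxfnD b1 b22)) (boxD mab fab b1 b22).
  rewrite (boxD mab fab b2 (boxfn_swap b2)) (box_swap mab fab b2).
  rewrite -YZ -[sigma2 l q]/(box mu fq) -[sigma2 l p]/(box mu fp).
  rewrite -[limit_Y l p D]/(box mu f1) -[limit_Z l p D]/(2 * box mu f2).
  have alg (A B X Y : R) : A - B - (X + 2 * Y) = A + -1 * (B + (X + (Y + Y))) by ring.
  exact: alg.
rewrite e1.
have rM x : 0 <= r (D x) <= C * e' + (C * k' + 5 * C ^+ 2).
  apply/andP; split.
    by rewrite addr_ge0// mulr_ge0 ?sqr_ge0// mulr_ge0// ltW.
  by apply: lerD; rewrite ler_piMr// mulr_ge0// ltW.
have mr : measurable_fun setT (fun y => r (D y)).
  apply: measurable_funD; apply: measurable_funM => //.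
    exact: measurableT_comp.
  exact: measurable_funX.
have bE := boxfnD bq (boxfnZ (-1) bT).
have pw x y : `[a, b]%classic x -> `[a, b]%classic y ->
    `|fq (x, y) + (-1) * (fp (x, y) + (f1 (x, y) + (f2 (x, y) + f2 (y, x))))| <=
    r (D x) + r (D y).
  move=> _ _; rewrite mulN1r /fq /fp /f1 /f2 /=.
  have q01 t : 0 <= mcdf q t <= 1 by rewrite mcdf_ge0 mcdf_le1.
  have p01 t : 0 <= F t <= 1 by rewrite mcdf_ge0 mcdf_le1.
  have lD t : `|lam (mcdf q t) - lam (F t)| <= C * `|D t| by rewrite DE.
  have tD t : `|lam (mcdf q t) - lam (F t) - lam' (F t) * D t| <= e' * `|D t| + k' * D t ^+ 2.
    by rewrite DE; exact: tay.
  have := @expansion_bound R C e' k' (lam (mcdf q x)) (lam (mcdf q y)) (lam (F x)) (lam (F y))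
    (lam' (F x)) (lam' (F y)) (D x) (D y) (F x) (F y) (F (Num.min x y)) (D (Num.min x y))
    C0 (lamC _) (lamC _) (lamC _) (lamC _) (lD x) (lD y) (tD x) (tD y) (p01 x) (p01 y).
  have -> : F (Num.min x y) - F x * F y = Gamma p x y by rewrite /Gamma mcdf_min.
  move=> /(_ (Gamma_le1 _ _ _)) H.
  have Dm : `|D (Num.min x y)| <= `|D x| + `|D y|.
    by case: (leP x y) => _; rewrite ?lerDl ?lerDr.
  apply: le_trans (H Dm).
  have -> : Gamma p y x = Gamma p x y by rewrite /Gamma minC mulrC.
  have -> : Gamma q x y = F (Num.min x y) + D (Num.min x y) - (F x + D x) * (F y + D y).
    by rewrite /Gamma -mcdf_min !DE; ring.
  rewrite le_eqVlt; apply/orP; left; apply/eqP; congr (`|_|).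
  by ring.
have := @box_le R _ _ mu _ mab fab _ (fun y => r (D y)) _ bE mr rM pw.
move=> /le_trans; apply.
have -> : fine (mu `[a, b]%classic) = b - a by exact: (congr1 fine (lebesgue_segment ab)).
rewrite -/c.
have rB y : `|r (D y)| <= C * e' + (C * k' + 5 * C ^+ 2).
  by have /andP[r0 r1] := rM y; rewrite ger0_norm.
have ir : mu.-integrable `[a, b] (EFin \o (fun y => r (D y))).
  exact: (@integrable_segment R a b _ _ mr (fun y _ => rB y)).
rewrite -(RintegralZl c mab ir).
apply: (le_Rintegral mab (integrable_EFinZ mab c ir)).
  apply: (@integrable_segment R a b _ (e + c * (C * k' + 5 * C ^+ 2))).
    by apply: measurable_funD; apply: measurable_funM => //;
      [exact: measurableT_comp|exact: measurable_funX].
  move=> y _; apply: le_trans (ler_normD _ _) _; apply: lerD.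
    by rewrite normrM (gtr0_norm e0) normr_id ler_piMr// ltW.
  have ck : 0 <= c * (C * k' + 5 * C ^+ 2) by rewrite mulr_ge0.
  by rewrite (ger0_norm (mulr_ge0 ck (sqr_ge0 _))) ler_piMr.
move=> y _; rewrite /r mulrDr !mulrA lerD2r ler_wpM2r//.
exact: key.
Qed.

Section inf_jack.
Variables (n : nat) (x : 'I_n -> R).
Hypothesis n2 : (1 < n)%N.
Local Notation G := (mcdf (empirical x [set: 'I_n])).
Hypotheses (Ga : G a < alpha / 2) (Gb : 1 - alpha / 2 < G b).

Lemma inf_jackE : inf_jack l x = sigma2 l (empirical x [set: 'I_n]).
Proof.
have [C [C0 lamC lamC' lamL]] := ext01_bounds a01 lsupp dl h0 lh.
have mG := measurable_empirical_cdf x n2.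
have cardT : (0 < #|[set: 'I_n]%SET|)%N by rewrite cardsT card_ord ltnW.
pose f i y := lam (G y) * (G y - (x i <= y)%R%:R).
have mf i : measurable_fun setT (f i).
  apply: measurable_funM; first exact: measurableT_comp.
  apply: measurable_funB => //; have := measurable_mcdf (\d_(x i : measurableTypeR R)).
  by congr measurable_fun; apply/funext => y; rewrite mcdf_dirac.
have fC i y : `|f i y| <= C.
  rewrite /f normrM -[leRHS]mulr1 ler_pM//.
  have /andP[? ?] := empirical_cdf_itv x n2 y.
  by rewrite ler_norml; case: (leP (x i) y) => _ /=; apply/andP; split; lra.
have f0 i y : ~ `[a, b]%classic y -> f i y = 0.
  move=> yab; rewrite /f (empirical_weight_out a01 lsupp n2 Ga Gb) ?mul0r//.
  by apply/negP => /set_mem.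
have phiE i : influence l (empirical x [set: 'I_n]) (x i) = \int[mu]_y f i y.
  rewrite (influence_empiricalE a01 lsupp dl lamC n2 Ga Gb) Rintegral_mkcond.
  apply: eq_Rintegral => y _; rewrite patchE; case: ifPn => // /negP yab.
  by rewrite f0// => y'; apply: yab; exact/mem_set.
have bf i : boxfn `[a, b] (fun z => f i z.1 * f i z.2).
  have -> : (fun z : R * R => f i z.1 * f i z.2) = (fun z => f i z.1 * 1 * f i z.2).
    by apply/funext => z; rewrite mulr1.
  apply: (@boxfn_tensor R _ _ _ (f i) (f i) (fun=> 1) (C + 1)) => //.
  - by move=> y; rewrite (le_trans (fC _ _))// lerDl.
  - by move=> y; rewrite (le_trans (fC _ _))// lerDl.
  - by move=> z; rewrite normr1 lerDr.
  - exact: f0.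
  - exact: f0.
have sq i : influence l (empirical x [set: 'I_n]) (x i) ^+ 2 = box mu (fun z => f i z.1 * f i z.2).
  by rewrite phiE (box_mul mab fab (mf i) (mf i) (fC i) (fC i) (f0 i) (f0 i)) expr2.
rewrite /inf_jack; under eq_bigr do rewrite sq.
rewrite -(box_sum mab fab (index_enum _) bf) -(boxZ mab fab n%:R^-1 (boxfn_sum _ bf)).
apply: eq_Rintegral => z _; apply: eq_Rintegral => y _ /=.
have n0 : n%:R != 0 :> R by rewrite pnatr_eq0 -lt0n ltnW.
rewrite /f.
have cE t : G t = n%:R^-1 * \sum_(j < n) (x j <= t)%R%:R by exact: empirical_cdfE.
pose H i t : R := (x i <= t)%R%:R.
have S1 t : \sum_(j < n) H j t = n%:R * G t by rewrite cE mulrA mulfV// mul1r.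
have S2 : \sum_(j < n) (H j y * H j z) = n%:R * G (Num.min y z).
  rewrite -S1; apply: eq_bigr => j _; rewrite /H -natrM mulnb.
  by rewrite le_min.
have -> : Gamma (empirical x [set: 'I_n]) y z = G (Num.min y z) - G y * G z.
  congr (_ - _); have [P PE] := empirical_probability x cardT.
  by rewrite -PE mcdf_min.
have -> : \sum_(i < n) (lam (G y) * (G y - (x i <= y)%R%:R) * (lam (G z) * (G z - (x i <= z)%R%:R))) =
    lam (G y) * lam (G z) * (n%:R * (G (Num.min y z) - G y * G z)).
  transitivity (lam (G y) * lam (G z) *
    (\sum_(i < n) (H i y * H i z) + \sum_(i < n) (G y * G z - G y * H i z - G z * H i y))).
    rewrite -big_split/= mulr_sumr; apply: eq_bigr => i _; rewrite /H.
    by ring.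
  rewrite S2 !big_split/= !sumrN -!mulr_sumr !S1 sumr_const card_ord -[_ *+ n]mulr_natl.
  by congr (_ * _); ring.
by field.
Qed.

End inf_jack.

End expansion.

(** * The empirical distribution function *)

Section psum_moments.
Context {R : realType} d (T : measurableType d) (Pr : probability T R).
Variables (p : probability (measurableTypeR R) R) (X : nat -> {RV Pr >-> R}).
Hypothesis iidX : iid p X.
Variables (xi : R -> R) (B : R).
Hypothesis mxi : measurable_fun setT xi.
Hypothesis xiB : forall x, `|xi x| <= B.

Let B0 : 0 <= B. Proof. exact: le_trans (xiB 0). Qed.

Lemma psum_bounded k w : `|psum X xi k w| <= k%:R * B.
Proof.
rewrite /psum; apply: le_trans (ler_norm_sum _ _ _) _.
apply: le_trans (ler_sum _ (fun i _ => xiB _)) _.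
by rewrite sumr_const card_ord -[leLHS]mulr_natl.
Qed.

Lemma psumS k w : psum X xi k.+1 w = psum X xi k w + xi (X k w).
Proof. by rewrite /psum big_ord_recr. Qed.

Let clip (k : nat) (s : R) : R := Num.max (- (k%:R * B)) (Num.min (k%:R * B) s).

Let kB0 (k : nat) : 0 <= k%:R * B. Proof. exact: mulr_ge0. Qed.

Let clip_id k s : `|s| <= k%:R * B -> clip k s = s.
Proof.
by rewrite ler_norml /clip => /andP[s1 s2]; rewrite (min_idPr s2) (max_idPr s1).
Qed.

Let clip_le k s : `|clip k s| <= k%:R * B.
Proof.
rewrite ler_norml /clip le_max lexx /= ge_max; apply/andP; split.
  by have := kB0 k; lra.
by rewrite ge_min lexx.
Qed.

Let mclip k : measurable_fun setT (clip k).
Proof.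
apply: (@measurable_maxr _ _ _ setT (cst _)) => //.
by apply: (@measurable_minr _ _ _ setT (cst _)).
Qed.

Lemma Rintegral_psumS k (f : R * R -> R) (M : R) : measurable_fun setT f ->
  (forall s x, `|s| <= k%:R * B -> `|f (s, x)| <= M) ->
  \int[Pr]_w f (psum X xi k w, X k w) = \int[Pr]_w \int[p]_x f (psum X xi k w, x).
Proof.
move=> mf fM; pose g z := f (clip k z.1, z.2).
have mg : measurable_fun setT g.
  apply: (measurableT_comp mf); apply: measurable_fun_pair => //.
  exact: (measurableT_comp (mclip k) measurable_fst).
have gM z : `|g z| <= M by apply: fM; exact: clip_le.
have := @Rintegral_psum_next R _ _ Pr p X xi mxi iidX k g M mg gM.
under eq_Rintegral do rewrite /g/= (clip_id (psum_bounded _ _)).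
move=> ->; apply: eq_Rintegral => w _; apply: eq_Rintegral => x _.
by rewrite /g/= (clip_id (psum_bounded _ _)).
Qed.

Lemma psum_exp_moment (c : R) n :
  \int[Pr]_w expR (c * psum X xi n w) = (\int[p]_x expR (c * xi x)) ^+ n.
Proof.
have mexp : measurable_fun setT (fun s : R => expR (c * s)).
  by apply: measurableT_comp => //; exact: measurable_funM.
elim: n => [|n ih].
  rewrite expr0 -[RHS](Rintegral_prob_cst Pr); apply: eq_Rintegral => w _.
  by rewrite /psum big_ord0 mulr0 expR0.
pose f (z : R * R) := expR (c * z.1) * expR (c * xi z.2).
have mf : measurable_fun setT f.
  apply: measurable_funM; first exact: measurableT_comp mexp measurable_fst.
  by apply: measurableT_comp mexp _; exact: measurableT_comp mxi measurable_snd.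
have eB s (t : R) : `|s| <= t -> `|expR (c * s)| <= expR (`|c| * t).
  move=> st; rewrite ger0_norm ?expR_ge0// ler_expR (le_trans (ler_norm _))//.
  by rewrite normrM ler_wpM2l.
have fM s x : `|s| <= n%:R * B -> `|f (s, x)| <= expR (`|c| * (n%:R * B)) * expR (`|c| * B).
  by move=> sB; rewrite /f normrM ler_pM//; apply: eB.
have := Rintegral_psumS mf fM.
have mxe : measurable_fun setT (fun x => expR (c * xi x)) by exact: measurableT_comp mexp mxi.
have ix := integrable_prob_bounded p mxe (fun x => eB _ _ (xiB x)).
have mpe : measurable_fun setT (fun w => expR (c * psum X xi n w)).
  by apply: measurableT_comp mexp _; exact: measurable_psum.
have ip := integrable_prob_bounded Pr mpe (fun w => eB _ _ (psum_bounded n w)).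
have -> : \int[Pr]_w f (psum X xi n w, X n w) = \int[Pr]_w expR (c * psum X xi n.+1 w).
  by apply: eq_Rintegral => w _; rewrite psumS mulrDr expRD.
move=> ->; rewrite exprS -ih mulrC.
have -> : \int[Pr]_w \int[p]_x f (psum X xi n w, x) =
    \int[Pr]_w (expR (c * psum X xi n w) * \int[p]_x expR (c * xi x)).
  apply: eq_Rintegral => w _; exact: (RintegralZl (expR (c * psum X xi n w)) measurableT ix).
exact: (RintegralZr (\int[p]_x expR (c * xi x)) measurableT ip).
Qed.

Lemma psum_second_moment n : \int[p]_x xi x = 0 ->
  \int[Pr]_w psum X xi n w ^+ 2 = n%:R * \int[p]_x xi x ^+ 2.
Proof.
move=> xi0; elim: n => [|n ih].
  rewrite mul0r -[RHS](Rintegral_prob_cst Pr); apply: eq_Rintegral => w _.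
  by rewrite /psum big_ord0 expr0n.
pose f (z : R * R) := (z.1 + xi z.2) ^+ 2.
have mf : measurable_fun setT f.
  by apply: measurable_funX; apply: measurable_funD => //; exact: measurableT_comp mxi measurable_snd.
have fM s x : `|s| <= n%:R * B -> `|f (s, x)| <= (n%:R * B + B) ^+ 2.
  move=> sB; rewrite /f normrX lerXn2r ?nnegrE//; first exact: addr_ge0 (kB0 n) B0.
  by apply: le_trans (ler_normD _ _) _; exact: lerD.
have := Rintegral_psumS mf fM.
have ix := integrable_prob_bounded p mxi xiB.
have mx2 : measurable_fun setT (fun x => xi x ^+ 2) by exact: measurable_funX.
have ix2 := integrable_prob_bounded p mx2 (fun x => _ : `|xi x ^+ 2| <= B ^+ 2).
have {}ix2 := ix2 (fun x => ltac:(rewrite normrX lerXn2r ?nnegrE//)).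
have mpe : measurable_fun setT (fun w => psum X xi n w ^+ 2).
  by apply: measurable_funX; exact: measurable_psum.
have ip := integrable_prob_bounded Pr mpe (fun x => _ : `|_ ^+ 2| <= (n%:R * B) ^+ 2).
have {}ip := ip (fun x => ltac:(rewrite normrX lerXn2r ?nnegrE ?psum_bounded//)).
have -> : \int[Pr]_w f (psum X xi n w, X n w) = \int[Pr]_w psum X xi n.+1 w ^+ 2.
  by apply: eq_Rintegral => w _; rewrite psumS.
move=> ->.
have -> : \int[Pr]_w \int[p]_x f (psum X xi n w, x) =
    \int[Pr]_w (\int[p]_x xi x ^+ 2 + 1 * psum X xi n w ^+ 2).
  apply: eq_Rintegral => w _; set s := psum X xi n w.
  have := Rintegral_prob_affine2 (s ^+ 2) (2 * s) 1 ix ix2.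
  rewrite xi0 mulr0 addr0 !mul1r addrC => <-; apply: eq_Rintegral => x _.
  by rewrite /f/=; ring.
rewrite (Rintegral_prob_affine _ 1 ip) ih mul1r -natr1 mulrDl mul1r addrC.
by [].
Qed.

End psum_moments.

Lemma Rintegral_prob_indic {R : realType} d (T : measurableType d) (P : probability T R)
  (E : set T) : measurable E -> \int[P]_w \1_E w = fine (P E).
Proof. by move=> mE; rewrite /Rintegral integral_indic// setIT. Qed.

Section tightness.
Context {R : realType} (p : probability (measurableTypeR R) R).

Let idR : measurableTypeR R -> R := idfun.

#[local] HB.instance Definition _ :=
  @isMeasurableFun.Build _ _ _ _ idR (@measurable_id _ _ setT).

Lemma mcdf_tails (e : R) : 0 < e -> exists a b, mcdf p a < e /\ 1 - e < mcdf p b.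
Proof.
move=> e0.
have Fny : mcdf p x @[x --> -oo] --> (0 : R).
  exact: (fine_cvg (@cvg_cdfNy0 _ _ _ _ (idR : {RV p >-> R}))).
have Fy : mcdf p x @[x --> +oo] --> (1 : R).
  exact: (fine_cvg (@cvg_cdfy1 _ _ _ _ (idR : {RV p >-> R}))).
have /filter_ex[a Fa] : \forall x \near -oo, mcdf p x < e by exact: (cvgr_lt _ Fny).
have /filter_ex[b Fb] : \forall x \near +oo, 1 - e < mcdf p x.
  by apply: (cvgr_gt _ Fy); lra.
by exists a, b.
Qed.

Lemma mcdf_right_continuous y : mcdf p x @[x --> at_right y] --> mcdf p y.
Proof.
have := @cdf_right_continuous _ _ _ _ (idR : {RV p >-> R}) y.
have -> : cdf (idR : {RV p >-> R}) y = (mcdf p y)%:E.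
  by rewrite /mcdf fineK ?fin_num_measure.
exact: fine_cvg.
Qed.

End tightness.

Section large_deviations.
Context {R : realType} d (T : measurableType d) (Pr : probability T R).
Variables (p : probability (measurableTypeR R) R) (X : nat -> {RV Pr >-> R}).
Hypothesis iidX : iid p X.

(* Chernoff's bound with the exponent c chosen so that exp (c * beta) = 4. *)
Lemma frequency_tail (beta : R) : 0 < beta -> exists eta : R, 0 < eta /\
  forall A : set (measurableTypeR R), measurable A -> fine (p A) <= eta ->
  forall n, fine (Pr [set w | n%:R * beta <= psum X \1_A n w]) <= (2^-1) ^+ n.
Proof.
move=> beta0; pose c := ln 4 / beta.
have c0 : 0 <= c by rewrite divr_ge0 ?(ltW beta0)// ln_ge0//; lra.
have cb : expR (c * beta) = 4 by rewrite /c divfK ?gt_eqF// lnK// posrE; lra.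
exists (expR (- c)); split; first exact: expR_gt0.
move=> A mA pA n.
have mi : measurable_fun setT (\1_A : R -> R) by exact: measurable_indic.
have i1 (x : R) : `|\1_A x : R| <= 1 by rewrite indicE normr_nat lern1 leq_b1.
have mom := psum_exp_moment iidX mi i1 c n.
set E := [set w | _].
have mE : measurable E.
  rewrite /E -[X in measurable X]setTI.
  have := measurable_psum X mi n => mS.
  have := @measurable_fun_ler _ _ _ setT (cst (n%:R * beta)) _ (measurable_cst _) mS.
  by move=> /(_ measurableT [set true]); apply.
have q2 : \int[p]_x expR (c * \1_A x) <= 2.
  have -> : \int[p]_x expR (c * \1_A x) = \int[p]_x (1 + (expR c - 1) * \1_A x).
    apply: eq_Rintegral => x _; rewrite indicE.
    by case: (x \in A); rewrite ?mulr1 ?mulr0 ?expR0; ring.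
  rewrite (Rintegral_prob_affine _ _ (integrable_prob_bounded p mi i1)).
  rewrite (Rintegral_prob_indic p mA).
  have ec1 : 0 <= expR c - 1 by rewrite subr_ge0 -expR0 ler_expR.
  have : (expR c - 1) * fine (p A) <= (expR c - 1) * expR (- c) by exact: ler_wpM2l.
  rewrite [leRHS]mulrBl -expRD subrr expR0 mul1r.
  by have := expR_gt0 (- c); lra.
have q0 : 0 <= \int[p]_x expR (c * \1_A x).
  by apply: Rintegral_ge0 => x _; exact: expR_ge0.
have mS := measurable_psum X mi n.
have mexp : measurable_fun setT (fun w => expR (c * psum X \1_A n w)).
  by apply: measurableT_comp => //; exact: measurable_funM.
have eB w : `|expR (c * psum X \1_A n w)| <= expR (c * n%:R).
  rewrite ger0_norm ?expR_ge0// ler_expR ler_wpM2l// (le_trans (ler_norm _))//.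
  by rewrite -[leRHS]mulr1; exact: psum_bounded.
have mark : 4 ^+ n * fine (Pr E) <= (\int[p]_x expR (c * \1_A x)) ^+ n.
  rewrite -mom -(Rintegral_prob_indic Pr mE).
  have iE : Pr.-integrable setT (EFin \o (\1_E : T -> R)).
    apply: (@integrable_prob_bounded _ _ _ Pr _ 1) => // w.
    by rewrite indicE normr_nat lern1 leq_b1.
  rewrite -(RintegralZl _ measurableT iE).
  apply: (le_Rintegral_prob (integrable_EFinZ measurableT _ iE) (integrable_prob_bounded Pr mexp eB)) => w.
  rewrite indicE; have [|] := boolP (w \in E); last by rewrite mulr0 expR_ge0.
  rewrite inE mulr1 => Ew; rewrite -cb -expRM_natl ler_expR mulrCA ler_wpM2l//.
have : 4 ^+ n * fine (Pr E) <= 2 ^+ n.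
  by apply: le_trans mark _; rewrite lerXn2r ?nnegrE.
rewrite mulrC -ler_pdivlMr ?exprn_gt0//.
by move/le_trans; apply; rewrite -expr_div_n lerXn2r ?nnegrE//; lra.
Qed.

Definition ecdf (n : nat) (w : T) (y : R) : R :=
  mcdf (empirical (fun i : 'I_n => X i w) [set: 'I_n]) y.

Lemma ecdfE n w y : ecdf n w y = n%:R^-1 * \sum_(i < n) (X i w <= y)%R%:R.
Proof.
rewrite /ecdf mcdf_empirical cardsT card_ord; congr (_ * _).
by apply: eq_bigl => i; rewrite inE.
Qed.

Definition good (beta a b : R) n : set T :=
  [set w | ecdf n w a < beta /\ 1 - beta < ecdf n w b].

Lemma good_probability (beta : R) : 0 < beta -> exists a b : R,
  [/\ mcdf p a < beta, 1 - beta < mcdf p b,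
      forall n, (0 < n)%N -> measurable (good beta a b n) &
      forall n, (0 < n)%N -> fine (Pr (~` good beta a b n)) <= 2 * (2^-1) ^+ n].
Proof.
move=> beta0; have [eta [eta0 tail]] := frequency_tail beta0.
pose e := Num.min beta eta.
have e0 : 0 < e by rewrite lt_min beta0.
have [a [b [ea eb]]] := mcdf_tails p e0.
have ebeta : e <= beta by rewrite ge_min lexx.
have eeta : e <= eta by rewrite ge_min lexx orbT.
pose A : set (measurableTypeR R) := `]-oo, a]%classic.
pose B : set (measurableTypeR R) := `]b, +oo[%classic.
have mA : measurable A by exact: measurable_itv.
have mB : measurable B by exact: measurable_itv.
have pA : fine (p A) <= eta by apply: le_trans eeta; exact: ltW.
have pB : fine (p B) <= eta.
  have -> : B = ~` `]-oo, b]%classic by rewrite /B -setCitvl.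
  have mI : @measurable _ (measurableTypeR R) `]-oo, b]%classic by exact: measurable_itv.
  have pI : p `]-oo, b]%classic = (mcdf p b)%:E by rewrite /mcdf fineK ?fin_num_measure.
  by rewrite (probability_setC p mI) pI -EFinB /=; lra.
exists a, b.
have SA n w : psum X \1_A n w = \sum_(i < n) (X i w <= a)%R%:R.
  by apply: eq_bigr => i _; rewrite indicE mem_setE in_itv.
have SB n w : psum X \1_B n w = n%:R - \sum_(i < n) (X i w <= b)%R%:R.
  have -> : n%:R = \sum_(i < n) 1 :> R by rewrite sumr_const card_ord.
  rewrite -sumrB; apply: eq_bigr => i _; rewrite indicE mem_setE in_itv/= andbT ltNge.
  by case: (_ <= _); rewrite ?subr0 ?subrr.
have badE n : (0 < n)%N -> ~` good beta a b n =
    [set w | n%:R * beta <= psum X \1_A n w] `|` [set w | n%:R * beta <= psum X \1_B n w].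
  move=> n0; have nR : 0 < n%:R :> R by rewrite ltr0n.
  apply/seteqP; split=> w /=; rewrite /good /= !ecdfE SA SB.
    move/not_andP => [/negP|/negP]; rewrite -leNgt.
      by rewrite ler_pdivlMl// => ?; left.
    by rewrite ler_pdivrMl// mulrBr mulr1 => ?; right; lra.
  case=> H; apply/not_andP.
    by left; apply/negP; rewrite -leNgt ler_pdivlMl.
  by right; apply/negP; rewrite -leNgt ler_pdivrMl// mulrBr mulr1; lra.
have mE (D : set (measurableTypeR R)) n : measurable D -> measurable [set w | n%:R * beta <= psum X \1_D n w].
  move=> mD; rewrite -[X in measurable X]setTI.
  have mi : measurable_fun setT (\1_D : R -> R) by exact: measurable_indic.
  have mS := measurable_psum X mi n.
  have := @measurable_fun_ler _ _ _ setT (cst (n%:R * beta)) _ (measurable_cst _) mS.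
  by move=> /(_ measurableT [set true]); apply.
split.
- exact: lt_le_trans ebeta.
- by lra.
- move=> n n0; rewrite -[X in measurable X]setCK; apply: measurableC; rewrite badE//.
  by apply: measurableU; exact: mE.
- move=> n n0; rewrite badE//.
  have -> : 2 * 2^-1 ^+ n = 2^-1 ^+ n + 2^-1 ^+ n :> R by ring.
  apply: (le_trans _ (lerD (tail _ mA pA n) (tail _ mB pB n))).
  rewrite -fineD ?fin_num_measure//; try exact: mE.
  rewrite fine_le ?fin_num_measure//; try by apply: measurableU; exact: mE.
    by rewrite fin_numD !fin_num_measure//; exact: mE.
  by apply: measureU2; exact: mE.
Qed.

Lemma good_eventually (beta a b : R) :
  (forall n, (0 < n)%N -> measurable (good beta a b n)) ->
  (forall n, (0 < n)%N -> fine (Pr (~` good beta a b n)) <= 2 * (2^-1) ^+ n) ->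
  {ae Pr, forall w, \forall n \near \oo, good beta a b n w}.
Proof.
move=> mg pg; pose E n := ~` good beta a b n.+1.
have mE n : measurable (E n) by apply: measurableC; exact: mg.
have PE n : (Pr (E n) <= (2 / (2 ^ (n + 1))%:R)%:E)%E.
  rewrite -(@fineK _ (Pr (E n))) ?fin_num_measure// lee_fin (le_trans (pg n.+1 isT))//.
  by rewrite addn1 natrX exprVn.
have sumE : (\sum_(n <oo) Pr (E n) < +oo)%E.
  apply: (@le_lt_trans _ _ (\sum_(n <oo) (2 / (2 ^ (n + 1))%:R)%:E)%E).
    by apply: lee_nneseries => [n _ _|n _]; [exact: measure_ge0|exact: PE].
  by rewrite (cvg_lim _ (@cvg_geometric_eseries_half R 2 0))// ltry.
exists (lim_sup_set E); split.
- apply: bigcap_measurable => // n _; apply: bigcup_measurable => // k _; exact: mE.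
- exact: lim_sup_set_cvg0.
- move=> w /= nw n _ /=; apply: contrapT => nE; apply: nw.
  exists n.+1 => // -[//|m] /= nm; apply: contrapT => gm; apply: nE.
  by exists m => //=.
Qed.

End large_deviations.

(** * Riemann sums and the Brownian bridge *)

Section riemann_sums.
Context {R : realType}.
Local Notation mu := (@lebesgue_measure R).
Variables (a b : R) (K : R -> R) (MK : R).
Hypothesis ab : a <= b.
Hypothesis mK : measurable_fun setT K.
Hypothesis KM : forall y, `|K y| <= MK.

Let mab : @measurable _ (measurableTypeR R) `[a, b]%classic.
Proof. exact: measurable_itv. Qed.
Let fab := lebesgue_segment_lty a b.

Let delta (m : nat) : R := (b - a + 1) / m.+1%:R.

(* The cells cover [a, b + 1) and are evaluated at their right endpoints, since the
   integrands are only right-continuous. *)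
Definition node (m j : nat) : R := a + j%:R * delta m.

Definition cell (m j : nat) (y : R) : R := (node m j <= y < node m j.+1)%R%:R.

Definition cell_weight (m j : nat) : R := \int[mu]_(y in `[a, b]) (cell m j y * K y).

Definition step (u : R -> R) (m : nat) (y : R) : R :=
  \sum_(j < m.+1) cell m j y * u (node m j.+1).

Let delta0 m : 0 < delta m.
Proof. by rewrite divr_gt0// ltr_pwDr// subr_ge0. Qed.

Lemma step_value m y : a <= y <= b ->
  exists t, y < t <= y + delta m /\ forall u, step u m y = u t.
Proof.
move=> /andP[ay yb]; have d0 := delta0 m.
have z0 : 0 <= (y - a) / delta m by rewrite divr_ge0 ?subr_ge0// ltW.
pose k := Num.truncn ((y - a) / delta m).
have /andP[k1 k2] := truncn_itv z0; rewrite -/k in k1 k2.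
rewrite ler_pdivlMr// in k1; rewrite ltr_pdivrMr// in k2.
have kE j : (node m j <= y < node m j.+1) = (j == k).
  apply/idP/eqP => [/andP[j1 j2]|->]; last by rewrite /node; apply/andP; split; lra.
  rewrite /node -lerBrDl in j1; rewrite /node -ltrBlDl in j2.
  have jk : (j < k.+1)%N.
    by rewrite -(ltr_nat R) -(ltr_pM2r d0); exact: le_lt_trans j1 k2.
  have kj : (k < j.+1)%N.
    by rewrite -(ltr_nat R) -(ltr_pM2r d0); exact: le_lt_trans k1 j2.
  by apply/eqP; rewrite eqn_leq -ltnS jk -ltnS kj.
have km : (k < m.+1)%N.
  rewrite -(ltr_nat R) -(ltr_pM2r d0); apply: le_lt_trans k1 _.
  by rewrite /delta mulrCA mulfV ?mulr1 ?pnatr_eq0//; lra.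
exists (node m k.+1); split.
  apply/andP; split; first by rewrite /node; lra.
  by rewrite /node -natr1 mulrDl mul1r; lra.
move=> u; rewrite /step (bigD1 (Ordinal km))//= big1 ?addr0.
  by rewrite /cell kE eqxx mul1r.
move=> i ik; rewrite /cell kE (_ : (i == k :> nat) = false) ?mul0r//.
by apply/negbTE; apply: contra ik => /eqP ik; apply/eqP/val_inj.
Qed.

Let mcell m j : measurable_fun setT (cell m j).
Proof.
have -> : cell m j = \1_`[node m j, node m j.+1[.
  by apply/funext => y; rewrite indicE mem_setE in_itv.
exact: measurable_indic.
Qed.

Let step_bounded u M m y : (forall t, `|u t| <= M) -> a <= y <= b -> `|step u m y| <= M.
Proof. by move=> uM /(step_value m)[t [_ ->]]. Qed.

Let MK0 : 0 <= MK. Proof. exact: le_trans (KM 0). Qed.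

Let int_cell m j : mu.-integrable `[a, b] (EFin \o (fun y => cell m j y * K y)).
Proof.
apply: (@integrable_segment R a b _ MK); first exact: measurable_funM.
move=> y _; rewrite normrM /cell normr_nat; case: (_ && _).
  by rewrite mul1r.
by rewrite mul0r.
Qed.

Lemma riemann_sumE u m :
  \sum_(j < m.+1) cell_weight m j * u (node m j.+1) =
  \int[mu]_(y in `[a, b]) (step u m y * K y).
Proof.
have -> : \int[mu]_(y in `[a, b]) (step u m y * K y) =
    \int[mu]_(y in `[a, b]) (\sum_(j < m.+1) u (node m j.+1) * (cell m j y * K y)).
  apply: eq_Rintegral => y _; rewrite /step mulr_suml; apply: eq_bigr => j _.
  by ring.
have ii (j : 'I_m.+1) : mu.-integrable `[a, b]
    (EFin \o (fun y => u (node m j.+1) * (cell m j y * K y))).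
  exact: (integrable_EFinZ mab (u (node m j.+1)) (int_cell m j)).
rewrite (Rintegral_sum mab (index_enum _) ii); apply: eq_bigr => j _.
rewrite mulrC; apply: esym; exact: (RintegralZl (u (node m j.+1)) mab (int_cell m j)).
Qed.

Let mstep u m : measurable_fun setT (fun y => step u m y * K y).
Proof.
by apply: measurable_funM => //; apply: measurable_sum => j; exact: measurable_funM.
Qed.

Lemma riemann_sum_bounded u M m : (forall t, `|u t| <= M) ->
  `|\sum_(j < m.+1) cell_weight m j * u (node m j.+1)| <= M * MK * (b - a).
Proof.
move=> uM; rewrite riemann_sumE; apply: (Rintegral_segment_bounded ab (mstep u m)) => y.
by rewrite in_itv/= => yab; rewrite normrM ler_pM//; exact: step_bounded.
Qed.

Lemma riemann_sum_cvg u M : (forall t, `|u t| <= M) ->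
  (forall y, u x @[x --> at_right y] --> u y) ->
  \sum_(j < m.+1) cell_weight m j * u (node m j.+1) @[m --> \oo] -->
  \int[mu]_(y in `[a, b]) (u y * K y).
Proof.
move=> uM ur; under eq_cvg do rewrite riemann_sumE.
have mf n : measurable_fun `[a, b] (fun y => step u n y * K y) by exact: measurable_funTS.
apply: (@Rintegral_bounded_cvg _ _ _ mu _ mab fab _ _ (M * MK) mf).
  move=> n y /=; rewrite in_itv/= => yab; rewrite normrM ler_pM//; exact: step_bounded.
move=> y /=; rewrite in_itv/= => yab; apply: cvgM; last exact: cvg_cst.
apply/cvgrPdist_le => e e0.
have /cvgrPdist_le/(_ e e0)/nbhs_ballP[r /= r0 ball_r] := ur y.
have c0 : 0 <= (b - a + 1) / r by rewrite divr_ge0// ?(ltW r0)// addr_ge0// subr_ge0.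
exists (Num.truncn ((b - a + 1) / r)) => //= m nm.
have [t [/andP[yt ty] ->]] := step_value m yab.
apply: ball_r => //; rewrite /ball/= distrC ger0_norm ?subr_ge0 1?ltW//.
have dr : delta m < r.
  rewrite /delta ltr_pdivrMr// mulrC -ltr_pdivrMr//.
  by rewrite (lt_le_trans (truncnS_gt _))// ler_nat.
by lra.
Qed.

End riemann_sums.

Section influence_variance.
Context {R : realType}.
Local Notation mu := (@lebesgue_measure R).
Variables (a b : R) (K : R -> R) (MK : R).
Hypothesis ab : a <= b.
Hypothesis mK : measurable_fun setT K.
Hypothesis KM : forall y, `|K y| <= MK.
Variable p : probability (measurableTypeR R) R.
Local Notation F := (mcdf p).
Local Notation c := (cell_weight a b K).
Local Notation t := (node a b).

Definition centered_step (x y : R) : R := (x <= y)%R%:R - F y.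

Definition step_integral (x : R) : R :=
  \int[mu]_(y in `[a, b]) (centered_step x y * K y).

Definition riemann_variance (m : nat) : R :=
  \sum_(i < m.+1) \sum_(j < m.+1) c m i * c m j *
    (Num.min (F (t m i.+1)) (F (t m j.+1)) - F (t m i.+1) * F (t m j.+1)).

Lemma centered_step_le1 x y : `|centered_step x y| <= 1.
Proof.
have := mcdf_ge0 p y; have := mcdf_le1 p y.
by rewrite ler_norml /centered_step; case: (leP x y) => _ /= *; apply/andP; split; lra.
Qed.

Lemma centered_step_right_continuous x y :
  centered_step x z @[z --> at_right y] --> centered_step x y.
Proof.
apply: cvgB; last exact: mcdf_right_continuous.
apply/cvgrPdist_le => e e0; have [xy|yx] := leP x y.
  near=> z; have -> : x <= z by rewrite (le_trans xy)//; near: z; exact: nbhs_right_ge.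
  by rewrite subrr normr0 ltW.
near=> z; have zx : z < x by near: z; exact: nbhs_right_lt.
by rewrite (lt_geF zx) subrr normr0 ltW.
Unshelve. all: by end_near. Qed.

Let mind y : measurable_fun setT (fun x : R => (x <= y)%R%:R : R).
Proof.
have -> : (fun x : R => (x <= y)%R%:R) = \1_`]-oo, y] :> (R -> R).
  by apply/funext => x; rewrite indicE mem_setE in_itv.
by apply: measurable_indic.
Qed.

Lemma measurable_centered_step y : measurable_fun setT (fun x => centered_step x y).
Proof. exact: measurable_funB. Qed.

Let int_ind (y : R) : \int[p]_x (x <= y)%R%:R = F y.
Proof.
rewrite /mcdf -(Rintegral_prob_indic p); last exact: measurable_itv.
by apply: eq_Rintegral => x _; rewrite indicE mem_setE in_itv.
Qed.

Let i_ind (y : R) : p.-integrable setT (EFin \o (fun x => (x <= y)%R%:R : R)).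
Proof.
apply: (@integrable_prob_bounded _ _ _ p _ 1); first exact: mind.
by move=> x; rewrite normr_nat lern1 leq_b1.
Qed.

Lemma centered_step_mean y : \int[p]_x centered_step x y = 0.
Proof.
have := Rintegral_prob_affine (- F y) 1 (i_ind y); rewrite mul1r int_ind addNr => <-.
by apply: eq_Rintegral => x _; rewrite /centered_step mul1r addrC.
Qed.

Let step_cov y z : \int[p]_x (centered_step x y * centered_step x z) =
  Num.min (F y) (F z) - F y * F z.
Proof.
have := Rintegral_prob_affine2 (F y * F z) 1 (- F y) (i_ind (Num.min y z)) (i_ind z).
have i2 := integrable_prob_affine2 (F y * F z) 1 (- F y) (i_ind (Num.min y z)) (i_ind z).
have := Rintegral_prob_affine2 0 1 (- F z) i2 (i_ind y).
rewrite !int_ind mcdf_min => e1 e2; rewrite e2 in e1.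
have -> : Num.min (F y) (F z) - F y * F z =
  0 + 1 * (F y * F z + 1 * Num.min (F y) (F z) + - F y * F z) + - F z * F y by ring.
rewrite -e1; apply: eq_Rintegral => x _; rewrite /centered_step le_min.
by case: (x <= y); case: (x <= z) => /=; ring.
Qed.

Let xi_ (m : nat) (x : R) : R := \sum_(j < m.+1) c m j * centered_step x (t m j.+1).

Let mxi_ m : measurable_fun setT (xi_ m).
Proof. by apply: measurable_sum => j; apply: measurable_funM => //; exact: measurable_centered_step. Qed.

Let xi_M m x : `|xi_ m x| <= 1 * MK * (b - a).
Proof. apply: (riemann_sum_bounded ab mK KM); exact: centered_step_le1. Qed.

Let xi_cvg x : xi_ m x @[m --> \oo] --> step_integral x.
Proof.
apply: (riemann_sum_cvg ab mK KM (centered_step_le1 x)).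
exact: centered_step_right_continuous.
Qed.

Lemma measurable_step_integral : measurable_fun setT step_integral.
Proof. exact: (@measurable_fun_cvg _ _ _ _ xi_). Qed.

Lemma step_integral_bounded x : `|step_integral x| <= 1 * MK * (b - a).
Proof.
have ng : `|xi_ m x| @[m --> \oo] --> `|step_integral x| by apply: cvg_norm; exact: xi_cvg.
rewrite -(cvg_lim (@Rhausdorff R) ng); apply: limr_le; first by apply/cvg_ex; exists `|step_integral x|.
by apply: nearW => n; exact: xi_M.
Qed.

Let i_step y : p.-integrable setT (EFin \o (fun x => centered_step x y)).
Proof. exact: (integrable_prob_bounded p (measurable_centered_step y) (fun x => centered_step_le1 x y)). Qed.

Lemma step_integral_mean : \int[p]_x step_integral x = 0.
Proof.
have lim := @Rintegral_prob_cvg _ _ _ p _ _ _ mxi_ xi_M xi_cvg.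
have zero m : \int[p]_x xi_ m x = 0.
  rewrite (@Rintegral_sum _ _ _ p _ measurableT _ _ (fun (j : 'I_m.+1) x => c m j * centered_step x (t m j.+1))).
    by rewrite big1// => j _; rewrite (RintegralZl _ measurableT (i_step _)) centered_step_mean mulr0.
  by move=> j; exact: (integrable_EFinZ measurableT (c m j) (i_step (t m j.+1))).
rewrite (funext zero) in lim.
exact: (cvg_unique (@Rhausdorff R) lim (cvg_cst _)).
Qed.

Lemma riemann_variance_cvg :
  riemann_variance m @[m --> \oo] --> \int[p]_x step_integral x ^+ 2.
Proof.
have mf m : measurable_fun setT (fun x => xi_ m x ^+ 2) by exact: measurable_funX.
have fM m x : `|xi_ m x ^+ 2| <= (1 * MK * (b - a)) ^+ 2.
  have M0 := le_trans (normr_ge0 _) (xi_M m x).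
  by rewrite normrX lerXn2r ?nnegrE ?normr_ge0//; exact: xi_M.
have fg x : xi_ m x ^+ 2 @[m --> \oo] --> step_integral x ^+ 2.
  by apply: cvgM; exact: xi_cvg.
have lim := @Rintegral_prob_cvg _ _ _ p _ _ _ mf fM fg.
have e m : \int[p]_x xi_ m x ^+ 2 = riemann_variance m.
  pose f (i j : nat) (x : R) := c m i * c m j * (centered_step x (t m i.+1) * centered_step x (t m j.+1)).
  have ij y z : p.-integrable setT (EFin \o (fun x => centered_step x y * centered_step x z)).
    apply: (@integrable_prob_bounded _ _ _ p _ 1).
      by apply: measurable_funM; exact: measurable_centered_step.
    by move=> x; rewrite normrM; apply: mulr_ile1; rewrite ?normr_ge0 ?centered_step_le1.
  have iF i j : p.-integrable setT (EFin \o f i j).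
    exact: (integrable_EFinZ measurableT (c m i * c m j) (ij _ _)).
  have -> : \int[p]_x xi_ m x ^+ 2 = \int[p]_x \sum_(i < m.+1) \sum_(j < m.+1) f i j x.
    apply: eq_Rintegral => x _; rewrite expr2 /xi_ mulr_suml; apply: eq_bigr => i _.
    by rewrite mulr_sumr; apply: eq_bigr => j _; rewrite /f; ring.
  rewrite (@Rintegral_sum _ _ _ p _ measurableT _ _ (fun (i : 'I_m.+1) x => \sum_(j < m.+1) f i j x)); last first.
    by move=> i; apply: (integrable_EFin_sum measurableT) => j; exact: iF.
  apply: eq_bigr => i _.
  rewrite (@Rintegral_sum _ _ _ p _ measurableT _ _ (fun (j : 'I_m.+1) x => f i j x)); last by move=> j; exact: iF.
  by apply: eq_bigr => j _; rewrite (RintegralZl _ measurableT (ij _ _)) step_cov.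
by rewrite (funext e) in lim.
Qed.

End influence_variance.

Section bridge.
Context {R : realType} d (T : measurableType d) (Pr : probability T R).
Local Notation mu := (@lebesgue_measure R).
Variables (a b : R) (K : R -> R) (MK : R).
Hypothesis ab : a <= b.
Hypothesis mK : measurable_fun setT K.
Hypothesis KM : forall y, `|K y| <= MK.
Variable p : probability (measurableTypeR R) R.
Variable W : R -> {RV Pr >-> R}.
Hypothesis bW : brownian_bridge W.
Local Notation F := (mcdf p).
Local Notation c := (cell_weight a b K).
Local Notation t := (node a b).
Local Notation gam := (normal_prob (0:R) 1).

Let F01 y : 0 <= F y <= 1. Proof. by rewrite mcdf_ge0 mcdf_le1. Qed.

Lemma bridge_path_bounded w : exists M : R, forall y, `|W (F y) w| <= M.
Proof.
have [_ _ _ cW] := bW.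
have [x1 _ h1] := EVT_max (ler01 : (0:R) <= 1) (cW w).
have [x2 _ h2] := EVT_min (ler01 : (0:R) <= 1) (cW w).
exists (`|W x1 w| + `|W x2 w|) => y.
have Fy : F y \in `[0, 1] by rewrite in_itv/= F01.
have := h1 _ Fy; have := h2 _ Fy; have := ler_norm (W x1 w); have := lerNnormlW (lexx `|W x2 w|).
have := normr_ge0 (W x1 w); have := normr_ge0 (W x2 w).
by rewrite ler_norml => *; apply/andP; split; lra.
Qed.

Lemma measurable_bridge_path w : measurable_fun setT (fun y => W (F y) w).
Proof.
have [_ _ _ cW] := bW.
have m01 : @measurable _ (measurableTypeR R) `[0:R, 1]%classic by exact: measurable_itv.
have mW : measurable_fun (`[0:R, 1]%classic : set (measurableTypeR R)) (fun s => W s w).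
  by apply: subspace_continuous_measurable_fun => //; exact: cW.
apply: (measurable_comp m01 _ mW (measurable_mcdf p)).
by move=> _ [y _ <-] /=; rewrite in_itv/= F01.
Qed.

Let W_right_continuous w y : W (F z) w @[z --> at_right y] --> W (F y) w.
Proof.
have [_ _ _ cW] := bW.
have Fy : `[0:R, 1]%classic (F y) by rewrite /= in_itv/= F01.
have /cvgrPdist_le Wc := cW w (F y); apply/cvgrPdist_le => e e0.
have : within `[0:R, 1]%classic (nbhs (F y)) [set s | `|W (F y) w - W s w| <= e].
  by rewrite nbhs_subspace_in//; exact: (Wc e e0).
move=> /nbhs_ballP[r /= r0 ball_r].
have /cvgrPdist_lt/(_ r r0) Fr := @mcdf_right_continuous R p y.
near=> z; apply: ball_r => /=; last by rewrite in_itv/= F01.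
by near: z.
Unshelve. all: by end_near. Qed.

Let intWW s u : 0 <= s <= 1 -> 0 <= u <= 1 ->
  (\int[Pr]_w (W s w * W u w)%:E = (Num.min s u - s * u)%:E)%E.
Proof.
move=> s01 u01; have [_ _ cov _] := bW; have := cov s u s01 u01.
by rewrite unlock.
Qed.

Let i_sq s : 0 <= s <= 1 -> Pr.-integrable setT (fun w => (W s w ^+ 2)%:E).
Proof.
move=> s01; apply/integrableP; split.
  by apply/measurable_EFinP; exact: measurable_funX.
have -> : (\int[Pr]_w `|(W s w ^+ 2)%:E| = \int[Pr]_w (W s w * W s w)%:E)%E.
  by apply: eq_integral => w _; rewrite gee0_abs ?lee_fin ?sqr_ge0.
by rewrite intWW// ltry.
Qed.

Let i_W s : 0 <= s <= 1 -> Pr.-integrable setT (EFin \o W s).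
Proof.
move=> s01; have i2 := integrable_prob_affine 1 1 (i_sq s01).
apply: (le_integrable measurableT _ _ i2); first by apply/measurable_EFinP.
move=> w _ /=; rewrite lee_fin [leRHS]ger0_norm; last first.
  by rewrite mul1r addr_ge0// sqr_ge0.
have := sqr_ge0 (`|W s w| - 1); rewrite -(real_normK (num_real (W s w))) sqrrB1.
by have := normr_ge0 (W s w); rewrite mulr2n; lra.
Qed.

Let i_WW s u : 0 <= s <= 1 -> 0 <= u <= 1 -> Pr.-integrable setT (EFin \o (fun w => W s w * W u w)).
Proof.
move=> s01 u01; have i2 := integrable_prob_affine2 0 1 1 (i_sq s01) (i_sq u01).
apply: (le_integrable measurableT _ _ i2); first by apply/measurable_EFinP; exact: measurable_funM.
move=> w _ /=; rewrite lee_fin add0r !mul1r [leRHS]ger0_norm ?addr_ge0 ?sqr_ge0//.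
rewrite normrM -(real_normK (num_real (W s w))) -(real_normK (num_real (W u w))).
have := sqr_ge0 (`|W s w| - `|W u w|); rewrite sqrrB mulr2n.
by have := mulr_ge0 (normr_ge0 (W s w)) (normr_ge0 (W u w)); lra.
Qed.

Let mean_W s : 0 <= s <= 1 -> \int[Pr]_w W s w = 0.
Proof.
move=> s01; have [_ mean _ _] := bW; have := mean s s01.
by rewrite unlock /Rintegral => ->.
Qed.

Let cov_W s u : 0 <= s <= 1 -> 0 <= u <= 1 ->
  \int[Pr]_w (W s w * W u w) = Num.min s u - s * u.
Proof. by move=> s01 u01; rewrite /Rintegral intWW. Qed.

Let G_ (m : nat) (w : T) : R := \sum_(j < m.+1) c m j * W (F (t m j.+1)) w.

Lemma bridge_integral_gaussian :
  let G w := \int[mu]_(y in `[a, b]) (W (F y) w * K y) in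
  [/\ measurable_fun setT G, gaussian Pr G &
    forall (f : R -> R) M, continuous f -> (forall x, `|f x| <= M) ->
      \int[Pr]_w f (G w) =
      \int[gam]_z f (Num.sqrt (\int[p]_x step_integral a b K p x ^+ 2) * z)].
Proof.
move=> G.
have iG m (j : 'I_m.+1) : Pr.-integrable setT (EFin \o (fun w => c m j * W (F (t m j.+1)) w)).
  exact: (integrable_EFinZ measurableT (c m j) (i_W (F01 _))).
have GE2 m w : G_ m w ^+ 2 = \sum_(i < m.+1) \sum_(j < m.+1)
    c m i * c m j * (W (F (t m i.+1)) w * W (F (t m j.+1)) w).
  rewrite expr2 /G_ mulr_suml; apply: eq_bigr => i _.
  by rewrite mulr_sumr; apply: eq_bigr => j _; ring.
have iGG m (i j : 'I_m.+1) : Pr.-integrable setT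
    (EFin \o (fun w => c m i * c m j * (W (F (t m i.+1)) w * W (F (t m j.+1)) w))).
  exact: (integrable_EFinZ measurableT (c m i * c m j) (i_WW (F01 _) (F01 _))).
have iGs m (i : 'I_m.+1) : Pr.-integrable setT (EFin \o (fun w => \sum_(j < m.+1)
    c m i * c m j * (W (F (t m i.+1)) w * W (F (t m j.+1)) w))).
  by apply: (integrable_EFin_sum measurableT) => j; exact: iGG.
apply: (@gaussian_limit R _ T Pr G_ (riemann_variance a b K p)).
- move=> m; have [gW _ _ _] := bW.
  by apply: (gW m.+1 (fun j => F (t m j.+1)) (fun j => c m j)) => i; exact: F01.
- by move=> m; exact: (integrable_EFin_sum measurableT _ (iG m)).
- move=> m; under eq_fun do rewrite GE2.
  exact: (integrable_EFin_sum measurableT _ (iGs m)).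
- move=> m; rewrite (Rintegral_sum measurableT _ (iG m)) big1// => j _.
  by rewrite (RintegralZl _ measurableT (i_W (F01 _))) mean_W// mulr0.
- move=> m; under eq_Rintegral do rewrite GE2.
  rewrite (Rintegral_sum measurableT _ (iGs m)); apply: eq_bigr => i _.
  rewrite (Rintegral_sum measurableT _ (iGG m i)); apply: eq_bigr => j _.
  by rewrite (RintegralZl _ measurableT (i_WW (F01 _) (F01 _))) cov_W.
- exact: (riemann_variance_cvg ab mK KM).
- move=> w; have [M hM] := bridge_path_bounded w.
  exact: (@riemann_sum_cvg R a b K MK ab mK KM (fun y => W (F y) w) M hM (@W_right_continuous w)).
Qed.

End bridge.

(** * Linearization of the jackknife *)

Section empirical_process.
Context {R : realType} d (T : measurableType d) (Pr : probability T R).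
Local Notation mu := (@lebesgue_measure R).
Variables (p : probability (measurableTypeR R) R) (X : nat -> {RV Pr >-> R}).
Hypothesis iidX : iid p X.
Variables (a b : R).
Hypothesis ab : a <= b.
Local Notation F := (mcdf p).
Local Notation cs := (centered_step p).

Let mab : @measurable _ (measurableTypeR R) `[a, b]%classic.
Proof. exact: measurable_itv. Qed.
Let fab := lebesgue_segment_lty a b.

Definition ecdf_dev (n : nat) (w : T) (y : R) : R := ecdf X n w y - F y.

Lemma measurable_ecdf n : measurable_fun setT (fun z : T * R => ecdf X n z.1 z.2).
Proof.
under eq_fun do rewrite ecdfE.
apply: measurable_funM => //; apply: measurable_sum => i.
have mX : measurable_fun setT (fun z : T * R => X i z.1 : R).
  by apply: measurableT_comp; [exact: measurable_funPT|exact: measurable_fst].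
exact: (measurableT_comp measurable_le2 (measurable_fun_pair mX measurable_snd)).
Qed.

Let mdev n : measurable_fun setT (fun z : T * R => ecdf_dev n z.1 z.2).
Proof.
apply: measurable_funB; first exact: measurable_ecdf.
by apply: measurableT_comp (measurable_mcdf p) _; exact: measurable_snd.
Qed.

Lemma ecdf_devE n w y : (0 < n)%N ->
  ecdf_dev n w y = n%:R^-1 * psum X (fun x => cs x y) n w.
Proof.
move=> n0; rewrite /ecdf_dev ecdfE /psum /centered_step sumrB mulrBr; congr (_ - _).
by rewrite sumr_const card_ord -(mulr_natl (F y) n) mulrA mulVf ?mul1r// pnatr_eq0 -lt0n.
Qed.

Lemma ecdf_dev_le1 n w y : (0 < n)%N -> `|ecdf_dev n w y| <= 1.
Proof.
move=> n0; rewrite ecdf_devE// normrM ger0_norm// ler_pdivrMl ?ltr0n//.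
exact: (psum_bounded X (fun x => centered_step_le1 p x y)).
Qed.

Let dev2_le1 n w y : (0 < n)%N -> `|ecdf_dev n w y ^+ 2| <= 1.
Proof. by move=> n0; rewrite normrX exprn_ile1// ecdf_dev_le1. Qed.

Lemma ecdf_dev_second_moment n y : (0 < n)%N ->
  \int[Pr]_w ecdf_dev n w y ^+ 2 <= n%:R^-1.
Proof.
move=> n0; have nR : 0 < n%:R :> R by rewrite ltr0n.
have cB x : `|cs x y| <= 1 by exact: centered_step_le1.
have mean0 : \int[p]_x cs x y = 0 by exact: centered_step_mean.
have mom := psum_second_moment iidX (measurable_centered_step p y) cB n mean0.
have mS := measurable_psum X (measurable_centered_step p y) n.
have iS : Pr.-integrable setT (EFin \o (fun w => psum X (fun x => cs x y) n w ^+ 2)).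
  apply: (@integrable_prob_bounded _ _ _ Pr _ ((n%:R * 1) ^+ 2)); first exact: measurable_funX.
  by move=> w; rewrite normrX lerXn2r ?nnegrE ?mulr1 ?(le_trans (psum_bounded X cB n w)) ?mulr1.
have -> : \int[Pr]_w ecdf_dev n w y ^+ 2 =
    \int[Pr]_w ((n%:R^-1) ^+ 2 * psum X (fun x => cs x y) n w ^+ 2).
  by apply: eq_Rintegral => w _; rewrite ecdf_devE// exprMn.
rewrite (RintegralZl _ measurableT iS) mom.
have v1 : \int[p]_x cs x y ^+ 2 <= 1.
  have m2 : measurable_fun setT (fun x => cs x y ^+ 2) by apply: measurable_funX; exact: measurable_centered_step.
  have b2 x : `|cs x y ^+ 2| <= 1 by rewrite normrX exprn_ile1.
  exact: le_trans (ler_norm _) (Rintegral_prob_bounded p m2 b2).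
have -> : n%:R^-1 ^+ 2 * (n%:R * \int[p]_x cs x y ^+ 2) = n%:R^-1 * \int[p]_x cs x y ^+ 2.
  by rewrite expr2 -mulrA mulKf// gt_eqF.
by rewrite ler_piMr// invr_ge0 ltW.
Qed.

Let Q n w := \int[mu]_(y in `[a, b]) ecdf_dev n w y ^+ 2.

Let f n (z : T * R) : R := \1_`[a, b] z.2 * ecdf_dev n z.1 z.2 ^+ 2.

Let QE n w : Q n w = \int[mu]_y f n (w, y).
Proof. exact: Rintegral_indic_mkcond. Qed.

Let mf n : measurable_fun setT (f n).
Proof.
apply: measurable_funM; last exact: measurable_funX.
have := @measurable_indic _ _ R setT _ mab => mi.
exact: (measurableT_comp mi measurable_snd).
Qed.

Let fM n z : (0 < n)%N -> `|f n z| <= 1.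
Proof.
move=> n0; rewrite normrM; apply: mulr_ile1; rewrite ?normr_ge0 ?dev2_le1//.
by rewrite indicE normr_nat lern1 leq_b1.
Qed.

Let f0 n w y : ~ ([set: T] w /\ `[a, b]%classic y) -> f n (w, y) = 0.
Proof.
move=> wy; rewrite /f/= indicE memNset ?mul0r// => yab.
by apply: wy.
Qed.

Lemma ecdf_dev_integral_square n : (0 < n)%N ->
  Pr.-integrable setT (EFin \o Q n) /\ \int[Pr]_w Q n w <= (b - a) / n%:R.
Proof.
move=> n0.
have PT : (Pr setT < +oo)%E by rewrite probability_setT ltry.
have fM1 z : `|f n z| <= 1 by exact: fM.
have iQ := @integrable_Rintegral2 R _ _ _ _ Pr mu setT `[a, b]%classic (f n) 1
  measurableT mab PT fab (mf n) fM1 (@f0 n).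
have Qf : Q n = (fun w => \int[mu]_y f n (w, y)) by apply/funext => w; exact: QE.
split; first by rewrite Qf.
rewrite Qf (@Rfubini R _ _ _ _ Pr mu setT `[a, b]%classic (f n) 1
  measurableT mab PT fab (mf n) fM1 (@f0 n)).
pose g (y : R) : R := \1_`[a, b] y * \int[Pr]_w ecdf_dev n w y ^+ 2.
have iD y : Pr.-integrable setT (EFin \o (fun w => ecdf_dev n w y ^+ 2)).
  have mD : measurable_fun setT (fun w => ecdf_dev n w y ^+ 2).
    by apply: measurable_funX; exact: (measurableT_comp (mdev n) (pair2_measurable y)).
  exact: (integrable_prob_bounded Pr mD (fun w => dev2_le1 w y n0)).
have -> : \int[mu]_y \int[Pr]_w f n (w, y) = \int[mu]_(y in `[a, b]) \int[Pr]_w ecdf_dev n w y ^+ 2.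
  rewrite [RHS]Rintegral_indic_mkcond; apply: eq_Rintegral => y _.
  exact: (RintegralZl (\1_`[a, b] y) measurableT (iD y)).
have mg : measurable_fun `[a, b] (fun y => \int[Pr]_w ecdf_dev n w y ^+ 2).
  have := @measurable_Rintegral1 R _ _ _ _ Pr mu setT `[a, b]%classic (f n) 1
    measurableT mab PT fab (mf n) fM1 (@f0 n).
  move=> /(@measurable_funTS _ _ _ _ `[a, b]%classic); apply: eq_measurable_fun => y yab.
  by apply: eq_Rintegral => w _; rewrite /f/= indicE yab mul1r.
have gM y : `[a, b]%classic y -> `|\int[Pr]_w ecdf_dev n w y ^+ 2| <= n%:R^-1.
  move=> _; rewrite ger0_norm; first exact: ecdf_dev_second_moment.
  by apply: Rintegral_ge0 => w _; exact: sqr_ge0.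
have := @Rintegral_bounded R _ _ mu _ mab fab _ _ mg gM.
move=> /(le_trans (ler_norm _))/le_trans; apply.
have -> : fine (mu `[a, b]%classic) = b - a by exact: (congr1 fine (lebesgue_segment ab)).
by rewrite mulrC.
Qed.

Variables (K : R -> R) (MK : R).
Hypothesis mK : measurable_fun setT K.
Hypothesis KM : forall y, `|K y| <= MK.

Lemma psum_step_integral n w : (0 < n)%N ->
  (Num.sqrt n%:R)^-1 * psum X (step_integral a b K p) n w =
  Num.sqrt n%:R * \int[mu]_(y in `[a, b]) (ecdf_dev n w y * K y).
Proof.
move=> n0; have nR : 0 < n%:R :> R by rewrite ltr0n.
have ics x : mu.-integrable `[a, b] (EFin \o (fun y => cs x y * K y)).
  apply: (@integrable_segment R a b _ (1 * MK)).
    apply: measurable_funM => //; apply: measurable_funB; last exact: measurable_mcdf.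
    exact: (measurableT_comp measurable_le2 (pair1_measurable x)).
  by move=> y _; rewrite normrM ler_pM// centered_step_le1.
have -> : psum X (step_integral a b K p) n w =
    n%:R * \int[mu]_(y in `[a, b]) (ecdf_dev n w y * K y).
  have iS : mu.-integrable `[a, b] (EFin \o (fun y => \sum_(i < n) cs (X i w) y * K y)).
    by apply: (integrable_EFin_sum mab) => i; exact: ics.
  have -> : \int[mu]_(y in `[a, b]) (ecdf_dev n w y * K y) =
      \int[mu]_(y in `[a, b]) (n%:R^-1 * \sum_(i < n) cs (X i w) y * K y).
    by apply: eq_Rintegral => y _; rewrite ecdf_devE// /psum -mulrA mulr_suml.
  rewrite /psum /step_integral.
  rewrite -(@Rintegral_sum _ _ _ mu _ mab _ _ (fun (i : 'I_n) y => cs (X i w) y * K y)); last first.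
    by move=> i; exact: ics.
  by rewrite (RintegralZl n%:R^-1 mab iS) mulVKf// gt_eqF.
have sn : Num.sqrt n%:R != 0 :> R by rewrite gt_eqF// sqrtr_gt0.
rewrite mulrA; congr (_ * _).
by rewrite -[X in _ * X](sqr_sqrtr (ltW nR)) expr2 mulKf.
Qed.

End empirical_process.

Section jackknife_estimates.
Context {R : realType} d (T : measurableType d) (Pr : probability T R).
Local Notation mu := (@lebesgue_measure R).
Variables (alpha h : R) (l : R -> R).
Hypothesis a01 : 0 < alpha < 1 / 2.
Hypothesis lsupp : supported_in l alpha (1 - alpha).
Hypothesis dl : forall u : R, 0 < u < 1 -> derivable l u 1.
Hypothesis h0 : 0 < h.
Hypothesis lh : hoelder_on01 h (derive1 l).
Variables (p : probability (measurableTypeR R) R) (X : nat -> {RV Pr >-> R}).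
Local Notation data n w := (fun i : 'I_n => X i w).
Local Notation prim := (primitive l).

(* The window [a, b] in LfunctionalE depends on the sample; [-N, N] works for N
   large enough, so L is a pointwise limit of measurable functions. *)
Lemma measurable_Lfunctional n (D : {set 'I_n}) : (0 < #|D|)%N ->
  measurable_fun setT (fun w => Lfunctional l (empirical (data n w) D)).
Proof.
move=> D0; pose E w y := mcdf (empirical (data n w) D) y.
have mE : measurable_fun setT (fun z : T * R => E z.1 z.2).
  under eq_fun do rewrite /E mcdf_empirical big_mkcond.
  apply: measurable_funM => //; apply: measurable_sum => i; case: (i \in D) => //.
  have mX : measurable_fun setT (fun z : T * R => X i z.1 : R).
    by apply: measurableT_comp; [exact: measurable_funPT|exact: measurable_fst].
  exact: (measurableT_comp measurable_le2 (measurable_fun_pair mX measurable_snd)).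
have [M hM] := primitive_bounded a01 lsupp dl h0 lh.
have mprim : measurable_fun setT prim.
  by apply: continuous_measurable_fun; exact: (primitive_continuous a01 lsupp dl).
have PE w : exists P : probability (measurableTypeR R) R,
    (P : {measure set (measurableTypeR R) -> \bar R}) = empirical (data n w) D.
  exact: empirical_probability.
have E01 w y : 0 <= E w y <= 1.
  by have [P Pw] := PE w; rewrite /E -Pw mcdf_ge0 mcdf_le1.
pose f (N : nat) (z : T * R) : R := \1_`[- N%:R, N%:R] z.2 * prim (E z.1 z.2).
have mab (N : nat) : @measurable _ (measurableTypeR R) `[- N%:R : R, N%:R]%classic.
  exact: measurable_itv.
have mf N : measurable_fun setT (f N).
  apply: measurable_funM; last exact: measurableT_comp.
  have := @measurable_indic _ _ R setT _ (mab N) => mi.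
  exact: (measurableT_comp mi measurable_snd).
have fM N z : `|f N z| <= M.
  rewrite normrM (le_trans _ (hM _ (E01 z.1 z.2)))// ler_piMl//.
  by rewrite indicE normr_nat lern1 leq_b1.
have f0 (N : nat) (w : T) (y : R) : ~ ([set: T] w /\ `[- N%:R : R, N%:R]%classic y) -> f N (w, y) = 0.
  move=> wy; rewrite /f/= indicE memNset ?mul0r// => yab.
  by apply: wy.
have PT : (Pr setT < +oo)%E by rewrite probability_setT ltry.
have mI N : measurable_fun setT (fun w => N%:R * prim 1 - \int[mu]_y f N (w, y)).
  apply: measurable_funB => //.
  exact: (@measurable_Rintegral2 R _ _ _ _ Pr mu setT _ (f N) M
    measurableT (mab N) PT (lebesgue_segment_lty _ _) (mf N) (fM N) (f0 N)).
apply: (@measurable_fun_cvg _ _ _ _ (fun N w => N%:R * prim 1 - \int[mu]_y f N (w, y))) => //.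
move=> w _; have [P Pw] := PE w.
have a0 : 0 < alpha by have /andP[] := a01.
have [u [v [Pu Pv]]] := mcdf_tails P a0.
apply: cvg_near_cst; exists (Num.truncn (`|u| + `|v|)).+1 => //= N Nn.
have NR : `|u| + `|v| <= N%:R.
  by rewrite (le_trans (ltW (truncnS_gt _)))// ler_nat.
have uv : - N%:R <= u /\ v <= N%:R.
  by have := ler_norm v; have := ler_norm (- u); rewrite normrN;
    have := normr_ge0 u; have := normr_ge0 v => *; split; lra.
have [Nu vN] := uv.
have := @LfunctionalE R alpha h l a01 lsupp dl h0 lh P (- N%:R) N%:R
  (le_lt_trans (mcdf_nd P Nu) Pu) (ltW (lt_le_trans Pv (mcdf_nd P vN))).
rewrite -Pw => ->; congr (_ - _).
by rewrite [RHS]Rintegral_indic_mkcond; apply: eq_Rintegral => y _; rewrite /f/= /E -Pw.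
Qed.

Lemma measurable_vjack n : measurable_fun setT (fun w => vjack l (data n w)).
Proof.
have [n2|n1] := ltnP 1 n; last first.
  have -> : (fun w => vjack l (data n w)) = cst 0.
    apply/funext => w; rewrite /vjack (_ : n.-1 = 0)%N ?invr0 ?mul0r//.
    by case: n n1 => [|[|n]].
  exact: measurable_cst.
have mps i : measurable_fun setT (fun w => pseudovalue l (data n w) i).
  apply: measurable_funB; apply: measurable_funM => //; apply: measurable_Lfunctional.
    by rewrite cardsT card_ord ltnW.
  by rewrite cardsC1 card_ord -subn1 subn_gt0.
apply: measurable_funM => //; apply: measurable_sum => i; apply: measurable_funX.
apply: measurable_funB => //; apply: measurable_funM => //.
by apply: measurable_sum => j.
Qed.

End jackknife_estimates.

Section jackknife_linearization.
Context {R : realType} d (T : measurableType d) (Pr : probability T R).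
Local Notation mu := (@lebesgue_measure R).
Variables (alpha h : R) (l : R -> R).
Hypothesis a01 : 0 < alpha < 1 / 2.
Hypothesis lsupp : supported_in l alpha (1 - alpha).
Hypothesis dl : forall u : R, 0 < u < 1 -> derivable l u 1.
Hypothesis h0 : 0 < h.
Hypothesis lh : hoelder_on01 h (derive1 l).
Variables (p : probability (measurableTypeR R) R) (X : nat -> {RV Pr >-> R}).
Hypothesis iidX : iid p X.
Local Notation data n w := (fun i : 'I_n => X i w).
Local Notation F := (mcdf p).
Variables (a b : R).
Hypotheses (pa : F a < alpha / 2) (pb : 1 - alpha / 2 < F b).
Local Notation goodn := (good X (alpha / 2) a b).
Hypothesis mgood : forall n, (0 < n)%N -> measurable (goodn n).
Hypothesis pgood : forall n, (0 < n)%N -> fine (Pr (~` goodn n)) <= 2 * (2^-1) ^+ n.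

Let a0 : 0 < alpha. Proof. by have /andP[] := a01. Qed.
Let a2 : alpha < 1 / 2. Proof. by have /andP[] := a01. Qed.

Let pa' : F a < alpha. Proof. by have := pa; have := a0; lra. Qed.
Let pb' : 1 - alpha < F b. Proof. by have := pb; have := a0; lra. Qed.

Let ab : a <= b. Proof. exact: mcdf_segment a2 pa' (ltW pb'). Qed.

Local Notation K := (limit_weight l p).
Local Notation D := (ecdf_dev p X).

Let mab : @measurable _ (measurableTypeR R) `[a, b]%classic.
Proof. exact: measurable_itv. Qed.

Definition jackn (n : nat) (w : T) : R :=
  Num.sqrt n%:R * (vjack l (data n w) - sigma2 l p).

Definition lin_stat (n : nat) (w : T) : R :=
  (Num.sqrt n%:R)^-1 * psum X (step_integral a b K p) n w.

Let Q n w := \int[mu]_(y in `[a, b]) D n w y ^+ 2.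

Let mD n w : measurable_fun setT (D n w).
Proof.
apply: measurable_funB; last exact: measurable_mcdf.
exact: (measurableT_comp (measurable_ecdf X n) (pair1_measurable w)).
Qed.

Let sqrt_inv n : (0 < n)%N -> Num.sqrt n%:R * n%:R^-1 = (Num.sqrt n%:R)^-1 :> R.
Proof.
move=> n0; have sn : 0 < Num.sqrt n%:R :> R by rewrite sqrtr_gt0 ltr0n.
by rewrite -[X in _ * X^-1](@sqr_sqrtr R)// expr2 invfM mulVKf ?mulfV ?gt_eqF// mulrA mulfV ?mul1r ?gt_eqF.
Qed.

Lemma vjack_inf_jack_good C n w : (forall u, `|ext01 l u| <= C) ->
  (forall u v, `|ext01 l u - ext01 l v| <= C * `|u - v|) ->
  (1 < n)%N -> goodn n w ->
  `|Num.sqrt n%:R * (vjack l (data n w) - inf_jack l (data n w))| <=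
  34 * (C * (b - a)) ^+ 2 / Num.sqrt n%:R.
Proof.
move=> lamC lamL n2 [ga gb].
have B := vjack_inf_jack_bound a01 lsupp dl h0 lh lamC lamL n2 ga gb.
rewrite normrM ger0_norm ?sqrtr_ge0// (le_trans (ler_wpM2l (sqrtr_ge0 _) B))//.
by rewrite mulrCA sqrt_inv// ltnW.
Qed.

Lemma jackn_lin_stat (e : R) : 0 < e -> exists c k : R, [/\ 0 <= c, 0 <= k &
  forall n w, (1 < n)%N -> goodn n w ->
  `|jackn n w - lin_stat n w| <= c / Num.sqrt n%:R + e + (e * n%:R + k * Num.sqrt n%:R) * Q n w].
Proof.
move=> e0; have [C [C0 lamC lamC' lamL]] := ext01_bounds a01 lsupp dl h0 lh.
pose e' := e / (b - a + 1).
have ba1 : 0 < b - a + 1 by rewrite ltr_wpDl// subr_ge0.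
have e'0 : 0 < e' by rewrite divr_gt0.
have e'e : e' <= e.
  by rewrite ler_pdivrMr// ler_peMr ?(ltW e0)// lerDr subr_ge0.
have [k [k0 expand]] := sigma2_expansion a01 lsupp dl h0 lh pa' pb' e'0.
exists (34 * (C * (b - a)) ^+ 2), k; split=> //.
  by rewrite mulr_ge0// sqr_ge0.
move=> n w n2 gw; have n0 : (0 < n)%N by rewrite ltnW.
have nR : 0 < n%:R :> R by rewrite ltr0n.
have sn0 : 0 <= Num.sqrt n%:R :> R by exact: sqrtr_ge0.
have [ga gb] := gw.
have [MK KM] := limit_weight_bounded a01 lsupp dl h0 lh pa' pb'.
have mK := measurable_limit_weight a01 lsupp dl h0 lh pa' pb'.
have cardT : (0 < #|[set: 'I_n]%SET|)%N by rewrite cardsT card_ord.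
have [q Pq] := empirical_probability (data n w) cardT.
have qE y : mcdf q y = ecdf X n w y by rewrite /ecdf -Pq.
have Dq y : D n w y = mcdf q y - F y by rewrite qE.
have qa : mcdf q a < alpha by rewrite qE; have := ga; have := a0; lra.
have qb : 1 - alpha < mcdf q b by rewrite qE; have := gb; have := a0; lra.
have ex := expand q (D n w) qa qb Dq.
have iE : inf_jack l (data n w) = sigma2 l q.
  by rewrite (inf_jackE a01 lsupp dl h0 lh n2 ga gb) -Pq.
have lE : lin_stat n w = Num.sqrt n%:R * \int[mu]_(y in `[a, b]) (D n w y * K y).
  exact: (psum_step_integral p X a b mK KM w n0).
have -> : jackn n w - lin_stat n w =
    Num.sqrt n%:R * (vjack l (data n w) - inf_jack l (data n w)) +
    Num.sqrt n%:R * (sigma2 l q - sigma2 l p - \int[mu]_(y in `[a, b]) (D n w y * K y)).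
  have alg (r v s j I : R) : r * (v - s) - r * I = r * (v - j) + r * (j - s - I) by ring.
  by rewrite lE /jackn iE; exact: alg.
apply: le_trans (ler_normD _ _) _; rewrite -[leRHS]addrA; apply: lerD.
  exact: (vjack_inf_jack_good lamC lamL n2 gw).
rewrite normrM (ger0_norm sn0); apply: le_trans (ler_wpM2l sn0 ex) _.
have D2 y : `|D n w y ^+ 2| <= 1 by rewrite normrX exprn_ile1// ecdf_dev_le1.
have i1 : mu.-integrable `[a, b] (EFin \o (fun y => e' * `|D n w y| + k * D n w y ^+ 2)).
  apply: (@integrable_segment R a b _ (e' + k)).
    apply: measurable_funD; apply: measurable_funM => //; last exact: measurable_funX.
    exact: measurableT_comp.
  move=> y _; apply: le_trans (ler_normD _ _) _; apply: lerD.
    by rewrite normrM (gtr0_norm e'0) normr_id ler_piMr ?(ltW e'0)// ecdf_dev_le1.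
  by rewrite normrM (ger0_norm k0) ler_piMr.
have i2 : mu.-integrable `[a, b] (EFin \o (fun y => D n w y ^+ 2)).
  apply: (@integrable_segment R a b _ 1); first exact: measurable_funX.
  by move=> y _; exact: D2.
pose s := e' * n%:R + k * Num.sqrt n%:R.
have i3 : mu.-integrable `[a, b] (EFin \o cst e').
  apply: (@integrable_segment R a b _ e') => //.
  by move=> y _ /=; rewrite gtr0_norm.
rewrite -(RintegralZl (Num.sqrt n%:R) mab i1).
apply: (@le_trans _ _ (\int[mu]_(y in `[a, b]) (e' + s * D n w y ^+ 2))).
  apply: (le_Rintegral mab (integrable_EFinZ mab _ i1)
    (integrable_EFinD mab i3 (integrable_EFinZ mab s i2))) => y _.
  have alg (r x : R) : 0 <= x -> r * (e' * x + k * x ^+ 2) <= e' + (e' * r ^+ 2 + k * r) * x ^+ 2.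
    move=> x0; have H : 0 <= e' * (1 - r * x + (r * x) ^+ 2).
      apply: mulr_ge0; first exact: ltW.
      have := sqr_ge0 (r * x - 1 / 2).
      have -> : (r * x - 1 / 2) ^+ 2 = (r * x) ^+ 2 - r * x + 1 / 4 by field.
      by lra.
    rewrite -subr_ge0; apply: le_trans H _.
    by rewrite le_eqVlt; apply/orP; left; apply/eqP; ring.
  have := alg (Num.sqrt n%:R) _ (normr_ge0 (D n w y)).
  by rewrite (sqr_sqrtr (ltW nR)) (real_normK (num_real (D n w y))).
rewrite (RintegralD mab i3 (integrable_EFinZ mab s i2)) (RintegralZl s mab i2).
apply: lerD.
  have := @Rintegral_segment_bounded R a b (cst e') e' ab.
  move=> /(_ (measurable_cst _) (fun y _ => ltac:(by rewrite /= gtr0_norm)))/(le_trans (ler_norm _))/le_trans; apply.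
  by rewrite /e' mulrAC ler_pdivrMr// ler_pM2l// lerDl.
apply: ler_wpM2r.
  by apply: Rintegral_ge0 => y _; exact: sqr_ge0.
by rewrite lerD2r ler_wpM2r.
Qed.

Lemma measurable_jackn n : measurable_fun setT (jackn n).
Proof.
apply: measurable_funM => //; apply: measurable_funB => //.
exact: (measurable_vjack a01 lsupp dl h0 lh X n).
Qed.

Let mK := measurable_limit_weight a01 lsupp dl h0 lh pa' pb'.

Lemma measurable_lin_stat n : measurable_fun setT (lin_stat n).
Proof.
have [MK KM] := limit_weight_bounded a01 lsupp dl h0 lh pa' pb'.
apply: measurable_funM => //; apply: measurable_psum.
exact: (measurable_step_integral ab mK KM).
Qed.

Let sqrt_le_pow2 n : Num.sqrt n%:R <= 2 ^+ n :> R.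
Proof.
have p1 : 1 <= 2 ^+ n :> R by rewrite exprn_ege1//; lra.
have p0 : 0 <= 2 ^+ n :> R by apply: le_trans p1.
rewrite -(@ler_sqr R) ?nnegrE ?sqrtr_ge0// sqr_sqrtr//.
rewrite (@le_trans _ _ (2 ^+ n))//; last by rewrite expr2 ler_peMr.
by rewrite -natrX ler_nat ltnW// ltn_expl.
Qed.

Lemma jackn_lin_stat_cvg (e : R) : 0 < e -> \forall n \near \oo,
  \int[Pr]_w Num.min 1 `|jackn n w - lin_stat n w| <= e.
Proof.
move=> e0; have ba : 0 <= b - a by rewrite subr_ge0.
pose e1 := e / (2 * (b - a + 1)).
have ba2 : 0 < 2 * (b - a + 1) by rewrite mulr_gt0// ltr_wpDl.
have e10 : 0 < e1 by rewrite divr_gt0.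
have e1E : e1 + e1 * (b - a) = e / 2 by rewrite /e1; field; rewrite gt_eqF// ltr_wpDl.
have [c [k [c0 k0 H]]] := jackn_lin_stat e10.
pose c' := c + k * (b - a) + 2.
have c'0 : 0 <= c' by rewrite !addr_ge0// mulr_ge0.
exists (Num.truncn ((c' / (e / 2)) ^+ 2)).+2 => // n /= Nn.
have n2 : (1 < n)%N by apply: leq_trans Nn.
have n0 : (0 < n)%N by rewrite ltnW.
have nR : 0 < n%:R :> R by rewrite ltr0n.
have sn0 : 0 < Num.sqrt n%:R :> R by rewrite sqrtr_gt0.
have c'n : c' / Num.sqrt n%:R <= e / 2.
  rewrite ler_pdivrMr// mulrC -ler_pdivrMr ?divr_gt0//.
  rewrite (le_trans (ler_norm _))// -sqrtr_sqr ler_wsqrtr//.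
  by rewrite (le_trans (ltW (truncnS_gt _)))// ler_nat ltnW.
have mg := mgood n0; have mb : measurable (~` goodn n) by exact: measurableC.
have [iQ EQ] := ecdf_dev_integral_square iidX ab n0.
have mJ : measurable_fun setT (fun w => Num.min 1 `|jackn n w - lin_stat n w|).
  apply: (@measurable_minr _ _ _ setT (cst 1)) => //; apply: measurableT_comp => //.
  by apply: measurable_funB; [exact: measurable_jackn|exact: measurable_lin_stat].
have bJ w : `|Num.min 1 `|jackn n w - lin_stat n w| | <= 1.
  by rewrite ger0_norm ?ge_min ?lexx// le_min ler01 normr_ge0.
have iJ := integrable_prob_bounded Pr mJ bJ.
have iB : Pr.-integrable setT (EFin \o (\1_(~` goodn n) : T -> R)).
  apply: (@integrable_prob_bounded _ _ _ Pr _ 1); first exact: measurable_indic.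
  by move=> w; rewrite indicE normr_nat lern1 leq_b1.
pose s := e1 * n%:R + k * Num.sqrt n%:R.
have s0 : 0 <= s by rewrite addr_ge0// mulr_ge0// ltW.
pose r := c / Num.sqrt n%:R + e1.
have r0 : 0 <= r by rewrite addr_ge0 ?divr_ge0// ltW.
have Q0 w : 0 <= Q n w by apply: Rintegral_ge0 => y _; exact: sqr_ge0.
have pw w : Num.min 1 `|jackn n w - lin_stat n w| <= r + 1 * \1_(~` goodn n) w + s * Q n w.
  rewrite indicE mul1r; have [gw|gw] := pselect (goodn n w).
    rewrite memNset; last by move=> /(_ gw).
    by rewrite addr0 ge_min (H n w n2 gw) orbT.
  by rewrite mem_set//= ge_min; apply/orP; left; have := mulr_ge0 s0 (Q0 w); have := r0; lra.
have := le_Rintegral_prob iJ (integrable_prob_affine2 r 1 s iB iQ) pw.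
move=> /le_trans; apply; rewrite (Rintegral_prob_affine2 r 1 s iB iQ) mul1r.
rewrite (Rintegral_prob_indic Pr mb).
have Pb : fine (Pr (~` goodn n)) <= 2 / Num.sqrt n%:R.
  apply: le_trans (pgood n0) _; rewrite exprVn ler_wpM2l// lef_pV2 ?posrE ?exprn_gt0//.
apply: le_trans (lerD (lerD (lexx r) Pb) (ler_wpM2l s0 EQ)) _.
have -> : s * ((b - a) / n%:R) = e1 * (b - a) + k * (b - a) / Num.sqrt n%:R.
  rewrite -(sqrt_inv n0) /s; field; exact: lt0r_neq0.
have -> : r + 2 / Num.sqrt n%:R + (e1 * (b - a) + k * (b - a) / Num.sqrt n%:R) =
    (e1 + e1 * (b - a)) + c' / Num.sqrt n%:R.
  by rewrite /r /c'; ring.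
by rewrite e1E; lra.
Qed.

Hypothesis egood : {ae Pr, forall w, \forall n \near \oo, goodn n w}.

Lemma jackn_ijackn_big_Os :
  big_Os Pr (fun n w => jackn n w - Num.sqrt n%:R * (inf_jack l (data n w) - sigma2 l p))
    (fun n => n%:R `^ (1 / 2 - h)).
Proof.
have [C [C0 lamC lamC' lamL]] := ext01_bounds a01 lsupp dl h0 lh.
apply: filterS egood => w gw; exists (34 * (C * (b - a)) ^+ 2).
near=> n.
have n2 : (1 < n)%N by near: n; exists 2%N.
have gn : goodn n w by near: n.
have nR : 0 < n%:R :> R by rewrite ltr0n ltnW.
have -> : jackn n w - Num.sqrt n%:R * (inf_jack l (data n w) - sigma2 l p) =
    Num.sqrt n%:R * (vjack l (data n w) - inf_jack l (data n w)).
  by rewrite /jackn; ring.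
have [h1|h1] := leP h 1.
  apply: le_trans (vjack_inf_jack_good lamC lamL n2 gn) _.
  apply: ler_wpM2l; first by rewrite mulr_ge0// sqr_ge0.
  rewrite -[X in X^-1]powR12_sqrt; last exact: ltW.
  rewrite -powRN; apply: ler_powR; first by rewrite ler1n ltnW. by lra.
(* For h > 1 the previous bound holds with C = 0. *)
have l0 := ext01_hoelder_gt1 a01 lsupp dl h0 lh h1.
have lam0 u : `|ext01 l u| <= 0 by rewrite l0 normr0.
have lamL0 u v : `|ext01 l u - ext01 l v| <= 0 * `|u - v| by rewrite !l0 subrr normr0 mul0r.
apply: le_trans (vjack_inf_jack_good lam0 lamL0 n2 gn) _.
rewrite mul0r expr0n mulr0 mul0r; apply: mulr_ge0; last exact: powR_ge0.
by rewrite mulr_ge0// sqr_ge0.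
Unshelve. all: by end_near. Qed.

End jackknife_linearization.

Theorem proposition3 (R : realType) (alpha h : R) (l : R -> R)
    (p : probability (measurableTypeR R) R)
    (d : measure_display) (T : measurableType d) (Pr : probability T R)
    (X : nat -> {RV Pr >-> R})
    (d' : measure_display) (T' : measurableType d') (Pr' : probability T' R)
    (W : R -> {RV Pr' >-> R}) :
  0 < alpha < 1 / 2 ->
  (forall u : R, 0 < u < 1 -> {for u, continuous l}) ->
  supported_in l alpha (1 - alpha) ->
  iid p X ->
  (forall x : R, p [set x] = 0%E) ->
  (forall u : R, 0 < u < 1 -> derivable l u 1) ->
  1 / 2 < h ->
  hoelder_on01 h (derive1 l) ->
  brownian_bridge W ->
  let data n w : 'I_n -> R := fun i => X i w in
  let B t : T' -> R := W (mcdf p t) in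
  let jack n w := Num.sqrt n%:R * (vjack l (data n w) - sigma2 l p) in
  let ijack n w := Num.sqrt n%:R * (inf_jack l (data n w) - sigma2 l p) in
  let limit w := limit_Y l p (B ^~ w) + limit_Z l p (B ^~ w) in
  [/\ big_Os Pr (fun n w => jack n w - ijack n w)
        (fun n => n%:R `^ (1 / 2 - h)),
      gaussian Pr' limit
    & cvg_in_law Pr Pr' jack limit].
Proof.
move=> a01 _ lsupp iidX _ dl h12 lh bW data B jack ijack limit.
have h0 : 0 < h by lra.
have b0 : 0 < alpha / 2 by have /andP[a0 _] := a01; lra.
have [a [b [pa pb mgood pgood]]] := good_probability iidX b0.
have egood := good_eventually mgood pgood.
have pa' : mcdf p a < alpha by have /andP[a0 _] := a01; lra.
have pb' : 1 - alpha < mcdf p b by have /andP[a0 _] := a01; lra.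
have ab : a <= b by have /andP[_ a2] := a01; exact: mcdf_segment a2 pa' (ltW pb').
have mK := measurable_limit_weight a01 lsupp dl h0 lh pa' pb'.
have [MK KM] := limit_weight_bounded a01 lsupp dl h0 lh pa' pb'.
have [mG gG fG] := bridge_integral_gaussian ab mK KM p bW.
have limitE : limit = (fun w => \int[@lebesgue_measure R]_(y in `[a, b])
    (W (mcdf p y) w * limit_weight l p y)).
  apply/funext => w; have [M hM] := bridge_path_bounded p bW w.
  exact: (limit_YZ a01 lsupp dl h0 lh pa' pb' (measurable_bridge_path p bW w) hM).
rewrite limitE; split => //.
  exact: (jackn_ijackn_big_Os a01 lsupp dl h0 lh p egood).
apply: (@cvg_in_law_taylor R _ T Pr _ T' Pr' _ _ _ mG (lin_stat l p X a b)).
- exact: (measurable_jackn a01 lsupp dl h0 lh p X).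
- exact: (measurable_lin_stat a01 lsupp dl h0 lh X pa pb).
- exact: (jackn_lin_stat_cvg a01 lsupp dl h0 lh iidX pa pb mgood pgood).
- move=> f C tf; have [f1 [f2 [M [_ _ fM _]]]] := tf.
  have cf : continuous f by exact: (taylor_continuous tf).
  have fM' x : `|f x| <= M by have [] := fM x.
  rewrite (fG f M cf fM').
  exact: (clt_taylor normal_id_integrable normal_square_integrable normal_cube_integrable
    normal_mean normal_variance normal_stable iidX
    (measurable_step_integral ab mK KM p) (step_integral_bounded ab mK KM p)
    (step_integral_mean ab mK KM p) erefl tf).
Qed.
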